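(* Let $R$ be a computable integral domain with field of fractions $K$, and assume that HTP$(K)$ is undecidable. Then: (i) for every $\delta>0$, the set $IADR_R(\delta)\cap T_R$ is $\Sigma^0_1$-complete; (ii) for every $\delta>0$, the set $IMDR_R(\delta)\cap H_R$ is $\Sigma^0_1$-complete; (iii) for every $\ell\in\mathbb{N}$, the sets $PR_R(\ell)$, $IPR_R(\ell)$, $PR_R(\ell)\cap H_R$ and $IPR_R(\ell)\cap H_R$ are $\Sigma^0_1$-complete; (iv) the sets $PR_R$, $IPR_R$, $PR_R\cap H_R$ and $IPR_R\cap H_R$ are $\Sigma^0_1$-hard. Moreover, all of the sets in (i)–(iii) are $\Sigma^0_1$-universal.
   Context: A computable integral domain is a countably infinite integral domain $R$ together with a bijection $\phi:R\to\mathbb{N}$ such that the induced addition and multiplication on $\mathbb{N}$ are computable. Via $\phi$, polynomials in $\bigcup_{n\ge1}R[x_1,\dots,x_n]$ are coded by natural numbers, so sets of such polynomials are regarded as subsets of $\mathbb{N}$. A set $A\subseteq\mathbb{N}$ is $\Sigma^0_1$ if there is a computable $B\subseteq\mathbb{N}^2$ with $n\in A\iff\exists m\,(n,m)\in B$; $\Pi^0_n$ sets are complements of $\Sigma^0_n$ sets, and $\Sigma^0_{n}$ sets are those of the form $\{n:\exists m\,(n,m)\in B\}$ with $B$ a $\Pi^0_{n-1}$ set. $A$ is $\Sigma^0_n$-complete if $A\in\Sigma^0_n$ and $A\notin\Pi^0_n$; $A$ is $\Sigma^0_n$-universal if every $\Sigma^0_n$ set $B\subseteq\mathbb{N}$ is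 computably reducible to $A$ (there is a computable $f$ with $n\in B\iff f(n)\in A$); $\Sigma^0_n$-hard means every $\Sigma^0_n$ set is computably reducible to $A$. ''HTP$(K)$ is undecidable'' means: every $\Sigma^0_1$ subset of $\mathbb{N}^k$ is computably reducible to the set of polynomials over $K$ having a root in $K$. Notation: $d^*$ denotes upper Banach density in the group $(R,+)$ and $d^*_\times$ upper Banach density in the semigroup $(R\setminus\{0\},\cdot)$, where for a countable cancellative left amenable semigroup $S$ and $A\subseteq S$, $d^*(A)=\sup_{\mathcal F}\limsup_{n}|A\cap F_n|/|F_n|$, the supremum over all left Følner sequences $\mathcal F=(F_n)$ (finite sets with $|sF_n\triangle F_n|/|F_n|\to0$ for all $s\in S$). An injective root of $p(x_1,\dots,x_n)$ is a root $(a_1,\dots,a_n)$ with $a_i\ne a_j$ for $i\ne j$. $H_R$: the set of homogeneous polynomials in $\bigcup_n R[x_1,\dots,x_n]$; $T_R$: the set of polynomials with $p(x_1+r,\dots,x_n+r)=p(x_1,\dots,x_n)$ for all $r\in R$. $IADR_R(\delta)$: polynomials $p$ over $R$ such that every $B\subseteq R$ with $d^*(B)\ge\delta$ contains an injective root of $p$ (all coordinates in $B$). $IMDR_R(\delta)$: same with $d^*_\times(B)\ge\delta$ (density of $B\setminus\{0\}$ in $(R\setminus\{0\},\cdot)$). $PR_R(\ell)$ ($IPR_R(\ell)$): polynomials $p$ such that for every partition $R\setminus\{0\}=C_1\cup\dots\cup C_\ell$ some $C_{i_0}$ contains a (an injective) root of $p$, i.e. $a_1,\dots,a_n\in C_{i_0}$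 (distinct) with $p(a_1,\dots,a_n)=0$. $PR_R=\bigcap_\ell PR_R(\ell)$, $IPR_R=\bigcap_\ell IPR_R(\ell)$.
   Formalization: In (i),(ii) δ is taken in (0,1] (for δ>1 the sets are decidable), and Σ⁰₁-completeness is claimed only when the rationals below δ are computably enumerable (otherwise membership in Σ⁰₁ fails); ''not Π⁰₁'' and universality are proved for all δ in (0,1]. *)

(* Defs.v *)
(* The notations of multinomials clash with those of mathcomp-analysis and are
   not imported. *)
From HB Require Import structures.
From mathcomp Require Import all_boot all_order all_algebra.
From mathcomp Require Import finmap boolp classical_sets reals ereal topology.
From mathcomp Require Import normedtype sequences.
From mathcomp Require Import -(notations) mpoly.

Set Implicit Arguments.
Unset Strict Implicit.
Unset Printing Implicit Defensive.

Import Order.TTheory GRing.Theory Num.Theory.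
Import numFieldNormedType.Exports.

Local Open Scope classical_set_scope.
Local Open Scope ring_scope.

(* Kleene's mu-recursive functions. *)
Inductive mu_code : Type :=
| MuZero
| MuSucc
| MuProj of nat
| MuComp of mu_code & seq mu_code
| MuRec of mu_code & mu_code
| MuMin of mu_code.

(* [mu_eval c v y]: the program c halts on the argument list v with output y.
   [mu_evals cs v w]: the programs cs all halt on v, with list of outputs w.
   In [MuMin c], c must halt with a nonzero output below the least zero. *)
Inductive mu_eval : mu_code -> seq nat -> nat -> Prop :=
| mu_eval_zero v : mu_eval MuZero v 0
| mu_eval_succ x v : mu_eval MuSucc (x :: v) x.+1
| mu_eval_proj i v : (i < size v)%N -> mu_eval (MuProj i) v (nth 0%N v i)
| mu_eval_comp c cs v w y :
    mu_evals cs v w -> mu_eval c w y -> mu_eval (MuComp c cs) v y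
| mu_eval_rec0 c d v y : mu_eval c v y -> mu_eval (MuRec c d) (0%N :: v) y
| mu_eval_recS c d n v r y :
    mu_eval (MuRec c d) (n :: v) r -> mu_eval d (n :: r :: v) y ->
    mu_eval (MuRec c d) (n.+1 :: v) y
| mu_eval_min c v n (r : nat -> nat) :
    (forall i, (i < n)%N -> mu_eval c (i :: v) (r i).+1) ->
    mu_eval c (n :: v) 0 -> mu_eval (MuMin c) v n
with mu_evals : seq mu_code -> seq nat -> seq nat -> Prop :=
| mu_evals_nil v : mu_evals [::] v [::]
| mu_evals_cons c cs v y w :
    mu_eval c v y -> mu_evals cs v w -> mu_evals (c :: cs) v (y :: w).

Definition computable_fun k (f : k.-tuple nat -> nat) : Prop :=
  exists c : mu_code, forall v : k.-tuple nat, mu_eval c v (f v).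

Definition computable_set k (B : set (k.-tuple nat)) : Prop :=
  computable_fun (fun v => nat_of_bool (v \in B)).

Definition Sigma01 k (A : set (k.-tuple nat)) : Prop :=
  exists2 B : set (k.+1.-tuple nat), computable_set B &
    forall v, A v <-> exists m : nat, B [tuple of rcons v m].

Definition Pi01 k (A : set (k.-tuple nat)) : Prop := Sigma01 (~` A).

(* Subsets of nat as subsets of nat^1. *)
Definition unary (A : set nat) : set (1.-tuple nat) := [set v | A (thead v)].

Definition computably_reducible k (B : set (k.-tuple nat)) (A : set nat) : Prop :=
  exists2 f : k.-tuple nat -> nat, computable_fun f & forall v, B v <-> A (f v).

Definition Sigma01_complete (A : set nat) : Prop :=
  Sigma01 (unary A) /\ ~ Pi01 (unary A).

Definition Sigma01_hard (A : set nat) : Prop :=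
  forall B : set nat, Sigma01 (unary B) -> computably_reducible (unary B) A.

Definition Sigma01_universal (A : set nat) : Prop := Sigma01_hard A.

(* delta is left-c.e.: the rationals a / (b + 1) below delta form a Sigma^0_1
   set.  Every computable real, in particular every rational, is left-c.e. *)
Definition left_ce (rT : realType) (delta : rT) : Prop :=
  Sigma01 [set v : 2.-tuple nat |
    (tnth v ord0)%:R / (tnth v ord_max).+1%:R < delta].

(* The bijection phi is [num], with inverse [elt]. *)
Record computable_domain (R : idomainType) := ComputableDomain {
  num : R -> nat;
  elt : nat -> R;
  numK : cancel num elt;
  eltK : cancel elt num;
  computable_add : computable_fun
    (fun v : 2.-tuple nat => num (elt (tnth v ord0) + elt (tnth v ord_max)));
  computable_mul : computable_fun
    (fun v : 2.-tuple nat => num (elt (tnth v ord0) * elt (tnth v ord_max)))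
}.

(* A set of polynomials over F in any number of variables: [P n] is its part in
   F[x_1, ..., x_n].  The number n of variables is part of the data of a
   polynomial, because the notion of an injective root depends on it. *)
Definition poly_set (F : nzRingType) := forall n, set (mpoly n F).

Definition poly_setI (F : nzRingType) (P Q : poly_set F) : poly_set F :=
  fun n => P n `&` Q n.

Section Numbering.
Variables (F : nzRingType) (nu : nat -> F).

(* The number coding [:: c; e_1; ...; e_n] denotes the term
   nu(c) x_1^e_1 ... x_n^e_n (missing exponents being 0). *)
Definition term_of n (t : nat) : mpoly n F :=
  let l := CodeSeq.decode t in
  nu (nth 0%N l 0) *:
    mpolyX F (Multinom [tuple nth 0%N l i.+1 | i < n]).

(* [:: n; t_1; ...; t_m] denotes the polynomial t_1 + ... + t_m in n + 1
   variables. *)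
Definition poly_of_seq (s : seq nat) : mpoly (head 0%N s).+1 F :=
  \sum_(t <- behead s) term_of _ t.

(* The set of all codes of the members of P that have at least one variable.
   A polynomial has several codes, but equality of the coded polynomials is
   decidable when equality of the coded coefficients is. *)
Definition codes (P : poly_set F) : set nat :=
  [set k | P _ (poly_of_seq (CodeSeq.decode k))].

Lemma codes_surj (nu_surj : forall x, exists c, nu c = x)
    n (p : mpoly n.+1 F) :
  exists k, forall P : poly_set F, codes P k <-> P n.+1 p.
Proof.
have [g gK] := choice nu_surj.
pose t (m : multinom n.+1) :=
  CodeSeq.code (g (mcoeff m p) :: multinom_val m).
exists (CodeSeq.code (n :: map t (msupp p))) => P.
rewrite /codes /mkset CodeSeq.codeK /poly_of_seq [behead _]/= big_map.
suff -> : \sum_(m <- msupp p) term_of n.+1 (t m) = p by [].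
rewrite [RHS]mpolyE; apply: eq_bigr => m _.
rewrite /term_of /t CodeSeq.codeK [nth _ _ _]/= gK; congr (_ *: mpolyX _ _).
case: m => m /=; congr (Multinom _); apply: eq_from_tnth => i.
by rewrite tnth_mktuple (tnth_nth 0%N).
Qed.

End Numbering.

(* [:: a; b] codes the fraction elt(a) / elt(b), read as 0 when elt(b) = 0. *)
Definition frac_elt (R : idomainType) (phi : computable_domain R) (c : nat) :
    {fraction R} :=
  let l := CodeSeq.decode c in
  tofrac (elt phi (nth 0%N l 0)) / tofrac (elt phi (nth 0%N l 1)).

Definition has_root (F : nzRingType) : poly_set F :=
  fun n => [set p | exists a : 'I_n -> F, meval a p = 0].

Definition HTP_undecidable (R : idomainType) (phi : computable_domain R) : Prop :=
  forall k (B : set (k.-tuple nat)), Sigma01 B ->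
    computably_reducible B (codes (frac_elt phi) (@has_root {fraction R})).

Section Density.
Variables (S : choiceType) (op : S -> S -> S) (rT : realType).

Definition left_translate (s : S) (A : {fset S}) : {fset S} :=
  [fset op s x | x in A]%fset.

Definition fset_symdiff (A B : {fset S}) : {fset S} :=
  ((A `\` B) `|` (B `\` A))%fset.

Definition left_Folner (F : nat -> {fset S}) : Prop :=
  (forall n, F n != fset0) /\
  forall s : S,
    (fun n => (#|` fset_symdiff (left_translate s (F n)) (F n)|)%:R
              / (#|` F n|)%:R : rT) @ \oo --> (0 : rT).

Definition upper_density_along (F : nat -> {fset S}) (A : set S) : \bar rT :=
  limn_esup (fun n => ((#|` [fset x in F n | x \in A]%fset|)%:R
                       / (#|` F n|)%:R : rT)%:E).

Definition upper_Banach_density (A : set S) : \bar rT :=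
  ereal_sup [set upper_density_along F A | F in left_Folner].

End Density.

Section RamseySets.
Variables (R : idomainType) (rT : realType).

Definition nonzero := {x : R | x != 0}.

Definition nonzero_mul (x y : nonzero) : nonzero :=
  exist _ (val x * val y) (mulf_neq0 (valP x) (valP y)).

Definition add_density (B : set R) : \bar rT :=
  @upper_Banach_density R +%R rT B.

Definition mul_density (B : set R) : \bar rT :=
  @upper_Banach_density nonzero nonzero_mul rT [set x | B (val x)].

Definition root_in n (p : mpoly n R) (B : set R) : Prop :=
  exists a : 'I_n -> R, (forall i, B (a i)) /\ meval a p = 0.

Definition inj_root_in n (p : mpoly n R) (B : set R) : Prop :=
  exists a : 'I_n -> R,
    [/\ injective a, forall i, B (a i) & meval a p = 0].

Definition homogeneous : poly_set R := fun n =>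
  [set p | exists d : nat, p \is ishomog1 d (@mdeg n)].

(* p(x_1 + r, ..., x_n + r) = p(x_1, ..., x_n), as an identity of polynomials. *)
Definition translation_invariant : poly_set R := fun n =>
  [set p | forall r : R,
    comp_mpoly
      [tuple mpolyX R (mnm1 i) + mpolyC n r | i < n] p = p].

Definition IADR (delta : rT) : poly_set R := fun n =>
  [set p | forall B : set R, (delta%:E <= add_density B)%E -> inj_root_in p B].

Definition IMDR (delta : rT) : poly_set R := fun n =>
  [set p | forall B : set R, (delta%:E <= mul_density B)%E -> inj_root_in p B].

(* Some of the C i may be empty. *)
Definition nonzero_partition l (C : 'I_l -> set R) : Prop :=
  trivIset setT C /\ \bigcup_i C i = [set x | x != 0].

Definition PRl (l : nat) : poly_set R := fun n =>
  [set p | forall C : 'I_l -> set R, nonzero_partition C ->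
    exists i0, root_in p (C i0)].

Definition IPRl (l : nat) : poly_set R := fun n =>
  [set p | forall C : 'I_l -> set R, nonzero_partition C ->
    exists i0, inj_root_in p (C i0)].

Definition PR : poly_set R := fun n =>
  [set p | forall l, (0 < l)%N -> PRl l p].

Definition IPR : poly_set R := fun n =>
  [set p | forall l, (0 < l)%N -> IPRl l p].

End RamseySets.

(* Main.v *)
(* Clear denominators in a polynomial p over K and homogenize it to P(x_0, ..., x_n).
   Replace each x_i, i > 0, by a sum of two differences of new variables, and x_0
   by one more difference (for the densities) or by a single variable (for the
   partitions).  An injective root of the result, respectively a root in R \ {0},
   has x_0 <> 0 and hence yields a root of p in K.  Conversely, as R is infinite,
   a root of p yields nonzero b_j such that a set contains an injective root of
   the new polynomial as soon as it contains disjoint pairs with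
   y_j - z_j = r b_j for a common r <> 0.  There are finite sets T, of nonzero
   elements, all of whose subsets of density at least eps contain such pairs: by
   pigeonhole two of many translates of a product set meet, so Szemeredi's theorem
   is not needed.  For colourings, Brauer's induction on the number of colours
   moreover puts r b_0 in the same class.  The new polynomial is homogeneous, and
   translation invariant when x_0 is a difference, so that in a set of positive
   upper Banach density one finds a dense part of a dilate or translate of T.

   The properties are Sigma^0_1 by compactness.  A partition property is decided
   by the colourings of the first N elements for some N.  A polynomial with an
   invariance property is density regular for delta if and only if some finite T
   has only root-free subsets of size less than delta |T|: otherwise suitable dilates
   of root-free sets that are dense in ever larger Folner sets accumulate at a
   root-free set of density at least delta.

   A Sigma^0_1-hard set is not Pi^0_1, since the halting problem is not. *)
From mathcomp Require Import all_boot all_order all_algebra zify ring lra.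
From mathcomp Require Import generic_quotient finmap boolp classical_sets reals.
From mathcomp Require Import ereal topology normedtype sequences.
From mathcomp Require Import -(notations) mpoly.
Require Import Defs.

Set Implicit Arguments.
Unset Strict Implicit.
Unset Printing Implicit Defensive.

(** * Computable functions *)

(** The target polynomials depend neither on delta nor on the number of colours: one computable map
    serves both densities, and a second one serves all the partition properties. Each x_i becomes a
    sum of two differences because a difference of distinct elements never vanishes while x_i may be
    0; x_i is split as t + (x_i - t) with both summands nonzero. The unknown common factor r of all
    the differences is harmless by homogeneity.

    On the semidecidable side the obstacle is that upper Banach density is a supremum over all
    Folner sequences, attained or not, so density regularity is not visibly arithmetical. The finite
    criterion leaves only a strict inequality m / |T| < delta, and this is where [left_ce] enters.
    For this equivalence the limit of the root-free sets must have density at least delta itself,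
    with no epsilon lost; the weighted windows in [exists_free_of_density] achieve this. *)

Definition mu_computable k (f : seq nat -> nat) :=
  exists c, forall v, size v = k -> mu_eval c v (f v).

Lemma mu_evals_map (I : eqType) (s : seq I) (c : I -> mu_code) v w :
  (forall i, i \in s -> mu_eval (c i) v (w i)) -> mu_evals (map c s) v (map w s).
Proof.
elim: s => [|i s IHs] Hs /=; first exact: mu_evals_nil.
apply: mu_evals_cons; first by apply: Hs; rewrite mem_head.
by apply: IHs => j js; apply: Hs; rewrite inE js orbT.
Qed.

Lemma mu_evals_proj v : mu_evals [seq MuProj i | i <- iota 0 (size v)] v v.
Proof.
rewrite -{3}(mkseq_nth 0 v); apply: mu_evals_map => i; rewrite mem_iota /= => lt_i.
exact: mu_eval_proj.
Qed.

Lemma mu_computable_proj k i : i < k -> mu_computable k (fun v => nth 0 v i).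
Proof. by move=> ik; exists (MuProj i) => v sv; apply: mu_eval_proj; rewrite sv. Qed.

Lemma mu_computable_comp1 k (op : nat -> nat) f :
  mu_computable 1 (fun v => op (nth 0 v 0)) -> mu_computable k f ->
  mu_computable k (fun v => op (f v)).
Proof.
move=> [c Hc] [d Hd]; exists (MuComp c [:: d]) => v sv.
apply: (mu_eval_comp (w := [:: f v])); last exact: (Hc [:: f v]).
by apply: mu_evals_cons; [exact: Hd | exact: mu_evals_nil].
Qed.

Lemma mu_computable_comp2 k (op : nat -> nat -> nat) f g :
  mu_computable 2 (fun v => op (nth 0 v 0) (nth 0 v 1)) ->
  mu_computable k f -> mu_computable k g ->
  mu_computable k (fun v => op (f v) (g v)).
Proof.
move=> [c Hc] [d Hd] [e He]; exists (MuComp c [:: d; e]) => v sv.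
apply: (mu_eval_comp (w := [:: f v; g v])); last exact: (Hc [:: f v; g v]).
by do 2 (apply: mu_evals_cons; first by auto); exact: mu_evals_nil.
Qed.

Lemma mu_computable_zero k : mu_computable k (fun=> 0).
Proof. by exists MuZero => v _; exact: mu_eval_zero. Qed.

Lemma mu_computable_succ k f : mu_computable k f -> mu_computable k (fun v => (f v).+1).
Proof.
apply: mu_computable_comp1; exists MuSucc => -[|x []] //= _; exact: mu_eval_succ.
Qed.

Lemma mu_computable_const k n : mu_computable k (fun=> n).
Proof. by elim: n => [|n]; [exact: mu_computable_zero | exact: mu_computable_succ]. Qed.

(** [F] is the closed form of the recursion, so each use only has to check its two recursion
    equations. *)
Lemma mu_computable_rec k (F : nat -> seq nat -> nat) b s n :
  mu_computable k b -> mu_computable k.+2 s -> mu_computable k n ->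
  (forall v, F 0 v = b v) -> (forall n v, F n.+1 v = s [:: n, F n v & v]) ->
  mu_computable k (fun v => F (n v) v).
Proof.
move=> [c Hc] [d Hd] [e He] F0 FS.
exists (MuComp (MuRec c d) (e :: [seq MuProj i | i <- iota 0 k])) => v sv.
apply: (mu_eval_comp (w := n v :: v)).
  by apply: mu_evals_cons; [exact: He | rewrite -sv; exact: mu_evals_proj].
elim: (n v) => [|m IHm]; first by rewrite F0; apply/mu_eval_rec0/Hc.
by apply: mu_eval_recS IHm _; rewrite FS; apply: Hd; rewrite /= sv.
Qed.

Lemma mu_computable_ext k f g : mu_computable k f -> f =1 g -> mu_computable k g.
Proof. by move=> [c Hc] fg; exists c => v sv; rewrite -fg; exact: Hc. Qed.

Lemma mu_computable_add k f g : mu_computable k f -> mu_computable k g ->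
  mu_computable k (fun v => f v + g v).
Proof.
apply: mu_computable_comp2; apply: (mu_computable_rec (F := fun n v => n + nth 0 v 1)
  (b := fun v => nth 0 v 1) (s := fun v => (nth 0 v 1).+1)) => //.
- exact: mu_computable_proj.
- exact/mu_computable_succ/mu_computable_proj.
- exact: mu_computable_proj.
Qed.

Lemma mu_computable_mul k f g : mu_computable k f -> mu_computable k g ->
  mu_computable k (fun v => f v * g v).
Proof.
apply: mu_computable_comp2; apply: (mu_computable_rec (F := fun n v => n * nth 0 v 1)
  (b := fun v => 0) (s := fun v => nth 0 v 3 + nth 0 v 1)) => //.
- exact: mu_computable_const.
- by apply: mu_computable_add; exact: mu_computable_proj.
- exact: mu_computable_proj.
Qed.

Lemma mu_computable_pred k f : mu_computable k f -> mu_computable k (fun v => (f v).-1).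
Proof.
apply: mu_computable_comp1; apply: (mu_computable_rec (F := fun n v => n.-1)
  (b := fun v => 0) (s := fun v => nth 0 v 0)) => //; try exact: mu_computable_proj.
exact: mu_computable_const.
Qed.

Lemma mu_computable_sub k f g : mu_computable k f -> mu_computable k g ->
  mu_computable k (fun v => f v - g v).
Proof.
apply: mu_computable_comp2; apply: (mu_computable_rec (F := fun n v => nth 0 v 0 - n)
  (b := fun v => nth 0 v 0) (s := fun v => (nth 0 v 1).-1)
  (n := fun v => nth 0 v 1)).
- exact: mu_computable_proj.
- exact/mu_computable_pred/mu_computable_proj.
- exact: mu_computable_proj.
- by move=> v; rewrite subn0.
- by move=> n v /=; rewrite subnS.
Qed.

(** Case analysis is a recursion whose step discards the recursive value; [drop 2] gives the step
    access to the original arguments. *)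
Lemma mu_computable_if0 k f g h : mu_computable k f -> mu_computable k g -> mu_computable k h ->
  mu_computable k (fun v => if f v is 0 then g v else h v).
Proof.
move=> Hf Hg [c Hc]; apply: (mu_computable_rec (F := fun n v => if n is 0 then g v else h v)
  (b := g) (s := fun v => h (drop 2 v)) (n := f)) => //.
  exists (MuComp c [seq MuProj i.+2 | i <- iota 0 k]) => -[|x [|y v]] //= [sv].
  rewrite drop0; apply: mu_eval_comp (Hc _ sv).
  rewrite -{2}(mkseq_nth 0 v) -sv; apply: mu_evals_map => i.
  by rewrite mem_iota /= => lt_i; apply: (@mu_eval_proj i.+2 [:: x, y & v]).
by move=> n v /=; rewrite drop0.
Qed.

Lemma mu_computable_eq k f g : mu_computable k f -> mu_computable k g ->
  mu_computable k (fun v => f v == g v).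
Proof.
move=> Hf Hg; have H := mu_computable_if0 (mu_computable_add (mu_computable_sub Hf Hg) (mu_computable_sub Hg Hf))
  (mu_computable_const k 1) (mu_computable_const k 0).
by apply: (mu_computable_ext H) => v /=; case E : (_ + _) => [|n]; lia.
Qed.

Lemma mu_computable_leq k f g : mu_computable k f -> mu_computable k g ->
  mu_computable k (fun v => f v <= g v).
Proof.
by move=> Hf Hg; apply: mu_computable_eq; [exact: mu_computable_sub | exact: mu_computable_const].
Qed.

Lemma mu_computable_exp2 k f : mu_computable k f -> mu_computable k (fun v => 2 ^ f v).
Proof.
apply: mu_computable_comp1; apply: (mu_computable_rec (F := fun n v => 2 ^ n)
  (b := fun v => 1) (s := fun v => nth 0 v 1 + nth 0 v 1)) => //.
- exact: mu_computable_const.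
- by apply: mu_computable_add; exact: mu_computable_proj.
- exact: mu_computable_proj.
- by move=> n v /=; rewrite expnS mul2n addnn.
Qed.

Lemma mu_computable_odd k f : mu_computable k f -> mu_computable k (fun v => odd (f v)).
Proof.
apply: (@mu_computable_comp1 k (fun n => odd n)); apply: (mu_computable_rec (F := fun n v => odd n)
  (b := fun v => 0) (s := fun v => 1 - nth 0 v 1)) => //.
- exact: mu_computable_const.
- by apply: mu_computable_sub; [exact: mu_computable_const | exact: mu_computable_proj].
- exact: mu_computable_proj.
- by move=> n v /=; case: (odd n).
Qed.

Lemma mu_computable_half k f : mu_computable k f -> mu_computable k (fun v => (f v)./2).
Proof.
apply: mu_computable_comp1; apply: (mu_computable_rec (F := fun n v => n./2)
  (b := fun v => 0) (s := fun v => nth 0 v 1 + odd (nth 0 v 0))) => //.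
- exact: mu_computable_const.
- by apply: mu_computable_add; [exact: mu_computable_proj | apply: mu_computable_odd; exact: mu_computable_proj].
- exact: mu_computable_proj.
- by move=> n v; rewrite [RHS]/=; lia.
Qed.

Lemma mu_computable_iter k (op : nat -> nat) n f :
  (forall k f, mu_computable k f -> mu_computable k (fun v => op (f v))) ->
  mu_computable k n -> mu_computable k f ->
  mu_computable k (fun v => iter (n v) op (f v)).
Proof.
move=> Hop; apply: (@mu_computable_comp2 k (fun n x => iter n op x)).
apply: (mu_computable_rec (F := fun n v => iter n op (nth 0 v 1))
  (b := fun v => nth 0 v 1) (s := fun v => op (nth 0 v 1))) => //.
- exact: mu_computable_proj.
- exact/Hop/mu_computable_proj.
- exact: mu_computable_proj.
Qed.

(* The exponent of 2 in [k], found by halving until the value is odd. *)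
Definition code_head (k : nat) : nat :=
  iteri k (fun _ t => if odd (iter t half k) is true then t else t.+1) 0.
Definition code_tail (k : nat) : nat := (iter (code_head k) half k)./2.

Lemma iter_half_exp t n m : t <= n -> iter t half (2 ^ n * m) = 2 ^ (n - t) * m.
Proof.
elim: t => [|t IHt] le_tn; first by rewrite subn0.
rewrite iterS IHt; last exact: ltnW.
have -> : n - t = (n - t.+1).+1 by lia.
by rewrite expnS -mulnA mul2n doubleK.
Qed.

Lemma code_head_cons x s : code_head (CodeSeq.code (x :: s)) = x.
Proof.
rewrite /code_head /=; set m := _.*2.+1; set K := 2 ^ x * m.
(* The counter stops at the first odd value, and the code itself is a large enough number of
   rounds. *)
have Kx : x <= K by rewrite (leq_trans (ltnW (ltn_expl x (ltnSn 1)))) // leq_pmulr.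
suff H i : iteri i (fun _ t => if odd (iter t half K) is true then t else t.+1) 0 = minn i x.
  by rewrite H; apply/minn_idPr.
elim: i => [|i IHi]; first by rewrite min0n.
rewrite iteriS IHi iter_half_exp ?geq_minr // oddM /= odd_double andbT.
by case: (ltnP i x) => ix; rewrite oddX /=; case E : (_ - _) => [|d] /=; lia.
Qed.

Lemma code_tail_cons x s : code_tail (CodeSeq.code (x :: s)) = CodeSeq.code s.
Proof.
rewrite /code_tail code_head_cons /= iter_half_exp // subnn mul1n.
by rewrite -[_.+1]add1n halfD odd_double /= doubleK.
Qed.

Lemma code_headE s : code_head (CodeSeq.code s) = head 0 s.
Proof. by case: s => // x s; exact: code_head_cons. Qed.

Lemma code_tailE s : code_tail (CodeSeq.code s) = CodeSeq.code (behead s).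
Proof. by case: s => // x s; exact: code_tail_cons. Qed.

Lemma mu_computable_head k f : mu_computable k f -> mu_computable k (fun v => code_head (f v)).
Proof.
apply: (@mu_computable_comp1 k code_head); rewrite /code_head.
apply: (mu_computable_rec (F := fun n v => iteri n (fun _ t =>
    if odd (iter t half (nth 0 v 0)) is true then t else t.+1) 0)
  (b := fun=> 0)
  (s := fun v => if nat_of_bool (odd (iter (nth 0 v 1) half (nth 0 v 2))) is 0
     then (nth 0 v 1).+1 else nth 0 v 1)).
- exact: mu_computable_const.
- apply: mu_computable_if0.
  + apply/mu_computable_odd/mu_computable_iter; try exact: mu_computable_proj; exact: mu_computable_half.
  + exact/mu_computable_succ/mu_computable_proj.
  + exact: mu_computable_proj.
- exact: mu_computable_proj.
- by [].
- by move=> n v /=; case: odd.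
Qed.

Lemma mu_computable_tail k f : mu_computable k f -> mu_computable k (fun v => code_tail (f v)).
Proof.
move=> Hf; apply/mu_computable_half/mu_computable_iter => //; [exact: mu_computable_half | exact: mu_computable_head].
Qed.

Lemma iter_tailE i s : iter i code_tail (CodeSeq.code s) = CodeSeq.code (drop i s).
Proof.
elim: i => [|i IHi]; first by rewrite drop0.
by rewrite iterS IHi code_tailE -drop1 drop_drop add1n.
Qed.

Definition code_nth k i := code_head (iter i code_tail k).

Lemma code_nthE s i : code_nth (CodeSeq.code s) i = nth 0 s i.
Proof. by rewrite /code_nth iter_tailE code_headE -nth0 nth_drop addn0. Qed.

Lemma mu_computable_nth k f g : mu_computable k f -> mu_computable k g ->
  mu_computable k (fun v => code_nth (f v) (g v)).
Proof. by move=> Hf Hg; apply/mu_computable_head/mu_computable_iter => //; exact: mu_computable_tail. Qed.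

(** Counts the nonempty tails: a list is empty exactly when its code is 0, and its code bounds its
    length. *)
Definition code_size k := iteri k (fun i r => r + (iter i code_tail k != 0)) 0.

Lemma size_leq_code s : size s <= CodeSeq.code s.
Proof.
elim: s => //= x s IHs; apply: (leq_trans (n := (CodeSeq.code s).*2.+1)); first by lia.
by rewrite leq_pmull // expn_gt0.
Qed.

Lemma code_eq0 s : (CodeSeq.code s == 0) = nilp s.
Proof. by case: s => //= x s; rewrite muln_eq0 expn_eq0. Qed.

Lemma code_sizeE s : code_size (CodeSeq.code s) = size s.
Proof.
rewrite /code_size.
suff H i : iteri i (fun i r => r + (iter i code_tail (CodeSeq.code s) != 0)) 0 = minn i (size s).
  by rewrite H; apply/minn_idPr/size_leq_code.
elim: i => [|i IHi]; first by rewrite min0n.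
rewrite iteriS IHi iter_tailE code_eq0 /nilp size_drop subn_eq0 -ltnNge; lia.
Qed.

Lemma mu_computable_size k f : mu_computable k f -> mu_computable k (fun v => code_size (f v)).
Proof.
apply: (@mu_computable_comp1 k code_size); rewrite /code_size.
apply: (mu_computable_rec (F := fun n v => iteri n (fun i r => r + (iter i code_tail (nth 0 v 0) != 0)) 0)
  (b := fun=> 0)
  (s := fun v => nth 0 v 1 + (1 - nat_of_bool (iter (nth 0 v 0) code_tail (nth 0 v 2) == 0)))).
- exact: mu_computable_const.
- apply: mu_computable_add; first exact: mu_computable_proj.
  apply: mu_computable_sub; first exact: mu_computable_const.
  apply: mu_computable_eq; last exact: mu_computable_const.
  by apply: mu_computable_iter; [exact: mu_computable_tail | exact: mu_computable_proj | exact: mu_computable_proj].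
- exact: mu_computable_proj.
- by [].
- by move=> n v /=; case: eqP.
Qed.

Lemma mu_computable_cons k f g : mu_computable k f -> mu_computable k g ->
  mu_computable k (fun v => 2 ^ f v * (g v).*2.+1).
Proof.
move=> Hf Hg; apply: mu_computable_mul; first exact: mu_computable_exp2.
by apply: mu_computable_succ; apply: mu_computable_ext (mu_computable_add Hg Hg) _ => v; rewrite addnn.
Qed.

Lemma mu_computable_pair k f g : mu_computable k f -> mu_computable k g ->
  mu_computable k (fun v => CodeSeq.code [:: f v; g v]).
Proof.
by move=> Hf Hg; apply/mu_computable_cons/mu_computable_cons => //; exact: mu_computable_const.
Qed.

(* Functions between encoded types are computed on the codes of their
   arguments; several arguments are passed as one pair.  The lemmas cp_f say
   that the operation f preserves computability. *)
Class Enc (T : Type) := enc : T -> nat.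
#[export] Instance enc_nat : Enc nat := id.
#[export] Instance enc_bool : Enc bool := nat_of_bool.
#[export] Instance enc_prod (A B : Type) (eA : Enc A) (eB : Enc B) : Enc (A * B) :=
  fun p => CodeSeq.code [:: enc p.1; enc p.2].
#[export] Instance enc_seq (A : Type) (eA : Enc A) : Enc (seq A) :=
  fun s => CodeSeq.code (map enc s).

Definition computable (A B : Type) {eA : Enc A} {eB : Enc B} (f : A -> B) :=
  exists c, forall a, mu_eval c [:: enc a] (enc (f a)).

Section Closure.
Context {A : Type} {eA : Enc A}.

Lemma cp_id : computable (fun a : A => a).
Proof. by exists (MuProj 0) => a; exact: mu_eval_proj. Qed.

(** The [cp_raw] lemmas lift a numerical function to an encoded operation; the two need only agree
    on codes of actual arguments. *)
Lemma cp_raw0 (B : Type) {eB : Enc B} (f : A -> B) F :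
  mu_computable 1 F -> (forall a, F [:: enc a] = enc (f a)) -> computable f.
Proof. by move=> [c Hc] HF; exists c => a; rewrite -HF; exact: Hc. Qed.

Lemma cp_const (B : Type) {eB : Enc B} (b : B) : computable (fun _ : A => b).
Proof. exact: cp_raw0 (mu_computable_const 1 (enc b)) _. Qed.

Lemma cp_comp (B C : Type) {eB : Enc B} {eC : Enc C} (g : B -> C) (f : A -> B) :
  computable g -> computable f -> computable (fun a => g (f a)).
Proof.
move=> [c Hc] [d Hd]; exists (MuComp c [:: d]) => a.
apply: (mu_eval_comp (w := [:: enc (f a)])) => //.
by apply: mu_evals_cons => //; exact: mu_evals_nil.
Qed.

Lemma cp_ext (B : Type) {eB : Enc B} (f g : A -> B) :
  computable f -> f =1 g -> computable g.
Proof. by move=> [c Hc] fg; exists c => a; rewrite -fg; exact: Hc. Qed.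

Lemma cp_raw1 (B C : Type) {eB : Enc B} {eC : Enc C} (g : B -> C) (f : A -> B) F :
  mu_computable 1 F -> (forall b, F [:: enc b] = enc (g b)) ->
  computable f -> computable (fun a => g (f a)).
Proof.
move=> [c Hc] HF; apply: cp_comp; exists c => b; rewrite -HF; exact: Hc.
Qed.

Lemma cp_raw2 (B C D : Type) {eB : Enc B} {eC : Enc C} {eD : Enc D}
    (g : B -> C -> D) (f1 : A -> B) (f2 : A -> C) F :
  mu_computable 2 F -> (forall b c, F [:: enc b; enc c] = enc (g b c)) ->
  computable f1 -> computable f2 -> computable (fun a => g (f1 a) (f2 a)).
Proof.
move=> [c Hc] HF [d1 Hd1] [d2 Hd2]; exists (MuComp c [:: d1; d2]) => a.
apply: (mu_eval_comp (w := [:: enc (f1 a); enc (f2 a)])); last by rewrite -HF; exact: Hc.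
by do 2 (apply: mu_evals_cons => //); exact: mu_evals_nil.
Qed.

Lemma cp_raw3 (B C D E : Type) {eB : Enc B} {eC : Enc C} {eD : Enc D} {eE : Enc E}
    (g : B -> C -> D -> E) (f1 : A -> B) (f2 : A -> C) (f3 : A -> D) F :
  mu_computable 3 F -> (forall b c d, F [:: enc b; enc c; enc d] = enc (g b c d)) ->
  computable f1 -> computable f2 -> computable f3 ->
  computable (fun a => g (f1 a) (f2 a) (f3 a)).
Proof.
move=> [c Hc] HF [d1 Hd1] [d2 Hd2] [d3 Hd3]; exists (MuComp c [:: d1; d2; d3]) => a.
apply: (mu_eval_comp (w := [:: enc (f1 a); enc (f2 a); enc (f3 a)])).
  by do 3 (apply: mu_evals_cons => //); exact: mu_evals_nil.
by rewrite -HF; exact: Hc.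
Qed.

Lemma cp_pair (B C : Type) {eB : Enc B} {eC : Enc C} (f : A -> B) (g : A -> C) :
  computable f -> computable g -> computable (fun a => (f a, g a)).
Proof.
apply: (cp_raw2 (g := fun b c => (b, c))
  (F := fun v => CodeSeq.code [:: nth 0 v 0; nth 0 v 1])) => //.
by apply: mu_computable_pair; exact: mu_computable_proj.
Qed.

Lemma cp_fst (B C : Type) {eB : Enc B} {eC : Enc C} (f : A -> B * C) :
  computable f -> computable (fun a => (f a).1).
Proof.
apply: (cp_raw1 (g := fun b : B * C => b.1) (F := fun v => code_head (nth 0 v 0))).
  by apply: mu_computable_head; exact: mu_computable_proj.
by move=> b; rewrite [nth _ _ _]/= code_headE.
Qed.

Lemma cp_snd (B C : Type) {eB : Enc B} {eC : Enc C} (f : A -> B * C) :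
  computable f -> computable (fun a => (f a).2).
Proof.
apply: (cp_raw1 (g := fun b : B * C => b.2) (F := fun v => code_nth (nth 0 v 0) 1)).
  by apply: mu_computable_nth; [exact: mu_computable_proj | exact: mu_computable_const].
by move=> b; rewrite [nth 0 [:: _] 0]/= code_nthE.
Qed.

Lemma cp_succ (f : A -> nat) : computable f -> computable (fun a => (f a).+1).
Proof.
by apply: (cp_raw1 (F := fun v => (nth 0 v 0).+1)) => //; apply/mu_computable_succ/mu_computable_proj.
Qed.

Lemma cp_addn (f g : A -> nat) :
  computable f -> computable g -> computable (fun a => f a + g a).
Proof.
apply: (cp_raw2 (F := fun v => nth 0 v 0 + nth 0 v 1)) => //.
by apply: mu_computable_add; exact: mu_computable_proj.
Qed.

Lemma cp_muln (f g : A -> nat) :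
  computable f -> computable g -> computable (fun a => f a * g a).
Proof.
apply: (cp_raw2 (F := fun v => nth 0 v 0 * nth 0 v 1)) => //.
by apply: mu_computable_mul; exact: mu_computable_proj.
Qed.

Lemma cp_subn (f g : A -> nat) :
  computable f -> computable g -> computable (fun a => f a - g a).
Proof.
apply: (cp_raw2 (F := fun v => nth 0 v 0 - nth 0 v 1)) => //.
by apply: mu_computable_sub; exact: mu_computable_proj.
Qed.

Lemma cp_leq (f g : A -> nat) :
  computable f -> computable g -> computable (fun a => f a <= g a).
Proof.
apply: (cp_raw2 (F := fun v => nth 0 v 0 <= nth 0 v 1)) => //.
by apply: mu_computable_leq; exact: mu_computable_proj.
Qed.

Lemma cp_eq (B : eqType) {eB : Enc B} (f g : A -> B) : injective (enc : B -> nat) ->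
  computable f -> computable g -> computable (fun a => f a == g a).
Proof.
move=> inj_enc; apply: (cp_raw2 (g := fun b c : B => b == c) (F := fun v => nth 0 v 0 == nth 0 v 1)).
  by apply: mu_computable_eq; exact: mu_computable_proj.
by move=> b c /=; congr nat_of_bool; apply/eqP/eqP => [/inj_enc|->].
Qed.

Lemma cp_eqn (f g : A -> nat) :
  computable f -> computable g -> computable (fun a => f a == g a).
Proof. exact: cp_eq. Qed.

Lemma cp_if (B : Type) {eB : Enc B} (b : A -> bool) (f g : A -> B) :
  computable b -> computable f -> computable g ->
  computable (fun a => if b a then f a else g a).
Proof.
apply: (cp_raw3 (g := fun b (x y : B) => if b then x else y)
  (F := fun v => if nth 0 v 0 is 0 then nth 0 v 2 else nth 0 v 1)).
  by apply: mu_computable_if0; exact: mu_computable_proj.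
by case.
Qed.

Lemma cp_and (f g : A -> bool) :
  computable f -> computable g -> computable (fun a => f a && g a).
Proof. by move=> Hf Hg; apply: cp_if => //; exact: cp_const. Qed.

Lemma cp_or (f g : A -> bool) :
  computable f -> computable g -> computable (fun a => f a || g a).
Proof. by move=> Hf Hg; apply: cp_if => //; exact: cp_const. Qed.

Lemma cp_neg (f : A -> bool) : computable f -> computable (fun a => ~~ f a).
Proof. by move=> Hf; apply: cp_if => //; exact: cp_const. Qed.

Lemma cp_implb (f g : A -> bool) :
  computable f -> computable g -> computable (fun a => f a ==> g a).
Proof. by move=> Hf Hg; apply: cp_if => //; exact: cp_const. Qed.

Lemma cp_iteri (B : Type) {eB : Enc B} (n : A -> nat) (g : A -> nat -> B -> B) (b : A -> B) :
  computable (fun p : A * (nat * B) => g p.1 p.2.1 p.2.2) ->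
  computable n -> computable b -> computable (fun a => iteri (n a) (g a) (b a)).
Proof.
move=> [c Hc] [d Hd] [e He].
(* The step of [MuRec] receives index, accumulator and parameter in this order; [cp] repacks them as
   the code of (a, (i, r)). *)
have [cp Hcp] : mu_computable 3 (fun v =>
    CodeSeq.code [:: nth 0 v 2; CodeSeq.code [:: nth 0 v 0; nth 0 v 1]]).
  by do 2 (try apply: mu_computable_pair); exact: mu_computable_proj.
exists (MuComp (MuRec e (MuComp c [:: cp])) [:: d; MuProj 0]) => a.
apply: (mu_eval_comp (w := [:: n a; enc a])).
  do 2 (apply: mu_evals_cons; first by [exact: Hd | exact: mu_eval_proj]).
  exact: mu_evals_nil.
elim: (n a) => [|i IHi]; first exact: mu_eval_rec0.
apply: mu_eval_recS IHi _; set r := iteri i _ _.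
apply: (mu_eval_comp (w := [:: enc (a, (i, r))])); last exact: (Hc (a, (i, r))).
by apply: mu_evals_cons; [exact: (Hcp [:: i; enc r; enc a]) | exact: mu_evals_nil].
Qed.

Lemma cp_cons (B : Type) {eB : Enc B} (f : A -> B) (g : A -> seq B) :
  computable f -> computable g -> computable (fun a => f a :: g a).
Proof.
apply: (cp_raw2 (g := fun x (s : seq B) => x :: s)
  (F := fun v => 2 ^ nth 0 v 0 * (nth 0 v 1).*2.+1)) => //.
by apply: mu_computable_cons; exact: mu_computable_proj.
Qed.

Lemma cp_behead (B : Type) {eB : Enc B} (f : A -> seq B) :
  computable f -> computable (fun a => behead (f a)).
Proof.
apply: (cp_raw1 (g := fun s : seq B => behead s) (F := fun v => code_tail (nth 0 v 0))).
  by apply: mu_computable_tail; exact: mu_computable_proj.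
by move=> s; rewrite [nth _ _ _]/= code_tailE /enc/= /enc_seq behead_map.
Qed.

Lemma cp_size (B : Type) {eB : Enc B} (f : A -> seq B) :
  computable f -> computable (fun a => size (f a)).
Proof.
apply: (cp_raw1 (g := fun s : seq B => size s) (F := fun v => code_size (nth 0 v 0))).
  by apply: mu_computable_size; exact: mu_computable_proj.
by move=> s; rewrite [nth _ _ _]/= code_sizeE size_map.
Qed.

Lemma cp_nth (B : Type) {eB : Enc B} (x : A -> B) (f : A -> seq B) (i : A -> nat) :
  computable x -> computable f -> computable i ->
  computable (fun a => nth (x a) (f a) (i a)).
Proof.
apply: (cp_raw3 (g := fun x (s : seq B) i => nth x s i)
  (F := fun v => if nat_of_bool ((nth 0 v 2).+1 <= code_size (nth 0 v 1)) is 0 then nth 0 v 0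
                 else code_nth (nth 0 v 1) (nth 0 v 2))).
  apply: mu_computable_if0; [|exact: mu_computable_proj|apply: mu_computable_nth; exact: mu_computable_proj].
  by apply: mu_computable_leq; [apply/mu_computable_succ|apply/mu_computable_size]; exact: mu_computable_proj.
move=> y s j; rewrite [nth 0 _ 2]/= [nth 0 _ 1]/= [nth 0 _ 0]/= code_sizeE size_map.
rewrite -[enc j]/j; case: (ltnP j (size s)) => [lt_j|le_j] /=.
  by rewrite code_nthE (nth_map y).
by rewrite nth_default.
Qed.

End Closure.

Section Fold.
Context {A : Type} {eA : Enc A}.

(** A right fold is an iteration over the positions counted from the end. Reading a position needs a
    default element, hence the distinction whether [B] is inhabited. *)
Lemma cp_foldr (B C : Type) {eB : Enc B} {eC : Enc C}
    (f : A -> B -> C -> C) (z : A -> C) (s : A -> seq B) :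
  computable (fun p : A * (B * C) => f p.1 p.2.1 p.2.2) ->
  computable z -> computable s -> computable (fun a => foldr (f a) (z a) (s a)).
Proof.
move=> Hf Hz Hs; have [[x0 _]|noB] := boolp.pselect (exists x : B, True); last first.
  by refine (cp_ext Hz _) => a; case: (s a) => // x; case: noB; exists x.
enough (H : computable (fun a => iteri (size (s a))
    (fun i r => f a (nth x0 (s a) (size (s a) - i.+1)) r) (z a))).
  refine (cp_ext H _) => a; elim: (s a) => //= x l IHl.
  rewrite subSS subnn /=; congr (f a _ _); rewrite -{}IHl.
  have : size l <= size l by [].
  elim: {1 3 5}(size l) => //= n IHn ltnl; rewrite IHn ?(ltnW ltnl) //.
  by rewrite subSS -[size l - n](@prednK _) ?subn_gt0 // subnS.
apply: (cp_iteri (g := fun a i r => f a (nth x0 (s a) (size (s a) - i.+1)) r)).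
- apply: (cp_comp (g := fun p : A * (B * C) => f p.1 p.2.1 p.2.2)
    (f := fun p : A * (nat * C) => (p.1, (nth x0 (s p.1) (size (s p.1) - p.2.1.+1), p.2.2)))) => //.
  assert (H1 : computable (fun p : A * (nat * C) => s p.1)).
    by apply: cp_comp Hs _; apply/cp_fst/cp_id.
  apply: cp_pair; first exact/cp_fst/cp_id.
  apply: cp_pair; last exact/cp_snd/cp_snd/cp_id.
  apply: cp_nth => //; first exact: cp_const.
  by apply: cp_subn; [exact: cp_size | exact/cp_succ/cp_fst/cp_snd/cp_id].
- exact: cp_size.
- exact: Hz.
Qed.
End Fold.

(** [cp] peels off the operations in the body of a function one by one. [cp_more] is a hook,
    redefined whenever closure lemmas for further operations are available. Goals about a hypothesis
    used under a binder remain and are closed by [cp_comp]. *)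
Ltac cp_more := fail.
Ltac cp_basic := lazymatch goal with
  | |- computable (fun a => a) => exact: cp_id
  | |- computable (fun _ => ?b) => exact: cp_const
  | |- computable (fun a => fst _) => apply: cp_fst
  | |- computable (fun a => snd _) => apply: cp_snd
  | |- computable fst => exact: (cp_fst cp_id)
  | |- computable snd => exact: (cp_snd cp_id)
  | |- computable (fun a => pair _ _) => apply: cp_pair
  | |- computable (fun a => S _) => apply: cp_succ
  | |- computable (fun a => addn _ _) => apply: cp_addn
  | |- computable (fun a => muln _ _) => apply: cp_muln
  | |- computable (fun a => subn _ _) => apply: cp_subn
  | |- computable (fun a => leq _ _) => apply: cp_leq
  | |- computable (fun a => andb _ _) => apply: cp_and
  | |- computable (fun a => orb _ _) => apply: cp_or
  | |- computable (fun a => negb _) => apply: cp_neg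
  | |- computable (fun a => implb _ _) => apply: cp_implb
  | |- computable (fun a => if _ then _ else _) => apply: cp_if
  | |- computable (fun a => cons _ _) => apply: cp_cons
  | |- computable (fun a => behead _) => apply: cp_behead
  | |- computable (fun a => size _) => apply: cp_size
  | |- computable (fun a => nth _ _ _) => apply: cp_nth
  | |- computable (fun a => iteri _ _ _) => apply: cp_iteri
  | |- computable (fun a => foldr _ _ _) => apply: cp_foldr
  | |- computable (fun a => eq_op _ _) => apply: cp_eqn
  end.
Ltac cp_eta := lazymatch goal with
  | |- computable (fun _ => _) => fail
  | |- @computable ?A ?B ?eA ?eB ?f => change (@computable A B eA eB (fun a : A => f a)); cbv beta
  end.
Ltac cp := repeat (first [assumption | cp_basic | cp_more | cp_eta]).

Section ListOps.
Context {A : Type} {eA : Enc A}.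
Variables (B C : Type).
Context {eB : Enc B} {eC : Enc C}.

Lemma cp_map (f : A -> B -> C) (s : A -> seq B) :
  computable (fun p : A * B => f p.1 p.2) -> computable s ->
  computable (fun a => [seq f a x | x <- s a]).
Proof.
move=> Hf Hs.
assert (H : computable (fun a => foldr (fun x l => f a x :: l) [::] (s a))).
  apply: cp_foldr; cp.
  by apply: (cp_comp (f := fun p : A * (B * seq C) => (p.1, p.2.1)) Hf); cp.
exact: (cp_ext H).
Qed.
End ListOps.

Local Open Scope classical_set_scope.

Section ListPredicates.
Context {A : Type} {eA : Enc A}.
Variable B : Type.
Context {eB : Enc B}.

Lemma cp_cat (f g : A -> seq B) :
  computable f -> computable g -> computable (fun a => f a ++ g a).
Proof.
move=> Hf Hg; assert (H : computable (fun a => foldr cons (g a) (f a))) by cp.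
by refine (cp_ext H _) => a; elim: (f a) => //= x l ->.
Qed.

Lemma cp_filter (f : A -> B -> bool) (s : A -> seq B) :
  computable (fun p : A * B => f p.1 p.2) -> computable s ->
  computable (fun a => [seq x <- s a | f a x]).
Proof.
move=> Hf Hs.
assert (H : computable (fun a => foldr (fun x l => if f a x then x :: l else l) [::] (s a))).
  cp; by apply: (cp_comp (f := fun p : A * (B * seq B) => (p.1, p.2.1)) Hf); cp.
exact: (cp_ext H).
Qed.

Lemma cp_all (f : A -> B -> bool) (s : A -> seq B) :
  computable (fun p : A * B => f p.1 p.2) -> computable s ->
  computable (fun a => all (f a) (s a)).
Proof.
move=> Hf Hs; assert (H : computable (fun a => foldr (fun x l => f a x && l) true (s a))).
  cp; by apply: (cp_comp (f := fun p : A * (B * bool) => (p.1, p.2.1)) Hf); cp.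
exact: (cp_ext H).
Qed.

Lemma cp_has (f : A -> B -> bool) (s : A -> seq B) :
  computable (fun p : A * B => f p.1 p.2) -> computable s ->
  computable (fun a => has (f a) (s a)).
Proof.
move=> Hf Hs; assert (H : computable (fun a => foldr (fun x l => f a x || l) false (s a))).
  cp; by apply: (cp_comp (f := fun p : A * (B * bool) => (p.1, p.2.1)) Hf); cp.
exact: (cp_ext H).
Qed.

End ListPredicates.

Section NatLists.
Context {A : Type} {eA : Enc A}.

Lemma cp_iota (f g : A -> nat) :
  computable f -> computable g -> computable (fun a => iota (f a) (g a)).
Proof.
move=> Hf Hg.
assert (H : computable (fun a => iteri (g a) (fun i l => l ++ [:: f a + i]) [::])).
  cp; apply: cp_cat; cp; by apply: (cp_comp Hf); cp.
refine (cp_ext H _) => a; elim: (g a) => // n IHn.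
by rewrite iteriS IHn -[n.+1]addn1 iotaD.
Qed.

Lemma cp_sumn (s : A -> seq nat) : computable s -> computable (fun a => sumn (s a)).
Proof. by move=> Hs; rewrite /sumn; cp. Qed.

Lemma cp_mem (x : A -> nat) (s : A -> seq nat) :
  computable x -> computable s -> computable (fun a => x a \in s a).
Proof.
move=> Hx Hs; assert (H : computable (fun a => has (fun y : nat => y == x a) (s a))).
  apply: cp_has; cp; by apply: (cp_comp Hx); cp.
by refine (cp_ext H _) => a; rewrite -has_pred1.
Qed.

End NatLists.

Lemma cp_flatten (A B : Type) {eA : Enc A} {eB : Enc B} (s : A -> seq (seq B)) :
  computable s -> computable (fun a => flatten (s a)).
Proof. by move=> Hs; rewrite /flatten; cp; apply: cp_cat; cp. Qed.

Ltac cp_lists := lazymatch goal with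
  | |- computable (fun a => cat _ _) => apply: cp_cat
  | |- computable (fun a => map _ _) => apply: cp_map
  | |- computable (fun a => seq.filter _ _) => apply: cp_filter
  | |- computable (fun a => all _ _) => apply: cp_all
  | |- computable (fun a => has _ _) => apply: cp_has
  | |- computable (fun a => iota _ _) => apply: cp_iota
  | |- computable (fun a => sumn _) => apply: cp_sumn
  | |- computable (fun a => in_mem _ _) => apply: cp_mem
  | |- computable (fun a => flatten _) => apply: cp_flatten
  end.
Ltac cp_more ::= cp_lists.

Definition words (T : Type) n (s : seq T) : seq (seq T) :=
  iteri n (fun _ l => flatten [seq [seq x :: w | w <- l] | x <- s]) [:: [::]].

Lemma mem_words (T : eqType) n (s w : seq T) :
  (w \in words n s) = (size w == n) && all [in s] w.
Proof.
elim: n w => [|n IHn] w; first by rewrite inE; case: w.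
rewrite /words iteriS -/(words n s); apply/flatten_mapP/idP => [[x xs /mapP[v]]|].
  by rewrite IHn => /andP[/eqP <- sv] -> /=; rewrite eqxx xs sv.
case: w => //= x w; rewrite eqSS => /and3P[sw xs ws]; exists x => //.
by apply: map_f; rewrite IHn sw.
Qed.

Lemma cp_words (A T : Type) {eA : Enc A} {eT : Enc T} (n : A -> nat) (s : A -> seq T) :
  computable n -> computable s -> computable (fun a => words (n a) (s a)).
Proof. by move=> Hn Hs; rewrite /words; cp; apply: (cp_comp Hs); cp. Qed.

Lemma enc_seq_nat (s : seq nat) : enc s = CodeSeq.code s.
Proof. by rewrite /enc /enc_seq map_id. Qed.

Lemma cp_decode (A : Type) {eA : Enc A} (f : A -> nat) :
  computable f -> computable (fun a => CodeSeq.decode (f a)).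
Proof.
apply: (cp_raw1 (F := fun v => nth 0 v 0)); first exact: mu_computable_proj.
by move=> n; rewrite enc_seq_nat CodeSeq.decodeK.
Qed.

Lemma cp_code (A : Type) {eA : Enc A} (f : A -> seq nat) :
  computable f -> computable (fun a => CodeSeq.code (f a)).
Proof.
apply: (cp_raw1 (F := fun v => nth 0 v 0)); first exact: mu_computable_proj.
by move=> n; rewrite -enc_seq_nat.
Qed.

Ltac cp_lists2 := first [ cp_lists | lazymatch goal with
  | |- computable (fun a => words _ _) => apply: cp_words
  | |- computable (fun a => CodeSeq.decode _) => apply: cp_decode
  | |- computable (fun a => CodeSeq.code _) => apply: cp_code
  end ].
Ltac cp_more ::= cp_lists2.

(** * Transfer between functions of k arguments and functions of one code *)

Lemma computable_fun_of k (f : k.-tuple nat -> nat) (g : seq nat -> nat) :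
  computable g -> (forall v : k.-tuple nat, f v = g v) -> computable_fun f.
Proof.
move=> [c Hc] fg.
have [d Hd] : mu_computable k (fun v => CodeSeq.code [seq nth 0 v i | i <- iota 0 k]).
  have : all (fun i => i < k) (iota 0 k) by apply/allP => i; rewrite mem_iota.
  elim: (iota 0 k) => [|i s IHs] /=; first by move=> _; exact: mu_computable_const.
  by case/andP => ik /IHs Hs; apply: mu_computable_cons => //; exact: mu_computable_proj.
exists (MuComp c [:: d]) => v; rewrite fg; apply: (mu_eval_comp (w := [:: enc (val v)])).
  apply: mu_evals_cons; last exact: mu_evals_nil.
  have := Hd v (size_tuple v); rewrite enc_seq_nat.
  by rewrite -/(mkseq _ _) -[X in mkseq _ X](size_tuple v) mkseq_nth.
exact: Hc.
Qed.

Lemma cp_computable_fun k (f : k.-tuple nat -> nat) (A : Type) {eA : Enc A}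
    (s : A -> k.-tuple nat) : computable_fun f ->
  computable (fun a => val (s a)) -> computable (fun a => f (s a)).
Proof.
move=> [c Hc] [d Hd].
have [e He] : exists e, forall v : k.-tuple nat, mu_evals e [:: enc (val v)] v.
  pose F i (x : seq nat) := code_nth (nth 0 x 0) i.
  have HF i : exists c, forall v, size v = 1 -> mu_eval c v (F i v).
    by apply: mu_computable_nth; [exact: mu_computable_proj | exact: mu_computable_const].
  have [C HC] := choice HF; exists [seq C i | i <- iota 0 k] => v.
  rewrite -[X in mu_evals _ _ X](mkseq_nth 0 v) size_tuple.
  apply: mu_evals_map => i _; rewrite -code_nthE -enc_seq_nat.
  exact: (HC i [:: enc (val v)] erefl).
exists (MuComp (MuComp c e) [:: d]) => a.
apply: (mu_eval_comp (w := [:: enc (val (s a))])).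
  by apply: mu_evals_cons; [exact: Hd | exact: mu_evals_nil].
exact: mu_eval_comp (He _) (Hc _).
Qed.

Lemma Sigma01_of_check (A : set nat) (chk : nat -> nat -> bool) :
  computable (fun p : nat * nat => chk p.1 p.2) ->
  (forall x, A x <-> exists m, chk x m) -> Sigma01 (unary A).
Proof.
move=> Hc AP; exists [set v : 2.-tuple nat | chk (nth 0 v 0) (nth 0 v 1)].
  apply: (computable_fun_of (g := fun s => nat_of_bool (chk (nth 0 s 0) (nth 0 s 1)))).
    case: (cp_comp (f := fun s => (nth 0 s 0, nth 0 s 1)) Hc); first by cp.
    by move=> c Hc'; exists c.
  move=> v; congr nat_of_bool; apply/idP/idP; first by rewrite inE.
  by move=> H; rewrite inE.
move=> v; rewrite /unary /= AP; case/tupleP: v => x v; rewrite theadE.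
by rewrite tuple0; split=> -[m Hm]; exists m.
Qed.

Lemma Sigma01_check k (A : set (k.-tuple nat)) : Sigma01 A ->
  exists2 chk : seq nat -> nat -> bool, computable (fun p : seq nat * nat => chk p.1 p.2) &
  forall v : k.-tuple nat, A v <-> exists m, chk v m.
Proof.
move=> [B cB AB].
(* Lists of the wrong length are padded or cut to length k, which makes the check total. *)
pose t (s : seq nat) m := [tuple of rcons (mktuple (fun i : 'I_k => nth 0 s i)) m].
exists (fun s m => t s m \in B) => [|v].
  have [c Hc] : computable (fun p : seq nat * nat => nat_of_bool (t p.1 p.2 \in B)).
    apply: (cp_computable_fun (f := fun v => nat_of_bool (v \in B)) (s := fun p : seq nat * nat => t p.1 p.2)) cB _.
    assert (H : computable (fun p : seq nat * nat => [seq nth 0 p.1 i | i <- iota 0 k] ++ [:: p.2])) by cp.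
    refine (cp_ext H _) => -[s m] /=; rewrite cats1; congr rcons.
    by rewrite -val_enum_ord -map_comp; apply: eq_map.
  by exists c.
have Et m : t v m = [tuple of rcons v m].
  have Ev : mktuple (fun i : 'I_k => nth 0 v i) = v.
    by apply: eq_from_tnth => i; rewrite tnth_mktuple -tnth_nth.
  by rewrite /t Ev.
by rewrite AB; split=> -[m]; [rewrite -Et | rewrite inE Et] => Bm; exists m; rewrite ?inE.
Qed.

(** * A set in Sigma01 that is not in Pi01 *)

Scheme mu_eval_ind2 := Minimality for mu_eval Sort Prop
  with mu_evals_ind2 := Minimality for mu_evals Sort Prop.
Combined Scheme mu_eval_evals_ind from mu_eval_ind2, mu_evals_ind2.

Lemma mu_eval_fun c v y y' : mu_eval c v y -> mu_eval c v y' -> y = y'.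
Proof.
pose P c v y := forall y', mu_eval c v y' -> y = y'.
pose Q cs v w := forall w', mu_evals cs v w' -> w = w'.
suff [H _] : (forall c v y, mu_eval c v y -> P c v y) /\
    (forall cs v w, mu_evals cs v w -> Q cs v w) by move=> /H; exact.
apply: mu_eval_evals_ind; rewrite /P /Q {P Q y y' c v}.
- by move=> v y' H; inversion H.
- by move=> x v y' H; inversion H.
- by move=> i v _ y' H; inversion H.
- move=> c cs v w y _ IHw _ IHy y' H; inversion H; subst.
  by apply: IHy; rewrite (IHw w0).
- by move=> c d v y _ IH y' H; inversion H; subst; exact: IH.
- move=> c d n v r y _ IHr _ IHy y' H; inversion H; subst.
  by apply: IHy; rewrite (IHr r0).
- move=> c v n r _ IHr _ IH0 y' H; inversion H; subst.
  case: (ltngtP n y') => // [lt_ny|lt_yn].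
  + by have := IH0 _ (H1 _ lt_ny).
  + by have := IHr _ lt_yn _ H2.
- by move=> v w' H; inversion H.
- move=> c cs v y w _ IHy _ IHw w' H; inversion H; subst.
  by rewrite (IHy y0) // (IHw w0).
Qed.

Fixpoint mu_num (c : mu_code) : nat :=
  CodeSeq.code match c with
  | MuZero => [:: 0]
  | MuSucc => [:: 1]
  | MuProj i => [:: 2; i]
  | MuComp d ds => [:: 3, mu_num d & map mu_num ds]
  | MuRec d e => [:: 4; mu_num d; mu_num e]
  | MuMin d => [:: 5; mu_num d]
  end.

Lemma decode_mu_num c : CodeSeq.decode (mu_num c) = match c with
  | MuZero => [:: 0]
  | MuSucc => [:: 1]
  | MuProj i => [:: 2; i]
  | MuComp d ds => [:: 3, mu_num d & map mu_num ds]
  | MuRec d e => [:: 4; mu_num d; mu_num e]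
  | MuMin d => [:: 5; mu_num d]
  end.
Proof. by case: c => *; exact: CodeSeq.codeK. Qed.

(* A computation is recorded as a list of steps, each of which follows from
   later entries of the list.  The step [:: c; code v; y; code w] asserts that
   the program number c maps v to y; w holds intermediate values. *)
Definition records (D : seq nat) (c : nat) (v : seq nat) (y : nat) : bool :=
  has (fun e => [&& nth 0 (CodeSeq.decode e) 0 == c,
    nth 0 (CodeSeq.decode e) 1 == CodeSeq.code v & nth 0 (CodeSeq.decode e) 2 == y]) D.

Definition justified_step (D : seq nat) (c : nat) (p v : seq nat) (y : nat) (w : seq nat) :=
  if nth 0 p 0 == 0 then y == 0
  else if nth 0 p 0 == 1 then (0 < size v) && (y == (nth 0 v 0).+1)
  else if nth 0 p 0 == 2 then (nth 0 p 1 < size v) && (y == nth 0 v (nth 0 p 1))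
  else if nth 0 p 0 == 3 then
    [&& (size w).+2 == size p,
        all (fun j => records D (nth 0 p j.+2) v (nth 0 w j)) (iota 0 (size w))
      & records D (nth 0 p 1) w y]
  else if nth 0 p 0 == 4 then
    (0 < size v) && (if nth 0 v 0 == 0 then records D (nth 0 p 1) (behead v) y
    else records D c ((nth 0 v 0 - 1) :: behead v) (nth 0 w 0) &&
         records D (nth 0 p 2) [:: nth 0 v 0 - 1, nth 0 w 0 & behead v] y)
  else records D (nth 0 p 1) (y :: v) 0 &&
       all (fun i => records D (nth 0 p 1) (i :: v) (nth 0 w i).+1) (iota 0 y).

Definition justified D e :=
  justified_step D (nth 0 (CodeSeq.decode e) 0)
    (CodeSeq.decode (nth 0 (CodeSeq.decode e) 0))
    (CodeSeq.decode (nth 0 (CodeSeq.decode e) 1)) (nth 0 (CodeSeq.decode e) 2)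
    (CodeSeq.decode (nth 0 (CodeSeq.decode e) 3)).

Fixpoint valid_run (D : seq nat) : bool :=
  if D is e :: D' then justified D' e && valid_run D' else true.

Lemma records_sub D D' c v y : {subset D <= D'} -> records D c v y -> records D' c v y.
Proof. by move=> sD /hasP[e eD He]; apply/hasP; exists e => //; exact: sD. Qed.

Lemma justified_sub D D' e : {subset D <= D'} -> justified D e -> justified D' e.
Proof.
move=> sD; have sub := records_sub sD.
rewrite /justified /justified_step; do 3 (case: ifP => [//|_]).
case: ifP => _; last case: ifP => _.
- by case/and3P=> -> /allP H /sub ->; rewrite andbT; apply/allP => j /H/sub.
- by case/andP=> ->; case: ifP => // _; [exact: sub | case/andP=> /sub-> /sub].
- by case/andP=> /sub -> /allP H; apply/allP => j /H/sub.
Qed.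

Lemma valid_cat D D' : valid_run D -> valid_run D' -> valid_run (D ++ D').
Proof.
elim: D => //= e D IHD /andP[je /IHD H] /H ->; rewrite andbT.
by apply: justified_sub je => x; rewrite mem_cat => ->.
Qed.

(** A run may also contain entries for numbers of no program. Soundness is claimed for numbers of
    programs only, and a justified step of such a program refers to programs again. *)
Lemma valid_run_sound D c v y : valid_run D -> records D (mu_num c) v y -> mu_eval c v y.
Proof.
elim: D c v y => //= e D IHD c v y /andP[je vD] /orP[|]; last exact: IHD.
case/and3P=> /eqP ec /eqP ev /eqP ey; move: je; rewrite /justified ec ev ey decode_mu_num CodeSeq.codeK.
set w := CodeSeq.decode _; move: w => w.
have {}IHD c' v' y' := IHD c' v' y' vD.
case: c {ec ev ey} => [||i|c cs|c d|c]; rewrite /justified_step /=.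
- by move/eqP->; exact: mu_eval_zero.
- by case: v => //= x v /eqP ->; exact: mu_eval_succ.
- by case/andP=> lt_i /eqP ->; exact: mu_eval_proj.
- case/and3P => /eqP[sw] /allP Hw /IHD; apply: mu_eval_comp.
  rewrite size_map in sw.
  rewrite -(mkseq_nth 0 w) -[X in mu_evals X](mkseq_nth MuZero cs) sw.
  apply: mu_evals_map => j j_lt; apply: IHD; have := Hw j; rewrite sw => /(_ j_lt).
  by rewrite (nth_map MuZero) //; move: j_lt; rewrite mem_iota.
- case: v => //= n v; rewrite subn1; case: n => [|n] /=; first by move=> /IHD; exact: mu_eval_rec0.
  by case/andP=> H1 /IHD H2; apply: mu_eval_recS H2; apply: (IHD (MuRec c d)).
- case/andP=> /IHD H0 /allP H; apply: (mu_eval_min (r := nth 0 w)) => // i lt_i.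
  by apply: IHD; apply: H; rewrite mem_iota.
Qed.

Definition step c v y w := CodeSeq.code [:: c; CodeSeq.code v; y; CodeSeq.code w].

Lemma records_step D c v y w : records (step c v y w :: D) c v y.
Proof. by rewrite /records /= /step CodeSeq.codeK /= !eqxx. Qed.

Lemma justified_stepE D c v y w :
  justified D (step c v y w) = justified_step D c (CodeSeq.decode c) v y w.
Proof. by rewrite /justified /step CodeSeq.codeK [nth _ _ 0]/= [nth _ _ 1]/= [nth _ _ 2]/= [nth _ _ 3]/= !CodeSeq.codeK. Qed.

Lemma records_catl D D' c v y : records D c v y -> records (D ++ D') c v y.
Proof. by apply: records_sub => x; rewrite mem_cat => ->. Qed.

Lemma records_catr D D' c v y : records D' c v y -> records (D ++ D') c v y.
Proof. by apply: records_sub => x; rewrite mem_cat => ->; rewrite orbT. Qed.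

Lemma valid_run_complete c v y : mu_eval c v y ->
  exists2 D, valid_run D & records D (mu_num c) v y.
Proof.
pose P c v y := exists2 D, valid_run D & records D (mu_num c) v y.
pose Q cs v w := size w = size cs /\ exists2 D, valid_run D &
  forall j, j < size cs -> records D (mu_num (nth MuZero cs j)) v (nth 0 w j).
suff [H _] : (forall c v y, mu_eval c v y -> P c v y) /\
    (forall cs v w, mu_evals cs v w -> Q cs v w) by exact: H.
have last_step D c' v' y' w' : valid_run D ->
    justified_step D (mu_num c') (CodeSeq.decode (mu_num c')) v' y' w' -> P c' v' y'.
  move=> vD H; exists (step (mu_num c') v' y' w' :: D); last exact: records_step.
  by rewrite /= justified_stepE H.
apply: mu_eval_evals_ind; rewrite {c v y}.
- by move=> v; apply: (@last_step [::] _ _ _ [::]) => //; rewrite decode_mu_num.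
- by move=> x v; apply: (@last_step [::] _ _ _ [::]) => //; rewrite decode_mu_num /justified_step /= eqxx.
- by move=> i v lt_i; apply: (@last_step [::] _ _ _ [::]) => //; rewrite decode_mu_num /justified_step /= lt_i eqxx.
- move=> c cs v w y _ [sw [D vD HD]] _ [D' vD' HD'].
  apply: (@last_step (D ++ D') _ _ _ w); first exact: valid_cat.
  rewrite decode_mu_num /justified_step /= size_map sw eqxx /=.
  rewrite records_catr // andbT; apply/allP => j; rewrite mem_iota /= add0n => lt_j.
  by rewrite (nth_map MuZero) //; apply/records_catl/HD.
- move=> c d v y _ [D vD HD]; apply: (@last_step D _ _ _ [::]) => //.
  by rewrite decode_mu_num /justified_step.
- move=> c d n v r y _ [D vD HD] _ [D' vD' HD'].
  apply: (@last_step (D ++ D') _ _ _ [:: r]); first exact: valid_cat.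
  by rewrite decode_mu_num /justified_step /= subn1 records_catl // records_catr.
- move=> c v n r _ IHr _ [D vD HD].
  have [D' vD' HD'] : exists2 D', valid_run D' &
      forall i, i < n -> records D' (mu_num c) (i :: v) (r i).+1.
    elim: n {HD} IHr => [|n IHn] IHr; first by exists [::].
    have [i lt_i|D1 vD1 HD1] := IHn; first by apply: IHr; exact: ltnW.
    have [D2 vD2 HD2] := IHr n (ltnSn n).
    exists (D1 ++ D2); first exact: valid_cat.
    move=> i; rewrite ltnS leq_eqVlt => /predU1P[->|lt_i]; first exact: records_catr.
    by apply: records_catl; exact: HD1.
  apply: (@last_step (D ++ D') _ _ _ (mkseq r n)); first exact: valid_cat.
  rewrite decode_mu_num /justified_step /= records_catl //=.
  apply/allP => i; rewrite mem_iota /= add0n => lt_i; rewrite nth_mkseq //.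
  by apply: records_catr; exact: HD'.
- by move=> v; split=> //; exists [::].
- move=> c cs v y w _ [D vD HD] _ [sw [D' vD' HD']]; split; first by rewrite /= sw.
  exists (D ++ D'); first exact: valid_cat.
  case=> [|j] /= lt_j; first exact: records_catl.
  by apply: records_catr; exact: HD'.
Qed.

Section ComputableRuns.
Context {A : Type} {eA : Enc A}.

Lemma cp_records (D : A -> seq nat) c (v : A -> seq nat) y :
  computable D -> computable c -> computable v -> computable y ->
  computable (fun a => records (D a) (c a) (v a) (y a)).
Proof.
move=> HD Hc Hv Hy; rewrite /records; cp.
- by apply: (cp_comp Hc); cp.
- by apply: (cp_comp Hv); cp.
- by apply: (cp_comp Hy); cp.
Qed.

End ComputableRuns.

Ltac cp_runs := first [ cp_lists2 | lazymatch goal with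
  | |- computable (fun a => records _ _ _ _) => apply: cp_records
  end ].
Ltac cp_more ::= cp_runs.

Lemma cp_valid_run : computable valid_run.
Proof.
assert (Hj : computable (fun p : seq nat * nat => justified p.1 p.2)).
  by rewrite /justified /justified_step; cp.
(* Each entry is justified by the entries after it, so the fold has to carry the tail along with the
   verdict. *)
assert (H : computable (fun D : seq nat =>
    (foldr (fun e st => (e :: st.1, justified st.1 e && st.2)) ([::] : seq nat, true) D).2)).
  by cp; apply: (cp_comp (f := fun p : seq nat * (nat * (seq nat * bool)) => (p.2.2.1, p.2.1)) Hj); cp.
refine (cp_ext H _) => D.
suff -> : foldr (fun e st => (e :: st.1, justified st.1 e && st.2)) ([::] : seq nat, true) D
  = (D, valid_run D) by [].
by elim: D => //= e D ->.
Qed.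

(** Acceptance with a witness m has the shape of [Sigma01]: a program deciding a relation accepts
    its own number exactly when that number lies in the projection of the relation. For a relation
    projecting to the complement this is a contradiction. *)
Definition self_accepting : set nat :=
  [set x | exists m D, valid_run D && records D x [:: x; m] 1].

Lemma Sigma01_self_accepting : Sigma01 (unary self_accepting).
Proof.
pose W x m := valid_run (behead (CodeSeq.decode m)) &&
  records (behead (CodeSeq.decode m)) x [:: x; nth 0 (CodeSeq.decode m) 0] 1.
apply: (Sigma01_of_check (chk := W)).
  by rewrite /W; cp; apply: (cp_comp cp_valid_run); cp.
move=> x; split=> [[m [D H]]|[m H]].
  by exists (CodeSeq.code (m :: D)); rewrite /W CodeSeq.codeK.
by exists (nth 0 (CodeSeq.decode m) 0), (behead (CodeSeq.decode m)).
Qed.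

Lemma not_Pi01_self_accepting : ~ Pi01 (unary self_accepting).
Proof.
move=> [B [c Hc] HB]; pose x := mu_num c.
have := HB [tuple x]; rewrite /unary /setC /= theadE => HBx.
have BP m : mu_eval c [:: x; m] 1 <-> B [tuple of rcons [tuple x] m].
  have := Hc [tuple of rcons [tuple x] m]; rewrite /= => Hxm; split=> [H|Bm].
    by apply: set_mem; move: (mu_eval_fun Hxm H); case: (_ \in _).
  by move: Hxm; rewrite mem_set.
have SP : self_accepting x <-> exists m, mu_eval c [:: x; m] 1.
  split=> [[m [D /andP[vD HD]]]|[m /valid_run_complete[D vD HD]]].
    by exists m; exact: valid_run_sound vD HD.
  by exists m, D; rewrite vD.
have [S|nS] := pselect (self_accepting x).
  by apply: (proj2 HBx) => //; have [m /BP] := SP.1 S; exists m.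
by have [m /BP Hm] := HBx.1 nS; apply: nS; apply/SP; exists m.
Qed.

Lemma Sigma01_reducible (A B : set nat) :
  computably_reducible (unary B) A -> Sigma01 (unary A) -> Sigma01 (unary B).
Proof.
move=> [f cf fP] /Sigma01_check[chk cchk AP].
pose g x := f [tuple x].
assert (cg : computable g).
  assert (Hs : computable (fun x : nat => [:: x])) by cp.
  exact: (cp_computable_fun (s := fun x => [tuple x]) cf Hs).
apply: (Sigma01_of_check (chk := fun x m => chk [:: g x] m)).
  apply: (cp_comp (f := fun p : nat * nat => ([:: g p.1], p.2)) cchk); cp.
  by apply: (cp_comp cg); cp.
move=> x; have := fP [tuple x]; rewrite {1}/unary /= theadE => ->.
by have := AP [tuple g x]; rewrite /unary /= theadE.
Qed.

Lemma Sigma01_hard_not_Pi01 (A : set nat) : Sigma01_hard A -> ~ Pi01 (unary A).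
Proof.
move=> hA PA; apply: not_Pi01_self_accepting.
have [f cf fP] := hA _ Sigma01_self_accepting.
apply: (@Sigma01_reducible (~` A) (~` self_accepting)) => //; exists f => // v.
by rewrite /unary /setC /= -fP.
Qed.

(** * Folner sets and Banach density *)

Lemma exp2_beats_poly C n K : exists i, C * (K * i).+1 ^ n < 2 ^ i.
Proof.
(* At i = 2 ^ t the left side is below 2 ^ (C + n * (K + t)), so only a linear function of t has to
   be compared with 2 ^ t; the choice of a bounds it by (a + 1) ^ 2 <= 2 ^ t. *)
pose a := C + n * K + 2 * n; pose t := 2 * a; exists (2 ^ t).
have lt_pow x : x < 2 ^ x by exact: ltn_expl.
have Ht : C + n * (K + t) <= 2 ^ t.
  rewrite /t (mulnC 2) expnM; apply: (leq_trans (n := a.+1 ^ 2)); last by rewrite leq_exp2r.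
  by rewrite /a; nia.
have Hb : (K * 2 ^ t).+1 <= 2 ^ (K + t).
  rewrite expnD; apply: (leq_trans (n := K.+1 * 2 ^ t)); last by rewrite leq_mul2r lt_pow orbT.
  have := expn_gt0 2 t; rewrite mulSn /= => H; lia.
apply: (leq_trans (n := 2 ^ C * 2 ^ (n * (K + t)))); last by rewrite -expnD leq_exp2l.
apply: (leq_trans (n := 2 ^ C * (K * 2 ^ t).+1 ^ n)); first by rewrite ltn_mul2r lt_pow expn_gt0.
rewrite leq_mul2l [n * _]mulnC expnM; apply/orP; right.
move: Hb; move: (2 ^ (K + t)) (K * 2 ^ t).+1 => x y yx.
by case: (posnP n) => [->//|n0]; rewrite leq_exp2r.
Qed.

(** The first two terms of the binomial expansion of (K + 1) ^ K both equal K ^ K. *)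
Lemma bernoulli2 K : 0 < K -> 2 * K ^ K <= K.+1 ^ K.
Proof.
case: K => [|K] // _; rewrite -[K.+2]addn1 expnDn (bigD1 ord0) //=.
rewrite (bigD1 (inord 1)) /=; last by apply/eqP => /(congr1 val); rewrite /= inordK.
rewrite inordK // bin0 bin1 !exp1n !muln1 mul1n subn0 subn1 /= -expnS.
by rewrite addnA addnn -mul2n leq_addr.
Qed.

(** Otherwise c grows by a factor of at least (K + 1) / K at each step, hence doubles every K steps,
    against its polynomial bound. *)
Lemma exists_slow_growth (c : nat -> nat) C n K :
  (forall k, 0 < c k <= C * k.+1 ^ n) -> exists k, K * c k.+1 <= K.+1 * c k.
Proof.
move=> Hc; apply: contrapT => H.
have {}H k : K.+1 * c k <= K * c k.+1.
  by rewrite leqNgt; apply/negP => /ltnW Hk; apply: H; exists k.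
have c0 k : 0 < c k by case/andP: (Hc k).
have K0 : 0 < K by case: K H => // /(_ 0); rewrite mul0n mul1n leqNgt c0.
have Hj j : K.+1 ^ j * c 0 <= K ^ j * c j.
  elim: j => [|j IHj]; first by rewrite !mul1n.
  rewrite expnS -mulnA; apply: (leq_trans (n := K.+1 * (K ^ j * c j))); first by rewrite leq_mul2l IHj orbT.
  by rewrite mulnCA expnSr -mulnA leq_mul2l H orbT.
have [i Hi] := exp2_beats_poly C n K.
have := Hj (K * i); rewrite !expnM leqNgt => /negP; apply.
case/andP: (Hc (K * i)) => _ Hci.
apply: (leq_ltn_trans (n := (K ^ K) ^ i * (C * (K * i).+1 ^ n))); first by rewrite leq_mul2l Hci orbT.
apply: (leq_trans (n := (K ^ K) ^ i * 2 ^ i)); first by rewrite ltn_mul2l !expn_gt0 K0.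
rewrite -expnMn mulnC; apply: (leq_trans (n := (K.+1 ^ K) ^ i)); last by rewrite leq_pmulr.
by case: i {Hi Hci} => // i; rewrite leq_exp2r // bernoulli2.
Qed.

Section Growth.
Variables (S : eqType) (op : S -> S -> S).
Hypotheses (opA : associative op) (opC : commutative op).

(** The products g_1 ^ j_1 ... g_m ^ j_m x with x in L and exponents at most k. The list L
    prescribes elements of the almost invariant set, which later forces that set to be large. *)
Fixpoint boxes (L G : seq S) k : seq S :=
  if G is g :: G' then
    flatten [seq [seq iter j (op g) x | x <- boxes L G' k] | j <- iota 0 k.+1]
  else L.

Lemma boxesP L g G k x : reflect (exists2 j, j <= k & exists2 y, y \in boxes L G k & x = iter j (op g) y)
  (x \in boxes L (g :: G) k).
Proof.
apply: (iffP flatten_mapP) => [[j]|[j jk Hj]].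
  by rewrite mem_iota => /= jk /mapP[y Hy ->]; exists j => //; exists y.
by exists j; [rewrite mem_iota | case: Hj => y Hy ->; exact: map_f].
Qed.

Lemma size_boxes L G k : size (boxes L G k) = size L * k.+1 ^ size G.
Proof.
elim: G => [|g G IHG]; first by rewrite muln1.
transitivity (size (flatten [seq [seq iter j (op g) x | x <- boxes L G k] | j <- iota 0 k.+1])) => //.
rewrite size_flatten /shape -map_comp.
rewrite (eq_map (g := fun=> size L * k.+1 ^ size G)) => [|j]; last by rewrite /= size_map IHG.
have -> m s : sumn [seq m | _ <- s] = m * @size nat s by elim: s => [|_ s IHs] /=; lia.
by rewrite size_iota expnSr mulnA.
Qed.

Lemma boxes_base L G k : {subset L <= boxes L G k}.
Proof.
by elim: G => //= g G IHG x /IHG Hx; apply/boxesP; exists 0 => //; exists x.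
Qed.

Lemma boxes_mono L G k : {subset boxes L G k <= boxes L G k.+1}.
Proof.
elim: G => // g G IHG x /boxesP[j jk [y /IHG Hy ->]].
by apply/boxesP; exists j; [exact: leqW | exists y].
Qed.

Lemma boxes_step L G k g x : g \in G -> x \in boxes L G k -> op g x \in boxes L G k.+1.
Proof.
elim: G g x => // h G IHG g x; rewrite inE => gG /boxesP[j jk [y Hy ->]].
have [->|gh] := eqVneq g h.
  by apply/boxesP; exists j.+1 => //; exists y => //; exact: boxes_mono.
move: gG; rewrite (negbTE gh) /= => gG; apply/boxesP; exists j; first exact: leqW.
exists (op g y); first exact: IHG.
by elim: j {jk} => //= j <-; rewrite !opA (opC g).
Qed.

(* Polynomial growth of the boxes makes some consecutive pair of them close. *)
Lemma almost_invariant_seq (L G : seq S) K : 0 < size L ->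
  exists T U : seq S, [/\ uniq T, uniq U, {subset L <= T}, {subset T <= U} &
    (forall g x, g \in G -> x \in T -> op g x \in U) /\ K * size U <= K.+1 * size T].
Proof.
move=> L0; pose c k := size (undup (boxes L G k)).
have [k Hk] : exists k, K * c k.+1 <= K.+1 * c k.
  apply: (@exists_slow_growth _ (size L) (size G)) => k; apply/andP; split.
    have [x xL] : exists x, x \in L by case: {c} L L0 => // x L; exists x; exact: mem_head.
    have : x \in undup (boxes L G k) by rewrite mem_undup; exact: boxes_base.
    by rewrite /c; case: (undup _).
  by rewrite -size_boxes size_undup.
exists (undup (boxes L G k)), (undup (boxes L G k.+1)).
split; rewrite ?undup_uniq //.
- by move=> x; rewrite mem_undup; exact: boxes_base.
- by move=> x; rewrite !mem_undup; exact: boxes_mono.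
split=> // g x gG; rewrite !mem_undup; exact: boxes_step.
Qed.

End Growth.

Import Order.TTheory GRing.Theory Num.Theory.
Import numFieldNormedType.Exports.
Local Open Scope ring_scope.

(** An ultrafilter containing the cofinite sets selects, for each x, the value that c N x takes for
    almost all N; finitely many x then agree at arbitrarily late N. This is the compactness argument
    for partitions and for densities. *)
Lemma limit_coloring (c : nat -> nat -> nat) l : (forall N x, c N x < l)%N ->
  exists2 d : nat -> nat, (forall x, d x < l)%N &
    forall M N0, exists2 N, (N0 <= N)%N & forall x, (x < M)%N -> c N x = d x.
Proof.
move=> cl; have [U [UU sU]] := ultraFilterLemma (eventually_filter).
have Hx x : exists d, (d < l)%N /\ U [set N | c N x = d].
  apply: contrapT => H.
  have : U [set N | forall j : 'I_l, c N x <> j].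
    apply: (filter_forall (f := fun (j : 'I_l) N => c N x <> j)) => j.
    have [Uj|//] := in_ultra_setVsetC [set N | c N x = j] UU.
    by case: H; exists j.
  by case/filter_ex => N /(_ (Ordinal (cl N x))).
have [d dP] := choice Hx; exists d => [x|M N0]; first by case: (dP x).
have U1 : U [set N | forall x : 'I_M, c N x = d x].
  by apply: (filter_forall (f := fun (x : 'I_M) N => c N x = d x)) => x; case: (dP x).
have U2 : U [set N | (N0 <= N)%N] by apply: sU; exists N0.
have [N [/= H1 H2]] := filter_ex (filterI U1 U2).
by exists N => // x xM; exact: (H1 (Ordinal xM)).
Qed.

Section Density.
Variables (S : choiceType) (op : S -> S -> S) (rT : realType).
Hypotheses (opA : associative op) (opC : commutative op).
Hypothesis opI : forall s, injective (op s).
Variables (e : nat -> S) (idx : S -> nat).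
Hypothesis idxK : cancel idx e.

Definition hits (F : {fset S}) (A : set S) : nat := (\sum_(x <- F) (x \in A))%N.
(** A preimage, so that no inverse of s is involved: multiplying a root in the dilate by s gives a
    candidate root in A. *)
Definition dilate (s : S) (A : set S) : set S := [set x | A (op s x)].

Lemma count_hits (F : {fset S}) (A : set S) : hits F A = count [in A] F.
Proof. by rewrite /hits -sum1_count [RHS]big_mkcond; apply: eq_bigr => x _; case: (x \in A). Qed.

Lemma card_hits (F : {fset S}) (A : set S) : #|` [fset x in F | x \in A]%fset| = hits F A.
Proof.
rewrite count_hits -size_filter; apply: perm_size; apply: uniq_perm.
- exact: fset_uniq.
- by rewrite filter_uniq // fset_uniq.
- by move=> x; rewrite mem_filter !inE /= andbC.
Qed.

Lemma hits_le (F : {fset S}) A : (hits F A <= #|` F|)%N.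
Proof. by rewrite count_hits count_size. Qed.

Lemma hits_setT (F : {fset S}) : hits F setT = #|` F|.
Proof. by rewrite count_hits -[RHS](count_predT F); apply: eq_count => x; exact: in_setT. Qed.

Lemma in_dilate s A x : (x \in dilate s A) = (op s x \in A).
Proof. by apply/idP/idP; rewrite !inE. Qed.

Lemma hits_dilate (F : {fset S}) t A :
  (hits F A <= hits F (dilate t A) + #|` fset_symdiff (left_translate op t F) F|)%N.
Proof.
have -> : hits F (dilate t A) = hits (left_translate op t F) A.
  rewrite !count_hits; transitivity (count [in A] [seq op t x | x <- F]).
    by rewrite count_map; apply: eq_count => x; rewrite /= in_dilate.
  apply/seq.permP; apply: uniq_perm; rewrite ?fset_uniq ?map_inj_uniq ?fset_uniq //.
  by move=> x; apply/mapP/imfsetP => /= -[y Hy ->]; exists y.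
rewrite -!card_hits; set T := left_translate _ _ _.
apply: leq_trans (leq_card_fsetU _ _); apply: fsubset_leq_card; apply/fsubsetP => x.
by rewrite !inE /= => /andP[-> ->]; case: (x \in T).
Qed.

Definition almost_invariant (eta : rT) (F : {fset S}) (g : S) :=
  (#|` fset_symdiff (left_translate op g F) F|%:R <= eta * #|` F|%:R).

Lemma exists_almost_invariant (G : {fset S}) (eta : rT) : 0 < eta ->
  exists2 F : {fset S}, F != fset0 & forall g, g \in G -> almost_invariant eta F g.
Proof.
(* F and its translate both have |F| elements and lie in a set V with K |V| <= (K + 1) |F|, so each
   half of their symmetric difference has at most |F| / K elements. *)
move=> eta0; pose K := (Num.truncn (2 / eta)).+1.
have HK : 2 <= eta * K%:R.
  rewrite mulrC -ler_pdivrMr //; apply: ltW; rewrite /K.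
  exact: truncnS_gt.
have [T [U [uT uU sLT sTU [TU cTU]]]] :=
  @almost_invariant_seq S op opA opC [:: e 0] (enum_fset G) K isT.
pose F := [fset x in T]%fset; pose V := [fset x in U]%fset.
have cF : #|` F| = size T by rewrite /F card_fseq undup_id.
have cV : #|` V| = size U by rewrite /V card_fseq undup_id.
exists F => [|g gG].
  by apply/fset0Pn; exists (e 0); rewrite inE; apply: sLT; rewrite mem_head.
have cgF : #|` left_translate op g F| = #|` F| by rewrite card_imfset.
have gFV : (left_translate op g F `<=` V)%fset.
  by apply/fsubsetP => x /imfsetP[y /=]; rewrite !inE => yT ->; exact: TU.
have FV : (F `<=` V)%fset by apply/fsubsetP => x; rewrite !inE; exact: sTU.
have H (P Q : {fset S}) : (P `<=` V)%fset -> #|` Q| = #|` F| -> (Q `<=` V)%fset ->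
    (K * #|` P `\` Q|%fset <= size T)%N.
  move=> PV cQ QV; apply: (@leq_trans (K * #|` V `\` Q|%fset)%N).
    by rewrite leq_mul2l fsubset_leq_card ?orbT // fsetSD.
  by rewrite cardfsDS // cV cQ cF mulnBr leq_subLR; move: cTU; rewrite mulSn addnC.
have H2 : (K * #|` fset_symdiff (left_translate op g F) F| <= 2 * #|` F|)%N.
  have := H _ _ gFV erefl FV; have := H _ _ FV cgF gFV; rewrite cF => h1 h2.
  apply: (@leq_trans (K * (#|` left_translate op g F `\` F|%fset + #|` F `\` left_translate op g F|%fset))%N).
    by rewrite leq_mul2l leq_card_fsetU orbT.
  by rewrite mulnDr mul2n -addnn leq_add.
rewrite /almost_invariant.
move: H2; rewrite -(ler_nat rT) !natrM => H2.
have K0 : 0 < K%:R :> rT by rewrite ltr0n.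
rewrite -(ler_pM2l K0) (le_trans H2) // mulrA [K%:R * _]mulrC.
by rewrite ler_wpM2r // ler0n.
Qed.

(** Both sides count the pairs (t, f) with [op t f] in A; commutativity turns dilates by t into
    dilates by f. *)
Lemma exchange_hits (F T : {fset S}) A :
  (\sum_(t <- T) hits F (dilate t A) = \sum_(f <- F) hits T (dilate f A))%N.
Proof.
rewrite /hits exchange_big /=; apply: eq_bigr => f _; apply: eq_bigr => t _.
by rewrite !in_dilate opC.
Qed.

Lemma sumr_const_fset (F : {fset S}) (c : rT) : \sum_(x <- F) c = #|` F|%:R * c.
Proof. by rewrite big_const_seq count_predT iter_addr_0 mulr_natl. Qed.

Lemma average_hits_ge (F T : {fset S}) A eta :
  (forall t, t \in T -> almost_invariant eta F t) ->
  #|` T|%:R * ((hits F A)%:R - eta * #|` F|%:R) <= \sum_(f <- F) (hits T (dilate f A))%:R :> rT.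
Proof.
move=> HT; rewrite -sumr_const_fset -natr_sum -exchange_hits natr_sum.
rewrite [leLHS]big_seq [leRHS]big_seq; apply: ler_sum => t tT.
have := hits_dilate F t A; rewrite -(ler_nat rT) natrD => H.
by have := HT _ tT; rewrite /almost_invariant => H2; lra.
Qed.

Lemma average_hits_le (F T : {fset S}) A eta theta :
  (forall t, t \in T -> almost_invariant eta F t) ->
  (forall f, f \in F -> (hits T (dilate f A))%:R <= theta) ->
  #|` T|%:R * ((hits F A)%:R - eta * #|` F|%:R) <= #|` F|%:R * theta.
Proof.
move=> HT HF; apply: le_trans (average_hits_ge A HT) _.
by rewrite -sumr_const_fset [leLHS]big_seq [leRHS]big_seq; apply: ler_sum => f /HF.
Qed.

(** Far along a Folner sequence, the density of A is nearly an average of its densities in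
    translates of T. *)
Lemma upper_Banach_density_le (T : {fset S}) A (theta : rT) : T != fset0 ->
  (forall s, (hits T (dilate s A))%:R <= theta * #|` T|%:R) ->
  (upper_Banach_density op rT A <= theta%:E)%E.
Proof.
move=> T0 HT; have cT : 0 < #|` T|%:R :> rT by rewrite ltr0n cardfs_gt0.
apply: ge_ereal_sup => _ [F [F0 Ffol] <-].
apply/lee_addgt0Pr => eps eps0; rewrite -EFinD.
have [N _ HN] : \forall n \near \oo, forall t, t \in T -> almost_invariant eps (F n) t.
  have : \forall n \near \oo, forall t : T, almost_invariant eps (F n) (val t).
    apply: (filter_forall (f := fun (t : T) n => almost_invariant eps (F n) (val t))) => t.
    have /cvgrPdist_le /(_ eps eps0) := Ffol (val t); apply: filterS => n.
    rewrite sub0r normrN ger0_norm ?divr_ge0 // ler_pdivrMr ?ltr0n ?cardfs_gt0 //.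
  by apply: filterS => n Hn t tT; exact: (Hn [` tT]%fset).
(* An upper limit is an infimum of suprema over the sets of the filter; the tail from N on is one of
   these sets. *)
apply: ereal_inf_le; exists (ereal_sup [set ((#|` [fset x in F n | x \in A]%fset|)%:R
                       / (#|` F n|)%:R : rT)%:E | n in [set n | (N <= n)%N]]).
  by exists [set n | (N <= n)%N] => //; exists N.
apply: ge_ereal_sup => _ [n /= Nn <-]; rewrite lee_fin card_hits.
have cF : 0 < #|` F n|%:R :> rT by rewrite ltr0n cardfs_gt0.
rewrite ler_pdivrMr // -(ler_pM2l cT).
have H := average_hits_le (HN n Nn) (fun f _ => HT f); lra.
Qed.

Lemma exists_dense_dilate (delta : rT) (A : set S) (T : {fset S}) :
  (delta%:E <= upper_Banach_density op rT A)%E -> T != fset0 ->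
  exists s, delta * #|` T|%:R <= (hits T (dilate s A))%:R.
Proof.
move=> HA T0; apply: contrapT => H.
have cT : 0 < #|` T|%:R :> rT by rewrite ltr0n cardfs_gt0.
have {}H s : (hits T (dilate s A))%:R < delta * #|` T|%:R.
  by rewrite ltNge; apply/negP => Hs; apply: H; exists s.
(* Counts are integers, so strict inequality for every s leaves a gap: the largest admissible m
   bounds all counts, and still m / |T| < delta. *)
pose P m := (m%:R < delta * #|` T|%:R) && (m <= #|` T|)%N.
have exP : exists m, P m by exists (hits T (dilate (e 0) A)); rewrite /P H hits_le.
have ubP m : P m -> (m <= #|` T|)%N by case/andP.
case: (ex_maxnP exP ubP) => m /andP[Hm _] max_m.
have : (upper_Banach_density op rT A <= (m%:R / #|` T|%:R : rT)%:E)%E.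
  apply: (upper_Banach_density_le T0) => s; rewrite divfK ?gt_eqF // ler_nat.
  by apply: max_m; rewrite /P H hits_le.
move/(le_trans HA); rewrite lee_fin leNgt => /negP; apply.
by rewrite ltr_pdivrMr.
Qed.

Lemma le_upper_Banach_density (F : nat -> {fset S}) A (delta : rT) c :
  left_Folner op rT F ->
  (forall n, (delta - c / n.+1%:R) * #|` F n|%:R <= (hits (F n) A)%:R) ->
  (delta%:E <= upper_Banach_density op rT A)%E.
Proof.
move=> FF HF; apply: (@le_trans _ _ (upper_density_along rT F A)); last first.
  by apply: ereal_sup_ubound; exists F.
apply: le_ereal_inf_tmp => _ [V VV <-].
apply/lee_subgt0Pr => eps eps0.
have [N _ HN] : \forall n \near \oo, V n /\ `|c / n.+1%:R| <= eps.
  apply: filterI => //; have : (fun n => c * harmonic n) @ \oo --> c * (0 : rT).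
    by apply: cvgMr; exact: cvg_harmonic.
  rewrite mulr0 => /cvgrPdist_le /(_ eps eps0); apply: filterS => n.
  by rewrite sub0r normrN.
have [/= VN cN] := HN N (leqnn N).
apply: le_trans (ereal_sup_ubound _); last by exists N => //; exact: VN.
rewrite -EFinB lee_fin card_hits.
have cF : 0 < #|` F N|%:R :> rT by rewrite ltr0n cardfs_gt0; case: FF.
rewrite ler_pdivlMr //; apply: le_trans (HF N); rewrite ler_pM2r //.
by rewrite lerD2l lerN2 (le_trans (ler_norm _)).
Qed.

Lemma left_Folner_of (F : nat -> {fset S}) : (forall n, F n != fset0) ->
  (forall n i, (i <= n)%N -> almost_invariant n.+1%:R^-1 (F n) (e i)) ->
  left_Folner op rT F.
Proof.
move=> F0 HF; split=> // s; apply/cvgrPdist_le => eps eps0.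
have [N _ HN] : \forall n \near \oo, `|harmonic n| <= eps :> rT.
  have /cvgrPdist_le /(_ eps eps0) := @cvg_harmonic rT.
  by apply: filterS => n; rewrite sub0r normrN.
exists (maxn N (idx s)) => // n /=; rewrite geq_max => /andP[Nn sn].
rewrite sub0r normrN ger0_norm ?divr_ge0 //.
rewrite ler_pdivrMr ?ltr0n ?cardfs_gt0 //; have := HF n _ sn; rewrite idxK => H.
apply: le_trans H _; apply: ler_wpM2r => //.
by apply: le_trans (ler_norm _) (HN n Nn).
Qed.

Lemma exists_Folner (P : nat -> {fset S} -> Prop) :
  (forall n (G : {fset S}) (eta : rT), 0 < eta -> exists F, [/\ F != fset0,
      forall g, g \in G -> almost_invariant eta F g & P n F]) ->
  exists2 F, left_Folner op rT F & forall n, P n (F n).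
Proof.
move=> H.
have /choice[F HF] n : exists F, [/\ F != fset0,
    forall i, (i <= n)%N -> almost_invariant n.+1%:R^-1 F (e i) & P n F].
  have [F [F0 Fi PF]] := H n [fset e i | i in iota 0 n.+1]%fset n.+1%:R^-1 ltac:(by rewrite invr_gt0 ltr0n).
  exists F; split=> // i i_n; apply: Fi; apply/imfsetP; exists i => //.
  by rewrite -[_ \in _]/(i \in iota 0 n.+1) mem_iota.
exists F => [|n]; last by case: (HF n).
by apply: left_Folner_of => n; case: (HF n).
Qed.

Lemma upper_Banach_density_setT (delta : rT) : delta <= 1 ->
  (delta%:E <= upper_Banach_density op rT setT)%E.
Proof.
move=> d1; have [F FF _] : exists2 F, left_Folner op rT F & forall n : nat, True.
  apply: (exists_Folner (P := fun _ _ => True)) => n G eta /(exists_almost_invariant G)[F F0 HF].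
  by exists F.
apply: (le_upper_Banach_density (c := 0) FF) => n.
by rewrite mul0r subr0 hits_setT ler_piMl.
Qed.

Lemma exists_ge_average (G : {fset S}) (phi : S -> rT) X : G != fset0 ->
  #|` G|%:R * X <= \sum_(f <- G) phi f -> exists2 f, f \in G & X <= phi f.
Proof.
move=> G0 HX; apply: contrapT => H.
have {}H f : f \in G -> phi f < X.
  by move=> fG; rewrite ltNge; apply/negP => Hf; apply: H; exists f.
move: HX; rewrite leNgt => /negP; apply.
have [f0 f0G] := fset0Pn _ G0.
rewrite -sumr_const_fset (big_fsetD1 f0) //= [ltRHS](big_fsetD1 f0) //=.
apply: ltr_leD; first exact: H.
rewrite [leLHS]big_seq [leRHS]big_seq; apply: ler_sum => f.
by rewrite !inE => /andP[_ /H/ltW].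
Qed.

Lemma sum_half_powers N : \sum_(n < N) (2^-1 : rT) ^+ n <= 2.
Proof.
suff -> : \sum_(n < N) (2^-1 : rT) ^+ n = 2 - 2 * 2^-1 ^+ N.
  by rewrite lerBlDr lerDl mulr_ge0 // exprn_ge0 // invr_ge0.
elim: N => [|N IHN]; first by rewrite big_ord0 expr0; lra.
by rewrite big_ord_recr /= IHN exprS; lra.
Qed.

(** * Dense members of hereditary, dilation-closed families of finite character *)

Section FreeSets.
Variable Free : set S -> Prop.
Hypothesis Free_sub : forall A B, A `<=` B -> Free B -> Free A.
Hypothesis Free_dilate : forall s A, Free A -> Free (dilate s A).
Hypothesis Free_fin : forall A,
  (forall F : {fset S}, [set` F] `<=` A -> Free [set` F]) -> Free A.

Lemma exists_max_free : (exists A, Free A) ->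
  exists m : {fset S} -> nat, forall T,
    (exists2 A, Free A & hits T A = m T) /\ (forall A, Free A -> (hits T A <= m T)%N).
Proof.
move=> [A0 freeA0].
suff H (T : {fset S}) : exists m, (exists2 A, Free A & hits T A = m) /\
    (forall A, Free A -> (hits T A <= m)%N).
  by have [m Hm] := choice H; exists m.
pose P m := `[< exists2 A, Free A & hits T A = m >].
have exP : exists m, P m by exists (hits T A0); apply/asboolP; exists A0.
have ubP m : P m -> (m <= #|` T|)%N by move/asboolP => [A _ <-]; exact: hits_le.
case: (ex_maxnP exP ubP) => m /asboolP Hm max_m; exists m; split=> // A freeA.
by apply: max_m; apply/asboolP; exists A.
Qed.

(** The limit agrees with arbitrarily late sets [B N] on any given finite set. This yields freeness,
    a property of finite character, and the bound in each window. *)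
Lemma free_window_limit (F : nat -> {fset S}) (q : nat -> rT) :
  (forall N, exists2 B, Free B & forall n, (n < N)%N -> q n <= (hits (F n) B)%:R) ->
  exists2 B, Free B & forall n, q n <= (hits (F n) B)%:R.
Proof.
move=> H; have [B HB] := choice (P := fun N B => Free B /\
   forall n, (n < N)%N -> q n <= (hits (F n) B)%:R) (fun N => let: ex_intro2 B f h := H N in ex_intro _ B (conj f h)).
have [d _ Hd] := limit_coloring (c := fun N x => nat_of_bool (e x \in B N)) (l := 2) (fun N x => leq_b1 _).
pose L : set S := [set s | d (idx s) = 1%N].
have agree (T : {fset S}) N0 : exists2 N, (N0 <= N)%N & forall s, s \in T -> (s \in L) = (s \in B N).
  have [N NN0 HN] := Hd (\max_(s <- T) (idx s).+1)%N N0; exists N => // s sT.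
  have := HN (idx s) (@leq_bigmax_seq _ _ xpredT (fun s => (idx s).+1) s sT isT); rewrite idxK => E.
  have -> : (s \in L) = (d (idx s) == 1%N) by apply/idP/eqP; rewrite inE.
  by rewrite -E; case: (s \in B N).
exists L.
  apply: Free_fin => T TL; have [N _ HN] := agree T 0%N.
  apply: Free_sub (proj1 (HB N)) => s sT; apply: set_mem; rewrite -HN //.
  by rewrite inE; exact: TL.
move=> n; have [N nN HN] := agree (F n) n.+1.
suff -> : hits (F n) L = hits (F n) (B N) by exact: (proj2 (HB N)).
by rewrite !count_hits; apply: eq_in_count => s; exact: HN.
Qed.

(* With D the infimum over finite T of the maximal density of a free subset of
   T, choose a Folner sequence of windows F n whose maximal free density exceeds
   D by very little.  On average over its dilates a large free set has density
   about D in each window; as no window can be much better than D, some dilate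
   is good for all of the first N windows at once. *)
Lemma exists_free_of_density (delta : rT) :
  (forall T : {fset S}, T != fset0 -> exists2 A, Free A & delta * #|` T|%:R <= (hits T A)%:R) ->
  exists2 A, Free A & (delta%:E <= upper_Banach_density op rT A)%E.
Proof.
move=> Hdelta.
have cT0 (T : {fset S}) : T != fset0 -> 0 < #|` T|%:R :> rT by rewrite ltr0n cardfs_gt0.
have e0 : [fset e 0]%fset != fset0 by apply/fset0Pn; exists (e 0); rewrite inE.
have [A0 freeA0 _] := Hdelta _ e0.
have [m Hm] := exists_max_free (ex_intro _ A0 freeA0).
pose Q := [set r : rT | exists2 T : {fset S}, T != fset0 & r = (m T)%:R / #|` T|%:R].
have Q0 : Q !=set0 by exists ((m [fset e 0]%fset)%:R / #|` [fset e 0]%fset|%:R); exists [fset e 0]%fset.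
have lbQ : has_lbound Q by exists 0 => _ [T _ ->]; rewrite divr_ge0.
pose D := inf Q.
have D_le T : T != fset0 -> D * #|` T|%:R <= (m T)%:R.
  by move=> T0; rewrite -ler_pdivlMr ?cT0 //; apply: ge_inf => //; exists T.
have D_adh eta : 0 < eta -> exists2 T : {fset S}, T != fset0 & (m T)%:R <= (D + eta) * #|` T|%:R.
  move=> eta0; have [_ [T T0 ->] HT] := inf_adherent eta0 (conj Q0 lbQ).
  by exists T => //; rewrite -ler_pdivrMr ?cT0 // ltW.
have deltaD : delta <= D.
  apply: lb_le_inf => // _ [T T0 ->]; rewrite ler_pdivlMr ?cT0 //.
  have [A freeA HA] := Hdelta T T0; apply: le_trans HA _; rewrite ler_nat.
  by case: (Hm T) => _; exact.
(* The weighted excesses w n * eta n = 2 ^- n sum to at most 2, and dividing a bounded loss by w n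
   leaves an error of order 1 / (n + 1) in window n, which vanishes along the sequence. *)
pose w n : rT := n.+1%:R; pose eta n : rT := 2^-1 ^+ n / w n.
have w0 n : 0 < w n by rewrite ltr0n.
have eta0 n : 0 < eta n by rewrite divr_gt0 // exprn_gt0 // invr_gt0.
have [F FF HF] : exists2 F, left_Folner op rT F & forall n, (m (F n))%:R <= (D + eta n) * #|` F n|%:R.
  apply: (exists_Folner (P := fun n F => (m F)%:R <= (D + eta n) * #|` F|%:R)) => n G xi xi0.
  have heta0 : 0 < eta n / 2 by rewrite divr_gt0.
  have [T T0 HT] := D_adh _ heta0.
  (* By averaging over T, a set nearly invariant under T has maximal free density at most that of T
     plus eta n / 2. So near-optimality survives when invariance under G is imposed as well. *)
  have [F F0 Finv] := exists_almost_invariant (G `|` T)%fset (eta := Num.min xi (eta n / 2)) ltac:(by rewrite lt_min xi0).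
  exists F; split=> // [g gG|].
    have := Finv g; rewrite inE gG => /(_ isT) H; apply: le_trans H _.
    by apply: ler_wpM2r => //; rewrite ge_min lexx.
  have [[A freeA <-] _] := Hm F.
  have HTA : forall t, t \in T -> almost_invariant (eta n / 2) F t.
    move=> t tT; have := Finv t; rewrite inE tT orbT => /(_ isT) H; apply: le_trans H _.
    by apply: ler_wpM2r => //; rewrite ge_min lexx orbT.
  have := average_hits_le (A := A) (theta := (m T)%:R) HTA.
  have HfA f : f \in F -> (hits T (dilate f A))%:R <= (m T)%:R :> rT.
    by move=> _; rewrite ler_nat; apply: (proj2 (Hm T)); exact: Free_dilate.
  move=> /(_ HfA) H1; rewrite -(ler_pM2l (cT0 _ T0)).
  have cF : 0 < #|` F|%:R :> rT by exact: cT0.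
  have H2 : #|` F|%:R * (m T)%:R <= #|` F|%:R * ((D + eta n / 2) * #|` T|%:R).
    by rewrite ler_pM2l.
  lra.
have F0 n : F n != fset0 by case: FF.
have [B freeB HB] : exists2 B, Free B & forall n, (D - 3 / n.+1%:R) * #|` F n|%:R <= (hits (F n) B)%:R.
  apply: (free_window_limit (q := fun n => (D - 3 / n.+1%:R) * #|` F n|%:R)) => N.
  pose W : rT := \sum_(n < N) w n; have W0 : 0 <= W by apply: sumr_ge0 => n _; exact: ltW.
  (* Imperfect invariance of G costs W * theta <= 1 over all windows; with the total excess 2 this
     makes the constant 3. *)
  pose theta := (1 + W)^-1; have theta0 : 0 < theta by rewrite invr_gt0; lra.
  have thetaW : theta * W <= 1 by rewrite /theta mulrC ler_pdivrMr; lra.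
  pose G0 := (\bigcup_(n <- iota 0 N) F n)%fset.
  have [G Gn0 Ginv] := exists_almost_invariant G0 theta0.
  have [[A freeA HA] _] := Hm G.
  pose phi f : rT := \sum_(n < N) w n * ((hits (F n) (dilate f A))%:R / #|` F n|%:R).
  have [f fG Hf] : exists2 f, f \in G & W * (D - theta) <= phi f.
    apply: exists_ge_average => //; rewrite exchange_big /= mulr_suml mulr_sumr.
    apply: ler_sum => n _; rewrite -mulr_sumr mulrCA ler_pM2l // -mulr_suml.
    rewrite ler_pdivlMr ?cT0 //.
    have FnG t : t \in F n -> almost_invariant theta G t.
      move=> tF; apply: Ginv; apply/bigfcupP; exists (val n) => //.
      by rewrite andbT mem_iota /=.
    apply: le_trans (average_hits_ge A FnG).
    have := D_le G Gn0; rewrite -HA => H.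
    by rewrite [leLHS]mulrC ler_wpM2l //; lra.
  exists (dilate f A); first exact: Free_dilate.
  move=> n nN; pose d k : rT := (hits (F k) (dilate f A))%:R / #|` F k|%:R.
  have dle k : d k <= D + eta k.
    rewrite /d ler_pdivrMr ?cT0 //; apply: le_trans (HF k); rewrite ler_nat.
    by apply: (proj2 (Hm _)); exact: Free_dilate.
  (* The other windows exceed D by at most eta k each, so they cannot make up for a window n far
     below D. *)
  have Hphi : phi f <= w n * d n + ((W - w n) * D + 2).
    rewrite /phi (bigD1 (Ordinal nN)) //= lerD2l.
    have -> : W - w n = \sum_(i < N | i != Ordinal nN) w i.
      by rewrite /W (bigD1 (Ordinal nN)) //= addrAC subrr add0r.
    apply: le_trans (_ : \sum_(i < N | i != Ordinal nN) (w i * D + 2^-1 ^+ i) <= _).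
      apply: ler_sum => i _; have -> : 2^-1 ^+ i = w i * eta i.
        by rewrite /eta mulrC divfK // gt_eqF.
      by rewrite -mulrDr ler_pM2l //; exact: dle.
    rewrite big_split /= -mulr_suml lerD2l; apply: le_trans (sum_half_powers N).
    rewrite [leRHS](bigD1 (Ordinal nN)) //= lerDr exprn_ge0 // invr_ge0 //.
  rewrite -ler_pdivlMr ?cT0 // -/(d n) -/(w n).
  rewrite -(ler_pM2l (w0 n)) mulrBr [_ * (3 / _)]mulrC divfK ?gt_eqF //.
  by have := le_trans Hf Hphi; rewrite mulrBr [W * theta]mulrC => H; lra.
exists B => //; apply: le_trans (_ : D%:E <= _)%E; first by rewrite lee_fin.
exact: (le_upper_Banach_density FF HB).
Qed.

End FreeSets.
End Density.

(** * Differences in dense sets *)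

Section Differences.
Variables (R : idomainType) (e : nat -> R).
Hypothesis e_inj : injective e.

Lemma exists_fresh (s : seq R) : exists x, x \notin s.
Proof.
apply: contrapT => H.
have sub : {subset [seq e i | i <- iota 0 (size s).+1] <= s}.
  by move=> x _; apply: contrapT => /negP xs; apply: H; exists x.
have := uniq_leq_size _ sub; rewrite map_inj_uniq ?iota_uniq // => /(_ isT).
by rewrite size_map size_iota ltnn.
Qed.

Definition spread (I : finType) (b : I -> R) (r : R) (y z : I -> R) :=
  [/\ injective y, injective z, forall i j, y i != z j & forall i, y i - z i = r * b i].

(* For each shift r_j, a subset T' of T of positive density, cut into #|I|
   disjoint parts of size s, gives s ^ #|I| points of a set U ^ I, where U is
   barely larger than T; two shifts must therefore share a point. *)
Lemma dense_differences (I : finType) (b : I -> R) (k : nat) :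
  (0 < #|I|)%N -> (forall i, b i != 0) ->
  exists2 D : seq R, 0 \notin D &
  forall E : seq R, exists T : seq R,
    [/\ (0 < size T)%N, uniq T, {in T, forall x, x \notin E} &
    forall T' : seq R, uniq T' -> {subset T' <= T} -> (size T <= k * size T')%N ->
    exists2 r, r \in D & exists y z : I -> R,
      (forall i, y i \in T' /\ z i \in T') /\ spread b r y z].
Proof.
move=> I0 b0; set m := #|I|.
(* The estimates |U| <= 2 |T|, |T| <= k |T'| and |T'| <= 2 s m bound U ^ I by (4 k m s) ^ m points,
   which is less than the M s ^ m points given by M shifts. *)
pose M := ((4 * k * m) ^ m).+1.
pose D := [seq x <- [seq e (nat_of_ord jl.1) - e (nat_of_ord jl.2) | jl <- enum {: 'I_M * 'I_M}] | x != 0].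
(* D is fixed before E: in [brauer] the elements to be avoided are themselves built from D. *)
exists D; first by rewrite mem_filter eqxx.
move=> E; pose G := [seq e (nat_of_ord ji.1) * b ji.2 | ji <- enum {: 'I_M * I}].
(* Starting from m k + 1 elements makes T' have at least m elements, so that the parts of size s are
   nonempty. *)
have [T0 [U [uT0 uU sLT sTU [TU cTU]]]] :=
  @almost_invariant_seq R +%R (@addrA R) (@addrC R) [seq e i | i <- iota 0 (m * k).+1] G 1
    ltac:(by rewrite size_map size_iota).
have sT0 : (m * k < size T0)%N.
  have := uniq_leq_size _ sLT; rewrite map_inj_uniq // iota_uniq => /(_ isT).
  by rewrite size_map size_iota.
(* Translation moves T away from E and leaves all differences unchanged. *)
have [t Ht] := exists_fresh [seq x - y | x <- E, y <- T0].
pose T := [seq x + t | x <- T0]; exists T; split.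
- by rewrite size_map (leq_ltn_trans _ sT0).
- by rewrite map_inj_uniq // => x y /addIr.
- move=> _ /mapP[y yT0 ->]; apply/negP => H; case/negP: Ht.
  by apply/allpairsP; exists (y + t, y); split; rewrite //= [y + t]addrC addrK.
move=> T' uT' sT' cT'; rewrite size_map in cT'.
have mT' : (m <= size T')%N.
  rewrite leqNgt; apply/negP => H; move: sT0; rewrite ltnNge mulnC => /negP; apply.
  by apply: leq_trans cT' _; rewrite leq_mul2l (ltnW H) orbT.
pose s := (size T' %/ m)%N.
have s0 : (0 < s)%N by rewrite divn_gt0.
have sm : (s * m <= size T')%N by exact: leq_divM.
have sT'2 : (size T' <= 2 * (s * m))%N.
  have := ltn_ceil (size T') I0; rewrite -/s -/m mulSn; nia.
pose pt (i : I) (p : 'I_s) := nth 0 T' (enum_rank i * s + p).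
have pt_lt (i : I) (p : 'I_s) : (enum_rank i * s + p < size T')%N.
  have := ltn_ord (enum_rank i); have := ltn_ord p; rewrite -/m => h1 h2.
  apply: leq_trans sm; nia.
have ptT' i p : pt i p \in T' by exact: mem_nth.
have pt_inj i p j q : pt i p = pt j q -> i = j /\ p = q.
  move/eqP; rewrite nth_uniq // => /eqP H.
  have hi : enum_rank i = enum_rank j :> nat.
    by have := congr1 (divn^~ s) H; rewrite !divnMDl // !divn_small ?addn0.
  split; first by apply: enum_rank_inj; apply: val_inj.
  by apply: val_inj; move: H; rewrite hi => /addnI.
pose U' := [seq x + t | x <- U].
have inU' (j : 'I_M) i p : pt i p + e j * b i \in U'.
  have /sT'/mapP[x xT0 ->] := ptT' i p.
  rewrite addrAC; apply: map_f; rewrite addrC; apply: TU => //.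
  by apply/mapP; exists (j, i) => //; rewrite mem_enum.
pose f (jp : 'I_M * {ffun I -> 'I_s}) : {ffun I -> 'I_(size U')} :=
  [ffun i => Ordinal (eq_ind _ is_true (inU' jp.1 i (jp.2 i)) _ (esym (index_mem _ _)))].
have : ~ injective f.
  move=> /leq_card; rewrite card_prod !card_ffun !card_ord -/m leqNgt => /negP; apply.
  rewrite size_map; apply: (@leq_ltn_trans ((4 * k * m * s) ^ m)%N).
    rewrite leq_exp2r //; have H1 := leq_mul (leqnn k) sT'2.
    have -> : (4 * k * m * s = 2 * (k * (2 * (s * m))))%N by ring.
    rewrite mul1n in cTU; apply: leq_trans cTU _.
    by rewrite leq_mul2l /=; exact: leq_trans cT' H1.
  by rewrite expnMn ltn_mul2r expn_gt0 s0 /M ltnS leqnn.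
move=> /injectiveP/injectivePn[[j p] [[l q] neq Ef]].
have Ei i : pt i (p i) + e j * b i = pt i (q i) + e l * b i.
  have := congr1 (fun g : {ffun I -> 'I_(size U')} => nth 0 U' (g i)) Ef.
  by rewrite !ffunE /= !nth_index.
have jl : j != l.
  apply: contra_neq neq => ejl; rewrite -ejl in Ei *; congr pair.
  by apply/ffunP => i; have /addIr/pt_inj[] := Ei i.
have r0 : e l - e j != 0.
  by rewrite subr_eq0 (inj_eq e_inj) eq_sym.
exists (e l - e j).
  by rewrite mem_filter r0; apply/mapP; exists (l, j) => //; rewrite mem_enum.
exists (fun i => pt i (p i)), (fun i => pt i (q i)); split=> //; split.
- by move=> i i' /pt_inj[].
- by move=> i i' /pt_inj[].
- move=> i i'; apply/eqP => H; have [ii pq] := pt_inj _ _ _ _ H.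
  have := Ei i; rewrite H -ii => /addrI/eqP; rewrite -subr_eq0 -mulrBl mulf_eq0.
  by rewrite (negbTE (b0 i)) orbF -oppr_eq0 opprB (negbTE r0).
- by move=> i; apply/eqP; rewrite mulrBl subr_eq addrAC -subr_eq opprK Ei addrC.
Qed.

(* The members of the configuration are w = r * b0 and the y i and z i. *)
Definition brauer_solution (I : finType) (b0 : R) (b : I -> R) (A : R -> Prop) :=
  exists (r : R) (y z : I -> R),
    [/\ r != 0, A (r * b0), forall i, A (y i) /\ A (z i), spread b r y z &
        forall i, y i != r * b0 /\ z i != r * b0].

Lemma brauer_solution_scale (I : finType) b0 (b : I -> R) A a : a != 0 ->
  brauer_solution b0 b (fun x => A (a * x)) -> brauer_solution b0 b A.
Proof.
move=> a0 [r [y [z [r0 Aw Ayz [yi zi yz yzb] nw]]]].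
have aI := mulfI a0.
exists (a * r), (fun i => a * y i), (fun i => a * z i); split.
- by rewrite mulf_neq0.
- by rewrite -mulrA.
- exact: Ayz.
- split; [by move=> i j /aI/yi | by move=> i j /aI/zi | |].
  + by move=> i j; rewrite (inj_eq aI).
  + by move=> i; rewrite -mulrBr yzb mulrA.
- by move=> i; rewrite -mulrA !(inj_eq aI).
Qed.

Lemma sub_brauer_solution (I : finType) b0 (b : I -> R) (A B : R -> Prop) :
  (forall x, A x -> B x) -> brauer_solution b0 b A -> brauer_solution b0 b B.
Proof.
move=> AB [r [y [z [r0 Aw Ayz H1 H2]]]]; exists r, y, z; split=> //; first exact: AB.
by move=> i; case: (Ayz i) => /AB ? /AB ?.
Qed.

Lemma size_color_classes (T : seq R) (c : R -> nat) Cs : {in T, forall x, c x \in Cs} ->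
  (size T <= \sum_(j <- Cs) count (fun x => c x == j) T)%N.
Proof.
elim: T => [|x T IHT] H; first by [].
rewrite /= big_split /= -add1n leq_add //; last by apply: IHT => y yT; apply: H; rewrite inE yT orbT.
by rewrite (big_rem (c x)) /= ?eqxx //; apply: H; exact: mem_head.
Qed.

Lemma exists_large_color_class (T : seq R) (c : R -> nat) Cs l : (0 < size T)%N ->
  (size Cs <= l)%N -> {in T, forall x, c x \in Cs} ->
  exists2 j, j \in Cs & (size T <= l * count (fun x => c x == j) T)%N.
Proof.
move=> T0 sC H; apply: contrapT => nH.
have {}nH j : j \in Cs -> (l * count (fun x => c x == j) T < size T)%N.
  by move=> jC; rewrite ltnNge; apply/negP => Hj; apply: nH; exists j.
have l0 : (0 < l)%N.
  apply: leq_trans sC; case: T T0 H {nH} => // x T _ /(_ x (mem_head _ _)).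
  by case: Cs.
have H1 := size_color_classes H.
have H2 : (\sum_(j <- Cs) (l * count (fun x => c x == j) T) <= \sum_(j <- Cs) (size T).-1)%N.
  rewrite [leqLHS]big_seq [leqRHS]big_seq; apply: leq_sum => j /nH.
  by case: (size T) T0.
have : (l * size T <= size Cs * (size T).-1)%N.
  apply: leq_trans (leq_mul (leqnn l) H1) _; rewrite big_distrr /=.
  by apply: leq_trans H2 _; rewrite big_const_seq count_predT iter_addn_0 mulnC.
by apply/negP; rewrite -ltnNge; nia.
Qed.

(* Induction on the number of colours: either the differences found inside the
   largest colour class T' come with some w of the same colour, or all the
   candidates w, which form a dilate of the previous T, avoid that colour. *)
Lemma brauer (I : finType) (b0 : R) (b : I -> R) (l : nat) :
  (0 < #|I|)%N -> b0 != 0 -> (forall i, b i != 0) ->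
  exists T : seq R, [/\ (0 < size T)%N, 0 \notin T &
    forall (c : R -> nat) Cs, (size Cs <= l)%N -> {in T, forall x, c x \in Cs} ->
    exists j, brauer_solution b0 b (fun x => x \in T /\ c x = j)].
Proof.
move=> I0 b00 bn0; elim: l => [|l [T [T0 nT HT]]].
  exists [:: 1]; split=> //; first by rewrite inE eq_sym oner_eq0.
  by move=> c [|//] _ /(_ 1 (mem_head _ _)).
(* One application of [dense_differences] serves all candidates w = b0 * r * t at once: the pair (t,
   i) asks for the difference r * t * b i. *)
pose b' (ti : 'I_(size T) * I) := b ti.2 * T`_ti.1.
have Tn0 (i : 'I_(size T)) : T`_i != 0 by apply: contraNneq nT => <-; exact: mem_nth.
have [D D0 HD] := @dense_differences _ b' l.+1 ltac:(by rewrite card_prod card_ord muln_gt0 T0)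
  (fun ti => mulf_neq0 (bn0 _) (Tn0 _)).
pose W := [seq b0 * r * t | r <- D, t <- T].
(* Avoiding W keeps every y and z distinct from the candidates w. *)
have [V [V0 uV VW HV]] := HD (0 :: W).
exists (V ++ W); split.
- by rewrite size_cat addn_gt0 V0.
- rewrite mem_cat negb_or; apply/andP; split; apply/negP.
    by move/VW; rewrite mem_head.
  case/allpairsP => -[r t] /= [rD tT /eqP]; rewrite eq_sym !mulf_eq0 (negbTE b00) /=.
  by case/orP => /eqP E; [move: D0; rewrite -E rD | move: nT; rewrite -E tT].
move=> c Cs sC Hc.
have [|j jC Hj] := @exists_large_color_class V c Cs l.+1 V0 sC.
  by move=> x xV; apply: Hc; rewrite mem_cat xV.
pose V' := [seq x <- V | c x == j].
have [||r rD [y [z [Hyz Hs]]]] := HV V' (filter_uniq _ uV).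
- by move=> x; rewrite mem_filter => /andP[].
- by rewrite size_filter.
have r0 : r != 0 by apply: contraNneq D0 => <-.
have inV' x : x \in V' -> x \in V /\ c x = j by rewrite mem_filter => /andP[/eqP].
have [[t Ht]|nt] := pselect (exists t : 'I_(size T), c (b0 * r * T`_t) = j).
  exists j; case: Hs => yi zi yz yzb.
  have wW : b0 * r * T`_t \in W by apply/allpairsP; exists (r, T`_t); split=> //; exact: mem_nth.
  have nw x : x \in V -> x != r * T`_t * b0.
    move=> /VW; apply: contraNneq => ->.
    by rewrite inE [r * _ * _]mulrC mulrA wW orbT.
  exists (r * T`_t), (fun i => y (t, i)), (fun i => z (t, i)); split.
  - by rewrite mulf_neq0.
  - by rewrite mulrC mulrA; split=> //; rewrite mem_cat wW orbT.
  - move=> i; case: (Hyz (t, i)) => /inV'[yV cy] /inV'[zV cz].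
    by rewrite !mem_cat yV zV.
  - split.
    + by move=> i i' /yi[].
    + by move=> i i' /zi[].
    + by move=> i i'; exact: yz.
    + by move=> i; rewrite yzb /b' /= mulrA mulrAC.
  - by move=> i; case: (Hyz (t, i)) => /inV'[/nw ? _] /inV'[/nw ? _].
have [||j' Hj'] := HT (fun x => c (b0 * r * x)) [seq a <- Cs | a != j].
- rewrite -ltnS size_filter; apply: leq_trans sC.
  by rewrite -(count_predC (pred1 j) Cs) -[ltnLHS]add0n ltn_add2r -has_count has_pred1.
- move=> x xT; rewrite mem_filter; apply/andP; split; last first.
    by apply: Hc; rewrite mem_cat; apply/orP; right; apply/allpairsP; exists (r, x).
  apply/eqP => cx; apply: nt; have ix : (index x T < size T)%N by rewrite index_mem.
  by exists (Ordinal ix); rewrite /= nth_index.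
exists j'; apply: (@brauer_solution_scale _ _ _ _ (b0 * r)); first by rewrite mulf_neq0.
apply: sub_brauer_solution Hj' => x [xT cx]; split=> //.
by rewrite mem_cat; apply/orP; right; apply/allpairsP; exists (r, x).
Qed.

End Differences.

(** * Polynomials as lists of terms *)

Lemma digits_inj n B (f g : nat -> nat) :
  (forall i, (i < n)%N -> (f i < B)%N /\ (g i < B)%N) ->
  (\sum_(i < n) f i * B ^ i = \sum_(i < n) g i * B ^ i)%N ->
  forall i, (i < n)%N -> f i = g i.
Proof.
elim: n f g => // n IHn f g H.
have Hsum (h : nat -> nat) : (\sum_(i < n.+1) h i * B ^ i = (\sum_(i < n) h i.+1 * B ^ i) * B + h 0)%N.
  rewrite big_ord_recl /= muln1 addnC big_distrl /=; congr (_ + _)%N.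
  by apply: eq_bigr => i _; rewrite expnSr mulnA.
rewrite !Hsum; have [f0 g0] := H 0%N isT; have B0 : (0 < B)%N by exact: leq_ltn_trans f0.
move=> E; have E0 : f 0%N = g 0%N by have := congr1 (modn^~ B) E; rewrite /= !modnMDl !modn_small.
have E1 := congr1 (divn^~ B) E; rewrite /= !divnMDl // !divn_small // !addn0 in E1.
case=> // i; rewrite ltnS => i_n.
by apply: (IHn (fun i => f i.+1) (fun i => g i.+1)) => // j jn; exact: H.
Qed.

Section InfiniteDomain.
Variables (R : idomainType) (e : nat -> R).
Hypothesis e_inj : injective e.

Lemma poly_eq0_of_roots (u : {poly R}) : (forall x, u.[x] = 0) -> u = 0.
Proof.
move=> H; apply/eqP; apply: contraT => u0.
suff : (size [seq e i | i <- iota 0 (size u)] < size u)%N by rewrite size_map size_iota ltnn.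
apply: max_poly_roots => //; last by rewrite map_inj_uniq // iota_uniq.
by apply/allP => x _; rewrite /root H.
Qed.

(* Kronecker substitution x_i := x ^ (B ^ i). *)
Lemma mpoly_eq0_of_meval n (p : mpoly n R) : (forall v, meval v p = 0) -> p = 0.
Proof.
move=> H; pose B := msize p.
pose code (m : multinom n) := (\sum_(i < n) m i * B ^ i)%N.
pose u : {poly R} := \sum_(m <- msupp p) mcoeff m p *: 'X^(code m).
have u0 : u = 0.
  apply: poly_eq0_of_roots => x; rewrite -(H (fun i => x ^+ (B ^ i))) mevalE horner_sum.
  apply: eq_bigr => m _; rewrite hornerZ hornerXn /code -prodrXr; congr (_ * _).
  by apply: eq_bigr => i _; rewrite -exprM mulnC.
have code_inj m m' : m \in msupp p -> m' \in msupp p -> code m = code m' -> m = m'.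
  have small (m1 : multinom n) i : m1 \in msupp p -> (m1 i < B)%N.
    by move=> /msize_mdeg_lt; apply: leq_ltn_trans; rewrite mdegE (bigD1 i) //= leq_addr.
  move=> mp mp'; pose f (m1 : multinom n) k := nth 0%N m1 k.
  have codeE m1 : code m1 = (\sum_(i < n) f m1 i * B ^ i)%N.
    by apply: eq_bigr => i _; rewrite (mnm_nth 0%N).
  rewrite !codeE => /digits_inj E; apply/mnmP => i.
  rewrite !(mnm_nth 0%N); apply: E => // k kn.
  by rewrite /f -!(mnm_nth 0%N _ (Ordinal kn)); split; exact: small.
apply: contrapT => /eqP; rewrite -msupp_eq0; case E : (msupp p) => [//|m s] _.
have mp : m \in msupp p by rewrite E mem_head.
have := congr1 (coefp (code m)) u0; rewrite /= coef0 coef_sum.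
rewrite (bigD1_seq m) ?msupp_uniq //= coefZ coefXn eqxx mulr1.
rewrite big_seq_cond big1 ?addr0 => [|m' /andP[mp' nm]].
  by apply/eqP; rewrite -mcoeff_msupp.
rewrite coefZ coefXn; case: eqP => [/(code_inj _ _ mp mp') E'|_]; last by rewrite mulr0.
by rewrite E' eqxx in nm.
Qed.

End InfiniteDomain.

Section TermLists.
Variable F : comNzRingType.

Definition expvec n (l : seq nat) : multinom n := Multinom [tuple nth 0%N l i | i < n].

Definition tpoly n (p : seq (F * seq nat)) : mpoly n F :=
  \sum_(t <- p) t.1 *: mpolyX F (expvec n t.2).

Lemma expvecE n l i : expvec n l i = nth 0%N l i.
Proof. exact: mnmE. Qed.

Lemma meval_tpoly n (x : 'I_n -> F) p :
  meval x (tpoly n p) = \sum_(t <- p) t.1 * \prod_(i < n) x i ^+ nth 0%N t.2 i.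
Proof.
rewrite /tpoly raddf_sum; apply: eq_bigr => t _; rewrite /= mevalZ mevalX.
by congr (_ * _); apply: eq_bigr => i _; rewrite expvecE.
Qed.

Lemma tpoly_cat n p q : tpoly n (p ++ q) = tpoly n p + tpoly n q.
Proof. exact: big_cat. Qed.

Definition addexp (l k : seq nat) :=
  [seq (nth 0 l i + nth 0 k i)%N | i <- iota 0 (size l + size k)].

Lemma nth_addexp l k i : nth 0%N (addexp l k) i = (nth 0 l i + nth 0 k i)%N.
Proof.
rewrite /addexp; have [lt_i|le_i] := ltnP i (size l + size k).
  by rewrite (nth_map 0%N) ?size_iota // nth_iota.
rewrite !nth_default ?size_map ?size_iota //; first exact: leq_trans (leq_addl _ _) le_i.
exact: leq_trans (leq_addr _ _) le_i.
Qed.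

Definition tmul (p q : seq (F * seq nat)) :=
  flatten [seq [seq (t.1 * u.1, addexp t.2 u.2) | u <- q] | t <- p].

Lemma tpoly_tmul n p q : tpoly n (tmul p q) = tpoly n p * tpoly n q.
Proof.
rewrite /tpoly /tmul big_flatten big_map mulr_suml; apply: eq_bigr => t _.
rewrite big_map mulr_sumr; apply: eq_bigr => u _ /=.
rewrite -scalerAl -scalerAr scalerA -mpolyXD; congr (_ *: mpolyX _ _).
by apply/mnmP => i; rewrite mnmDE !expvecE nth_addexp.
Qed.

Definition tone : seq (F * seq nat) := [:: (1, [::])].

Lemma tpoly_tone n : tpoly n tone = 1.
Proof.
rewrite /tpoly big_seq1 scale1r; have -> : expvec n [::] = mnm0; last exact: mpolyX0.
by apply/mnmP => i; rewrite expvecE mnm0E nth_nil.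
Qed.

Definition texp p k := iteri k (fun _ r => tmul p r) tone.

Lemma tpoly_texp n p k : tpoly n (texp p k) = tpoly n p ^+ k.
Proof.
by elim: k => [|k IHk]; [exact: tpoly_tone | rewrite exprS -IHk -tpoly_tmul].
Qed.

Definition tsubst n (L : seq (seq (F * seq nat))) p :=
  flatten [seq tmul [:: (t.1, [::])]
    (foldr (fun i r => tmul (texp (nth [::] L i) (nth 0%N t.2 i)) r) tone (iota 0 n)) | t <- p].

Lemma tpoly_tsubst n N L p : tpoly N (tsubst n L p) =
  comp_mpoly [tuple tpoly N (nth [::] L i) | i < n] (tpoly n p).
Proof.
rewrite {1}/tpoly /tsubst big_flatten big_map {2}/tpoly raddf_sum /=.
apply: eq_bigr => t _; rewrite -/(tpoly N _) tpoly_tmul comp_mpolyZ comp_mpolyX.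
have -> : tpoly N [:: (t.1, [::])] = t.1 *: tpoly N tone by rewrite /tpoly !big_seq1 scale1r.
rewrite tpoly_tone -scalerAl mul1r; congr (_ *: _).
rewrite (eq_bigr (fun i : 'I_n => tpoly N (nth [::] L i) ^+ nth 0%N t.2 i)); last first.
  by move=> i _; rewrite tnth_mktuple expvecE.
rewrite -(big_mkord xpredT (fun i => tpoly N (nth [::] L i) ^+ nth 0%N t.2 i)) /index_iota subn0.
elim: (iota 0 n) => [|i s IHs] /=; first by rewrite big_nil tpoly_tone.
by rewrite big_cons tpoly_tmul tpoly_texp IHs.
Qed.

(** A normal form: exponent lists that differ in trailing zeros or beyond position n denote the same
    monomial. *)
Definition texpvec n (l : seq nat) := [seq nth 0%N l i | i <- iota 0 n].

Lemma eq_texpvec n l k : (texpvec n l == texpvec n k) = (expvec n l == expvec n k).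
Proof.
have E l' : texpvec n l' = expvec n l'.
  by rewrite /texpvec -val_enum_ord -map_comp.
by rewrite !E; apply/eqP/eqP => [H|->//]; do 2 apply: val_inj.
Qed.

Lemma sumn_texpvec n l : sumn (texpvec n l) = mdeg (expvec n l).
Proof.
rewrite mdegE sumnE big_map -[n in iota 0 n]subn0 -/(index_iota 0 n) big_mkord.
by apply: eq_bigr => i _; rewrite expvecE.
Qed.

Definition tcoef n (p : seq (F * seq nat)) l :=
  foldr (fun t r => (if texpvec n t.2 == texpvec n l then t.1 else 0) + r) 0 p.

Lemma mcoeff_tpoly n p l : mcoeff (expvec n l) (tpoly n p) = tcoef n p l.
Proof.
rewrite /tpoly raddf_sum; elim: p => [|t p IHp]; first by rewrite big_nil.
rewrite big_cons [RHS]/= {}IHp; congr (_ + _).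
by rewrite /= mcoeffZ mcoeffX eq_texpvec; case: eqP; rewrite ?mulr1 ?mulr0.
Qed.

Lemma mcoeff_tpoly_notin n p m :
  (forall t, t \in p -> m != expvec n t.2) -> mcoeff m (tpoly n p) = 0.
Proof.
move=> H; rewrite /tpoly raddf_sum big_seq big1 // => t tp.
by rewrite /= mcoeffZ mcoeffX eq_sym (negbTE (H t tp)) mulr0.
Qed.

(** Term lists may repeat monomials, so total coefficients are compared; outside the listed
    monomials both polynomials have coefficient 0. *)
Definition teq n p q := all (fun t => tcoef n p t.2 == tcoef n q t.2) (p ++ q).

Lemma teqP n p q : reflect (tpoly n p = tpoly n q) (teq n p q).
Proof.
apply: (iffP allP) => [H|E t _]; last by rewrite -!mcoeff_tpoly E.
apply/mpolyP => m; have [/hasP[t tpq /eqP ->]|/hasPn H'] := boolP (has (fun t => m == expvec n t.2) (p ++ q)).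
  by rewrite !mcoeff_tpoly; apply/eqP; exact: H.
by rewrite !mcoeff_tpoly_notin // => t tp; apply: H'; rewrite mem_cat tp ?orbT.
Qed.

(** Listed terms may cancel, so a term of the wrong degree is allowed if its total coefficient
    vanishes. *)
Definition thomog n d p :=
  all (fun t => (tcoef n p t.2 == 0) || (sumn (texpvec n t.2) == d)) p.

Lemma thomogP n d p : (tpoly n p \is ishomog1 d (@mdeg n)) = thomog n d p.
Proof.
apply/idP/allP => [/dhomogP H t _|H].
  rewrite -mcoeff_tpoly sumn_texpvec; have [//|/= nz] := eqVneq (mcoeff _ _) 0.
  by apply/eqP/H; rewrite mcoeff_msupp.
apply/dhomogP => m; rewrite mcoeff_msupp => nz.
have [/hasP[t tp /eqP E]|/hasPn H'] := boolP (has (fun t => m == expvec n t.2) p).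
  by have := H t tp; rewrite -mcoeff_tpoly -E (negbTE nz) sumn_texpvec -E => /eqP.
by rewrite mcoeff_tpoly_notin ?eqxx // in nz.
Qed.

End TermLists.

Fixpoint sublists (s : seq nat) : seq (seq nat) :=
  if s is x :: s' then sublists s' ++ [seq x :: l | l <- sublists s'] else [:: [::]].

Lemma mem_sublists l s : (l \in sublists s) = subseq l s.
Proof.
elim: s l => [|x s IHs] l /=; first by rewrite inE; case: l.
rewrite mem_cat IHs; case: l => [|y l] /=; first by rewrite sub0seq.
have -> : (y :: l \in [seq x :: l' | l' <- sublists s]) = (y == x) && subseq l s.
  apply/mapP/andP => [[l' Hl' [-> ->]]|[/eqP -> Hl]]; first by rewrite eqxx -IHs.
  by exists l; rewrite ?IHs.
case: eqP => [->|_]; rewrite ?orbF //=; case H : (subseq l s); first by rewrite orbT.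
rewrite orbF; apply/negbTE/negP => /(subseq_trans (subseq_cons l x)).
by rewrite H.
Qed.

Section MoreLists.
Context {A : Type} {eA : Enc A}.

Lemma cp_nat_of_bool (f : A -> bool) :
  computable f -> computable (fun a => nat_of_bool (f a)).
Proof. by case=> c Hc; exists c. Qed.

Lemma cp_uniq (f : A -> seq nat) : computable f -> computable (fun a => uniq (f a)).
Proof.
move=> Hf; pose g (s : seq nat) := foldr (fun x st => (x :: st.1, ~~ (x \in st.1) && st.2))
  ([::] : seq nat, true) s.
assert (H : computable (fun a => (g (f a)).2)) by (rewrite /g; cp).
refine (cp_ext H _) => a; suff -> : g (f a) = (f a, uniq (f a)) by [].
by elim: (f a) => //= x s ->.
Qed.

Lemma cp_sublists (f : A -> seq nat) : computable f -> computable (fun a => sublists (f a)).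
Proof.
move=> Hf.
assert (H : computable (fun a => foldr (fun x r => r ++ [seq x :: l | l <- r]) [:: [::]] (f a))) by cp.
by refine (cp_ext H _) => a; elim: (f a) => //= x s ->.
Qed.

End MoreLists.

Ltac cp_lists3 := first [ cp_lists2 | lazymatch goal with
  | |- computable (fun a => nat_of_bool _) => apply: cp_nat_of_bool
  | |- computable (fun a => uniq _) => apply: cp_uniq
  | |- computable (fun a => sublists _) => apply: cp_sublists
  end ].
Ltac cp_more ::= cp_lists3.

(* A numbering of R in the context determines the encoding of R. *)
Existing Class computable_domain.
#[export] Instance enc_domain (R : idomainType) (phi : computable_domain R) : Enc R := num phi.

(** * Computability of the operations of R and of term lists *)

Section DomainComputability.
Variables (R : idomainType) (phi : computable_domain R).
Context {A : Type} {eA : Enc A}.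

Lemma cp_num (f : A -> R) : computable f -> computable (fun a => num phi (f a)).
Proof. by case=> c Hc; exists c. Qed.

Lemma cp_of_num (f : A -> R) : computable (fun a => num phi (f a)) -> computable f.
Proof. by case=> c Hc; exists c. Qed.

Lemma cp_elt (f : A -> nat) : computable f -> computable (fun a => elt phi (f a)).
Proof. by case=> c Hc; exists c => a; rewrite /enc /enc_domain eltK; exact: Hc. Qed.

Lemma cp_addR (f g : A -> R) : computable f -> computable g -> computable (fun a => f a + g a).
Proof.
move=> Hf Hg; apply: cp_of_num.
assert (Hs : computable (fun a => [:: num phi (f a); num phi (g a)])).
  by cp; exact: cp_num.
refine (cp_ext (cp_computable_fun (s := fun a => [tuple num phi (f a); num phi (g a)])
  (computable_add phi) Hs) _) => a.
by rewrite !(tnth_nth 0%N) /= !numK.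
Qed.

Lemma cp_mulR (f g : A -> R) : computable f -> computable g -> computable (fun a => f a * g a).
Proof.
move=> Hf Hg; apply: cp_of_num.
assert (Hs : computable (fun a => [:: num phi (f a); num phi (g a)])).
  by cp; exact: cp_num.
refine (cp_ext (cp_computable_fun (s := fun a => [tuple num phi (f a); num phi (g a)])
  (computable_mul phi) Hs) _) => a.
by rewrite !(tnth_nth 0%N) /= !numK.
Qed.

Lemma cp_eqR (f g : A -> R) : computable f -> computable g -> computable (fun a => f a == g a).
Proof. by apply: cp_eq; exact: can_inj (numK phi). Qed.

End DomainComputability.

Ltac cp_domain := first [ cp_lists3 | lazymatch goal with
  | |- computable (fun a => GRing.add _ _) => apply: cp_addR
  | |- computable (fun a => GRing.mul _ _) => apply: cp_mulR
  | |- computable (fun a => eq_op _ _) => apply: cp_eqR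
  | |- computable (fun a => elt _ _) => apply: cp_elt
  | |- computable (fun a => num _ _) => apply: cp_num
  end ].
Ltac cp_more ::= cp_domain.

Section TermComputability.
Variables (R : idomainType) (phi : computable_domain R).
Context {A : Type} {eA : Enc A}.

Lemma cp_tmul (f g : A -> seq (R * seq nat)) :
  computable f -> computable g -> computable (fun a => tmul (f a) (g a)).
Proof.
move=> Hf Hg; rewrite /tmul /addexp; cp.
by apply: (cp_comp Hg); cp.
Qed.
End TermComputability.

Section TermPowers.
Variables (R : idomainType) (phi : computable_domain R).
Context {A : Type} {eA : Enc A}.

Lemma cp_texp (f : A -> seq (R * seq nat)) (k : A -> nat) :
  computable f -> computable k -> computable (fun a => texp (f a) (k a)).
Proof.
move=> Hf Hk; rewrite /texp; cp; apply: cp_tmul; cp.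
by apply: (cp_comp Hf); cp.
Qed.
End TermPowers.

(** Evaluation by list recursion only, in a form that [cp] can prove computable. *)
Definition teval (F : comNzRingType) n (x : seq F) (p : seq (F * seq nat)) : F :=
  foldr (fun t r => t.1 * foldr (fun i s =>
    iteri (nth 0%N t.2 i) (fun _ u => nth 0 x i * u) 1 * s) 1 (iota 0 n) + r) 0 p.

Lemma tevalE (F : comNzRingType) n (x : seq F) p :
  teval n x p = meval (fun i : 'I_n => nth 0 x i) (tpoly n p).
Proof.
rewrite meval_tpoly; elim: p => [|t p IHp]; first by rewrite big_nil.
rewrite big_cons -{}IHp /=; congr (_ * _ + _).
rewrite -(big_mkord xpredT (fun i => nth 0 x i ^+ nth 0%N t.2 i)) /index_iota subn0.
elim: (iota 0 n) => [|i s IHs] /=; first by rewrite big_nil.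
rewrite big_cons IHs; congr (_ * _).
by elim: (nth 0%N t.2 i) => //= k ->; rewrite exprS.
Qed.

Section PolynomialCodes.
Variables (R : idomainType) (phi : computable_domain R).

Section Operations.
Context {A : Type} {eA : Enc A}.

Lemma cp_tsubst (n : A -> nat) (L : A -> seq (seq (R * seq nat))) (p : A -> seq (R * seq nat)) :
  computable n -> computable L -> computable p ->
  computable (fun a => tsubst (n a) (L a) (p a)).
Proof.
move=> Hn HL Hp; rewrite /tsubst; cp; apply: cp_tmul; cp.
- apply: cp_tmul; cp; apply: cp_texp; cp.
  by apply: (cp_comp HL); cp.
- by apply: (cp_comp Hn); cp.
Qed.

Lemma cp_texpvec (n : A -> nat) (l : A -> seq nat) :
  computable n -> computable l -> computable (fun a => texpvec (n a) (l a)).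
Proof. by move=> Hn Hl; rewrite /texpvec; cp; apply: (cp_comp Hl); cp. Qed.

Lemma cp_eq_seq (l k : A -> seq nat) :
  computable l -> computable k -> computable (fun a => l a == k a).
Proof.
apply: cp_eq => x y; rewrite !enc_seq_nat; exact: (can_inj CodeSeq.codeK).
Qed.

End Operations.

Lemma cp_tcoef (A : Type) {eA : Enc A} (n : A -> nat) (p : A -> seq (R * seq nat)) (l : A -> seq nat) :
  computable n -> computable p -> computable l ->
  computable (fun a => tcoef (n a) (p a) (l a)).
Proof.
move=> Hn Hp Hl; rewrite /tcoef; cp; apply: cp_eq_seq; apply: cp_texpvec; cp.
- by apply: (cp_comp Hn); cp.
- by apply: (cp_comp Hn); cp.
- by apply: (cp_comp Hl); cp.
Qed.

Lemma cp_teq (A : Type) {eA : Enc A} (n : A -> nat) (p q : A -> seq (R * seq nat)) :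
  computable n -> computable p -> computable q ->
  computable (fun a => teq (n a) (p a) (q a)).
Proof.
move=> Hn Hp Hq; rewrite /teq; cp; apply: cp_tcoef; cp.
- by apply: (cp_comp Hn); cp.
- by apply: (cp_comp Hp); cp.
- by apply: (cp_comp Hn); cp.
- by apply: (cp_comp Hq); cp.
Qed.

Lemma cp_thomog (A : Type) {eA : Enc A} (n d : A -> nat) (p : A -> seq (R * seq nat)) :
  computable n -> computable d -> computable p ->
  computable (fun a => thomog (n a) (d a) (p a)).
Proof.
move=> Hn Hd Hp; rewrite /thomog; cp; [apply: cp_tcoef; cp | apply: cp_texpvec; cp |].
- by apply: (cp_comp Hn); cp.
- by apply: (cp_comp Hp); cp.
- by apply: (cp_comp Hn); cp.
- by apply: (cp_comp Hd); cp.
Qed.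

Lemma cp_teval (A : Type) {eA : Enc A} (n : A -> nat) (x : A -> seq R) (p : A -> seq (R * seq nat)) :
  computable n -> computable x -> computable p ->
  computable (fun a => teval (n a) (x a) (p a)).
Proof.
move=> Hn Hx Hp; rewrite /teval; cp.
- by apply: (cp_comp Hx); cp.
- by apply: (cp_comp Hn); cp.
Qed.

Definition code_vars (k : nat) : nat := (nth 0%N (CodeSeq.decode k) 0).+1.
Definition code_terms (k : nat) : seq (R * seq nat) :=
  [seq (elt phi (nth 0%N (CodeSeq.decode t) 0), behead (CodeSeq.decode t))
    | t <- behead (CodeSeq.decode k)].

Lemma codesE (P : poly_set R) k :
  codes (elt phi) P k <-> P (code_vars k) (tpoly (code_vars k) (code_terms k)).
Proof.
rewrite /codes /= /code_vars nth0; set s := CodeSeq.decode k.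
suff -> : poly_of_seq (elt phi) s = tpoly (head 0%N s).+1 (code_terms k) by [].
rewrite /poly_of_seq /tpoly big_map; apply: eq_bigr => t _; rewrite /term_of /=.
congr (_ *: mpolyX _ _); apply/mnmP => i; rewrite !mnmE -nth_behead //.
Qed.

Lemma cp_code_vars (A : Type) {eA : Enc A} (f : A -> nat) :
  computable f -> computable (fun a => code_vars (f a)).
Proof. by move=> Hf; rewrite /code_vars; cp. Qed.

Lemma cp_code_terms (A : Type) {eA : Enc A} (f : A -> nat) :
  computable f -> computable (fun a => code_terms (f a)).
Proof. by move=> Hf; rewrite /code_terms; cp. Qed.

Definition terms_code (n : nat) (p : seq (R * seq nat)) : nat :=
  CodeSeq.code (n :: [seq CodeSeq.code (num phi t.1 :: t.2) | t <- p]).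

Lemma cp_terms_code (A : Type) {eA : Enc A} (n : A -> nat) (p : A -> seq (R * seq nat)) :
  computable n -> computable p -> computable (fun a => terms_code (n a) (p a)).
Proof. by move=> Hn Hp; rewrite /terms_code; cp. Qed.

Lemma code_varsK n p : code_vars (terms_code n p) = n.+1.
Proof. by rewrite /code_vars /terms_code CodeSeq.codeK. Qed.

Lemma code_termsK n p : code_terms (terms_code n p) = p.
Proof.
rewrite /code_terms /terms_code CodeSeq.codeK /behead -map_comp -[RHS]map_id.
by apply: eq_map => -[c l]; rewrite /comp CodeSeq.codeK /= numK.
Qed.

Lemma codes_terms_code (P : poly_set R) n p :
  codes (elt phi) P (terms_code n p) <-> P n.+1 (tpoly n.+1 p).
Proof. by rewrite codesE code_varsK code_termsK. Qed.

End PolynomialCodes.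

Ltac cp_term_ops := first [ cp_domain | lazymatch goal with
  | |- computable (fun a => tmul _ _) => apply: cp_tmul
  | |- computable (fun a => tsubst _ _ _) => apply: cp_tsubst
  | |- computable (fun a => teq _ _ _) => apply: cp_teq
  | |- computable (fun a => thomog _ _ _) => apply: cp_thomog
  | |- computable (fun a => teval _ _ _) => apply: cp_teval
  | |- computable (fun a => code_vars _) => apply: cp_code_vars
  | |- computable (fun a => code_terms _ _) => apply: cp_code_terms
  | |- computable (fun a => terms_code _ _ _) => apply: cp_terms_code
  end ].
Ltac cp_more ::= cp_term_ops.

(** * Semidecidability *)

Definition semidecidable (A : set nat) := exists2 chk : nat -> nat -> bool,
  computable (fun p : nat * nat => chk p.1 p.2) & forall x, A x <-> exists m, chk x m.

Lemma semidecidable_Sigma01 A : semidecidable A -> Sigma01 (unary A).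
Proof. by case=> chk; exact: Sigma01_of_check. Qed.

Lemma semidecidable_setI A B : semidecidable A -> semidecidable B -> semidecidable (A `&` B).
Proof.
move=> [f cf fP] [g cg gP].
exists (fun x m => f x (nth 0%N (CodeSeq.decode m) 0) && g x (nth 0%N (CodeSeq.decode m) 1)).
  cp.
  - by apply: (cp_comp (f := fun p : nat * nat => (p.1, nth 0%N (CodeSeq.decode p.2) 0)) cf); cp.
  - by apply: (cp_comp (f := fun p : nat * nat => (p.1, nth 0%N (CodeSeq.decode p.2) 1)) cg); cp.
move=> x; split=> [[/fP[m Hm] /gP[m' Hm']]|[m /andP[fm gm]]].
  by exists (CodeSeq.code [:: m; m']); rewrite CodeSeq.codeK Hm.
by split; [apply/fP; exists (nth 0%N (CodeSeq.decode m) 0) |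
  apply/gP; exists (nth 0%N (CodeSeq.decode m) 1)].
Qed.

Section Membership.
Variables (R : idomainType) (phi : computable_domain R).

Lemma elt_inj : injective (elt phi). Proof. exact: can_inj (eltK phi). Qed.

Definition flag_root (inj : bool) n (p : mpoly n R) (B : set R) :=
  exists a : 'I_n -> R, [/\ inj -> injective a, forall i, B (a i) & meval a p = 0].

Definition list_root (inj : bool) n (q : seq (R * seq nat)) (B : seq nat) :=
  has (fun a => (inj ==> uniq a) && (teval n [seq elt phi i | i <- a] q == 0)) (words n B).

Lemma list_rootP inj n q B :
  list_root inj n q B <-> flag_root inj (tpoly n q) [set x | num phi x \in B].
Proof.
split.
  case/hasP => s; rewrite mem_words => /andP[/eqP ss /allP sB] /andP[us /eqP s0].
  exists (fun i => elt phi (nth 0%N s i)); split.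
  - move=> injT i j /elt_inj/eqP; move: us; rewrite injT /= => us.
    by rewrite nth_uniq ?ss // => /eqP/val_inj.
  - by move=> i; rewrite /= eltK; apply/sB/mem_nth; rewrite ss.
  - rewrite -s0 tevalE; apply: meval_eq => i.
    by rewrite (nth_map 0%N) // ss.
case=> a [inja aB a0]; apply/hasP; exists [seq num phi (a i) | i <- enum 'I_n].
  rewrite mem_words size_map size_enum_ord eqxx; apply/allP => _ /mapP[i _ ->].
  exact: aB.
apply/andP; split.
  apply/implyP => /inja ia; rewrite map_inj_uniq ?enum_uniq // => i j /(can_inj (numK phi)).
  exact: ia.
rewrite -a0 tevalE; apply/eqP/meval_eq => i; rewrite -map_comp.
by rewrite (nth_map i) ?size_enum_ord //= numK nth_ord_enum.
Qed.

Lemma cp_list_root (A : Type) {eA : Enc A} inj (n : A -> nat) (q : A -> seq (R * seq nat)) B :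
  computable n -> computable q -> computable B ->
  computable (fun a => list_root inj (n a) (q a) (B a)).
Proof.
move=> Hn Hq HB; rewrite /list_root; cp.
- by apply: (cp_comp Hn); cp.
- by apply: (cp_comp Hq); cp.
Qed.

Lemma flag_root_sub inj n (p : mpoly n R) (A B : set R) :
  A `<=` B -> flag_root inj p A -> flag_root inj p B.
Proof. by move=> AB [a [ia aA a0]]; exists a; split=> // i; exact: AB. Qed.

Definition coloring_check inj l n q N :=
  all (fun w => has (fun j => list_root inj n q
      [seq i <- iota 0 N | (elt phi i != 0) && (nth 0%N w i == j)]) (iota 0 l))
    (words N (iota 0 l)).

(** If every initial segment had a bad colouring, a limit of these would colour R; a monochromatic
    root of the limit involves finitely many elements, so it would also occur in a bad colouring of
    a long segment. *)
Lemma coloring_checkP inj l n q : (0 < l)%N ->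
  (forall C : 'I_l -> set R, nonzero_partition C -> exists i0, flag_root inj (tpoly n q) (C i0))
  <-> exists N, coloring_check inj l n q N.
Proof.
move=> l0; split=> [H|[N /allP HN] C [_ CT]]; last first.
  have HC x : exists i : 'I_l, x != 0 -> C i x.
    (* The element 0 lies in no class; its arbitrary colour is ignored by the check. *)
    have [->|x0] := eqVneq x 0; first by exists (Ordinal l0).
    have : (\bigcup_i C i) x by rewrite CT.
    by case=> i _ Cx; exists i.
  have [c Hc] := choice HC.
  pose w := [seq val (c (elt phi i)) | i <- iota 0 N].
  have Hw : w \in words N (iota 0 l).
    rewrite mem_words size_map size_iota eqxx; apply/allP => _ /mapP[i _ ->].
    by rewrite mem_iota ltn_ord.
  have /hasP[j] := HN w Hw; rewrite mem_iota => /= jl /list_rootP Hj.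
  exists (Ordinal jl); apply: flag_root_sub Hj => x /=.
  rewrite mem_filter mem_iota numK => /andP[/andP[x0 /eqP E] xN].
  rewrite (nth_map 0%N) ?size_iota // nth_iota // add0n numK in E.
  have -> : Ordinal jl = c x by apply: val_inj.
  exact: Hc.
apply: contrapT => nH.
have Hw N : exists w : seq nat, w \in words N (iota 0 l) /\ forall j, (j < l)%N ->
    ~ flag_root inj (tpoly n q) [set x | [&& (num phi x < N)%N, x != 0 & nth 0%N w (num phi x) == j]].
  have /negP/allPn[w Hw /hasPn Hj] : ~ coloring_check inj l n q N by move=> ?; apply: nH; exists N.
  exists w; split=> // j jl Hr; have := Hj j; rewrite mem_iota jl => /(_ isT)/negP; apply.
  apply/list_rootP; apply: flag_root_sub Hr => x /= /and3P[xN x0 wx].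
  by rewrite mem_filter mem_iota numK x0 wx.
have [w HW] := choice Hw.
have wl N x : (nth 0%N (w N) x < l)%N.
  have := proj1 (HW N); rewrite mem_words => /andP[_ /allP Ha].
  have [xs|xs] := ltnP x (size (w N)); last by rewrite nth_default.
  by have := Ha _ (mem_nth 0%N xs); rewrite mem_iota.
have [d dl Hd] := limit_coloring wl.
pose C (i : 'I_l) : set R := [set x | x != 0 /\ d (num phi x) = i].
have [|i0 [a [ia aC a0]]] := H C.
  split.
    by move=> i j _ _ [x [[_ xi] [_ xj]]]; apply: val_inj; rewrite /= -xi -xj.
  apply/seteqP; split=> x /=; first by case=> i _ [].
  by move=> x0; exists (Ordinal (dl (num phi x))).
(* The bound serves twice: the numbers of all a i must lie below N, and the colours must agree
   there. *)
have [N NM HN] := Hd (\max_i (num phi (a i)).+1)%N (\max_i (num phi (a i)).+1)%N.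
apply: (proj2 (HW N) i0 (ltn_ord i0)); exists a; split=> // i /=.
have aM : (num phi (a i) < \max_i (num phi (a i)).+1)%N by exact: (@leq_bigmax _ (fun i => (num phi (a i)).+1)).
by have [-> di] := aC i; rewrite (leq_trans aM NM) HN // di eqxx.
Qed.

Lemma semidecidable_coloring inj l (P : poly_set R) : (0 < l)%N ->
  (forall n p, P n p <-> forall C : 'I_l -> set R, nonzero_partition C ->
     exists i0, flag_root inj p (C i0)) ->
  semidecidable (codes (elt phi) P).
Proof.
move=> l0 HP; exists (fun k N => coloring_check inj l (code_vars k) (code_terms phi k) N).
  by rewrite /coloring_check; cp; apply: cp_list_root; cp.
by move=> k; rewrite codesE HP coloring_checkP.
Qed.

Lemma semidecidable_PRl l : (0 < l)%N -> semidecidable (codes (elt phi) (@PRl R l)).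
Proof.
move=> l0; apply: (semidecidable_coloring (inj := false) l0) => n p.
split=> H C /H[i0 [a]]; first by case=> Ha a0; exists i0, a; split.
by case=> _ Ha a0; exists i0, a.
Qed.

Lemma semidecidable_IPRl l : (0 < l)%N -> semidecidable (codes (elt phi) (@IPRl R l)).
Proof.
move=> l0; apply: (semidecidable_coloring (inj := true) l0) => n p.
split=> H C /H[i0 [a]]; first by case=> ia Ha a0; exists i0, a; split.
by case=> ia Ha a0; exists i0, a; split=> //; exact: ia.
Qed.

Lemma semidecidable_homogeneous : semidecidable (codes (elt phi) (@homogeneous R)).
Proof.
exists (fun k d => thomog (code_vars k) d (code_terms phi k)).
  by cp.
by move=> k; rewrite codesE; split=> -[d Hd]; exists d; rewrite ?thomogP // -thomogP.
Qed.

(** Over an infinite domain a polynomial is determined by its values. *)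
Lemma translation_invariantP n (p : mpoly n R) : translation_invariant p <->
  forall (v : 'I_n -> R) r, meval (fun i => v i + r) p = meval v p.
Proof.
split=> [H v r|H r].
  rewrite -{2}(H r) comp_mpoly_meval; apply: meval_eq => i.
  by rewrite tnth_mktuple mevalD mevalXU mevalC.
apply/eqP; rewrite -subr_eq0; apply/eqP; apply: (mpoly_eq0_of_meval elt_inj) => v.
rewrite mevalB comp_mpoly_meval -(H v r); apply/eqP; rewrite subr_eq0; apply/eqP.
by apply: meval_eq => i; rewrite tnth_mktuple mevalD mevalXU mevalC.
Qed.

Definition unitvec n i : seq nat := [seq nat_of_bool (j == i) | j <- iota 0 n].

Definition tvar n i : seq (R * seq nat) := [:: (1, unitvec n i)].

Lemma meval_tvar n (v : 'I_n -> R) (i : 'I_n) : meval v (tpoly n (tvar n i)) = v i.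
Proof.
rewrite meval_tpoly big_seq1 mul1r (bigD1 i) //= big1 ?mulr1 => [|j ji].
  by rewrite (nth_map 0%N) ?size_iota // nth_iota // eqxx.
by rewrite (nth_map 0%N) ?size_iota // nth_iota // add0n (inj_eq val_inj) (negbTE ji).
Qed.

(* Compares p(x_0 + x_n, ..., x_(n-1) + x_n) with p(x_0, ..., x_(n-1)). *)
Definition shift_check n q :=
  teq n.+1 (tsubst n [seq tvar n.+1 i ++ tvar n.+1 n | i <- iota 0 n] q)
           (tsubst n [seq tvar n.+1 i | i <- iota 0 n] q).

(** With r as an additional variable, infinitely many conditions become one identity of polynomials,
    which is decidable. *)
Lemma shift_checkP n q : shift_check n q <-> translation_invariant (tpoly n q).
Proof.
rewrite translation_invariantP.
pose g1 := tpoly n.+1 (tsubst n [seq tvar n.+1 i ++ tvar n.+1 n | i <- iota 0 n] q).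
pose g2 := tpoly n.+1 (tsubst n [seq tvar n.+1 i | i <- iota 0 n] q).
have E1 v : meval v g1 = meval (fun i => v (widen_ord (leqnSn n) i) + v ord_max) (tpoly n q).
  rewrite /g1 tpoly_tsubst comp_mpoly_meval; apply: meval_eq => i; rewrite tnth_mktuple.
  rewrite (nth_map 0%N) ?size_iota // nth_iota // add0n tpoly_cat mevalD.
  by rewrite (meval_tvar v (widen_ord (leqnSn n) i)) (meval_tvar v ord_max).
have E2 v : meval v g2 = meval (fun i => v (widen_ord (leqnSn n) i)) (tpoly n q).
  rewrite /g2 tpoly_tsubst comp_mpoly_meval; apply: meval_eq => i; rewrite tnth_mktuple.
  rewrite (nth_map 0%N) ?size_iota // nth_iota // add0n.
  by rewrite (meval_tvar v (widen_ord (leqnSn n) i)).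
split=> [/teqP H v r|H].
  pose v' (j : 'I_n.+1) := if unlift ord_max j is Some i then v i else r.
  have v'w i : v' (widen_ord (leqnSn n) i) = v i.
    rewrite /v'; have -> : widen_ord (leqnSn n) i = lift ord_max i.
      by apply: val_inj; rewrite /= /bump leqNgt ltn_ord.
    by rewrite liftK.
  have v'm : v' ord_max = r by rewrite /v' unlift_none.
  have := congr1 (meval v') H; rewrite -/g1 -/g2 E1 E2 v'm => E.
  transitivity (meval (fun i => v' (widen_ord (leqnSn n) i) + r) (tpoly n q)).
    by apply: meval_eq => i; rewrite v'w.
  by rewrite E; apply: meval_eq => i; rewrite v'w.
apply/teqP/eqP; rewrite -/g1 -/g2 -subr_eq0; apply/eqP.
apply: (mpoly_eq0_of_meval elt_inj) => v.
by rewrite mevalB E1 E2 H subrr.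
Qed.

Lemma semidecidable_translation_invariant :
  semidecidable (codes (elt phi) (@translation_invariant R)).
Proof.
exists (fun k _ => shift_check (code_vars k) (code_terms phi k)); last first.
  move=> k; rewrite codesE -shift_checkP.
  by split=> [H|[_ H]] //; exists 0%N.
rewrite /shift_check /tvar /unitvec.
cp.
Qed.

End Membership.

(** * Semidecidability of density regularity *)

Section DensityMembership.
Variables (R : idomainType) (phi : computable_domain R) (rT : realType).
(** Two instances are intended: R under addition and the nonzero elements under multiplication. The
    map v embeds S in R, and P recognizes the numbers of its elements. *)
Variables (S : choiceType) (op : S -> S -> S) (v : S -> R) (e : nat -> S) (P : pred nat).
Hypotheses (opA : associative op) (opC : commutative op).
Hypothesis opI : forall s, injective (op s).
Hypothesis eK : forall s, e (num phi (v s)) = s.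
Hypothesis numP : forall s, P (num phi (v s)).
Hypothesis eP : forall i, P i -> num phi (v (e i)) = i.

Section Polynomial.
Variables (n : nat) (p : mpoly n R).
Hypothesis root_dilate : forall s (A : set S),
  flag_root true p (v @` dilate op s A) -> flag_root true p (v @` A).

Lemma flag_root_finite (A : set S) : flag_root true p (v @` A) ->
  exists2 F : {fset S}, [set` F] `<=` A & flag_root true p (v @` [set` F]).
Proof.
move=> [a [ia aA a0]].
have [s Hs] := choice (P := fun i s => A s /\ v s = a i)
  (fun i => let: ex_intro2 s h1 h2 := aA i in ex_intro _ s (conj h1 h2)).
exists [fset s i | i in 'I_n]%fset.
  by move=> _ /imfsetP[i _ ->]; case: (Hs i).
exists a; split=> // i; exists (s i); last by case: (Hs i).
by apply/imfsetP; exists i.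
Qed.

(** Root-free sets fit the assumptions on [Free]: they are hereditary, dilates inherit root-freeness
    by the invariance of p, and a root has finitely many coordinates. *)
Lemma density_regularP (delta : rT) :
  (forall A : set S, (delta%:E <= upper_Banach_density op rT A)%E ->
     flag_root true p (v @` A)) <->
  exists2 T : {fset S}, T != fset0 &
    forall A : set S, delta * #|` T|%:R <= (hits T A)%:R -> flag_root true p (v @` A).
Proof.
split=> [H|[T T0 HT] A HA]; last first.
  have [s Hs] := exists_dense_dilate opC opI e HA T0.
  exact/root_dilate/HT/Hs.
apply: contrapT => nH.
suff [A nA /H //] : exists2 A : set S, ~ flag_root true p (v @` A) &
    (delta%:E <= upper_Banach_density op rT A)%E.
apply: (@exists_free_of_density S op rT opA opC opI e (fun s => num phi (v s)) eK
  (fun A => ~ flag_root true p (v @` A))).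
- move=> A B AB nB rA; apply: nB; apply: flag_root_sub rA => _ [s As <-].
  by exists s => //; exact: AB.
- by move=> s A nA /root_dilate.
- by move=> A HA /flag_root_finite[F FA]; exact: HA.
- move=> T T0; apply: contrapT => nT; apply: nH; exists T => // A HA.
  by apply: contrapT => nA; apply: nT; exists A.
Qed.

End Polynomial.

(* All root-free subsets of T have at most m elements. *)
Definition density_check n q (T : seq nat) m :=
  [&& uniq T, 0 < size T, all P T &
      all (fun T' => (size T' <= m) || list_root phi true n q T') (sublists T)]%N.

(** The maximal size m of a root-free subset of T turns the real bound into one strict inequality.
    The denominator is written as a successor to match [left_ce]. *)
Lemma density_checkP (delta : rT) n q : 0 < delta -> (0 < n)%N ->
  (exists2 T : {fset S}, T != fset0 &
    forall A : set S, delta * #|` T|%:R <= (hits T A)%:R -> flag_root true (tpoly n q) (v @` A)) <->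
  exists T m, density_check n q T m /\ m%:R / (size T).-1.+1%:R < delta.
Proof.
move=> delta0 n0; split.
  move=> [T T0 HT]; have cT : 0 < #|` T|%:R :> rT by rewrite ltr0n cardfs_gt0.
  (* The empty set is root-free because there is at least one variable. *)
  have [|m Hm] := @exists_max_free S (fun A => ~ flag_root true (tpoly n q) (v @` A)).
    by exists set0 => -[a [_ /(_ (Ordinal n0)) [s []]]].
  have [[A nA HA] max_m] := Hm T.
  pose Tn := [seq num phi (v s) | s <- T].
  have sTn : size Tn = #|` T| by rewrite size_map.
  have numI : injective (fun s => num phi (v s)) := can_inj eK.
  exists Tn, (m T); split.
    apply/and4P; split.
    - by rewrite map_inj_uniq // fset_uniq.
    - by rewrite sTn cardfs_gt0.
    - by apply/allP => _ /mapP[s _ ->].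
    apply/allP => T'; rewrite mem_sublists => sT'; case: leqP => //= mT'.
    have uT' : uniq T' by apply: subseq_uniq sT' _; rewrite map_inj_uniq // fset_uniq.
    apply/list_rootP.
    pose A' : set S := [set s | num phi (v s) \in T'].
    have HA' : hits T A' = size T'.
      rewrite count_hits -size_filter -(size_map (fun s => num phi (v s))).
      apply: perm_size; apply: uniq_perm => // [|i].
        by rewrite map_inj_uniq // filter_uniq // fset_uniq.
      apply/mapP/idP => [[s]|iT'].
        by rewrite mem_filter => /andP[+ _] ->; rewrite inE.
      have /mapP[s sT Es] := mem_subseq sT' iT'.
      by exists s => //; rewrite mem_filter sT andbT inE /A' /= -Es.
    have : flag_root true (tpoly n q) (v @` A').
      by apply: contrapT => /max_m; rewrite HA' leqNgt mT'.
    by apply: flag_root_sub => _ [s As <-].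
  rewrite sTn prednK ?cardfs_gt0 // ltr_pdivrMr // -HA ltNge; apply/negP => /HT.
  exact: nA.
move=> [Tn [m [/and4P[uT T0 /allP PT /allP HT] mT]]].
rewrite prednK // in mT.
pose T := [fset e i | i in Tn]%fset.
have inT s : (s \in T) = (num phi (v s) \in Tn).
  apply/imfsetP/idP => [[i /= iT ->]|sT]; first by rewrite eP // PT.
  by exists (num phi (v s)); rewrite ?eK.
have numI : injective (fun s => num phi (v s)) := can_inj eK.
have pT : perm_eq [seq num phi (v s) | s <- T] Tn.
  apply: uniq_perm => // [|i]; first by rewrite map_inj_uniq // fset_uniq.
  apply/mapP/idP => [[s sT ->]|iT]; first by rewrite -inT.
  by exists (e i); rewrite ?inT eP // PT.
have cT : #|` T| = size Tn by rewrite -(perm_size pT) size_map.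
exists T; first by rewrite -cardfs_gt0 cT.
move=> A HA; pose T' := [seq i <- Tn | e i \in A].
have sT' : size T' = hits T A.
  rewrite count_hits size_filter -(seq.permP pT) count_map; apply: eq_count => s /=.
  by rewrite eK.
have := HT T'; rewrite mem_sublists filter_subseq => /(_ isT)/orP[|/list_rootP].
  rewrite leqNgt => /negP[]; rewrite sT' -(ltr_nat rT); apply: lt_le_trans HA.
  by rewrite cT -ltr_pdivrMr // ltr0n.
apply: flag_root_sub => x; rewrite /= mem_filter => /andP[xA xT].
exists (e (num phi x)); first exact: set_mem.
by apply: (can_inj (numK phi)); rewrite eP // PT.
Qed.

Lemma semidecidable_density (delta : rT) (Q Inv : poly_set R) : computable P ->
  0 < delta -> left_ce delta -> semidecidable (codes (elt phi) Inv) ->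
  (forall n p, Inv n p -> forall s (A : set S),
     flag_root true p (v @` dilate op s A) -> flag_root true p (v @` A)) ->
  (forall n p, Q n p <-> forall A : set S, (delta%:E <= upper_Banach_density op rT A)%E ->
     flag_root true p (v @` A)) ->
  semidecidable (codes (elt phi) (poly_setI Q Inv)).
Proof.
move=> cP delta0 /Sigma01_check[lt clt ltP] sInv HInv HQ.
(* A certificate codes the finite set, the bound on its root-free subsets, and a stage at which the
   inequality with delta is confirmed. *)
pose W k m := let T := CodeSeq.decode (nth 0%N (CodeSeq.decode m) 0) in
  density_check (code_vars k) (code_terms phi k) T (nth 0%N (CodeSeq.decode m) 1) &&
  lt [:: nth 0%N (CodeSeq.decode m) 1; (size T).-1] (nth 0%N (CodeSeq.decode m) 2).
have sW : semidecidable [set k | exists m, W k m].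
  exists W => //; rewrite /W /density_check; cp.
  - by apply: (cp_comp cP); cp.
  - by apply: cp_list_root; cp.
  - apply: (cp_comp (f := fun p : nat * nat => ([:: nth 0%N (CodeSeq.decode p.2) 1;
       (size (CodeSeq.decode (nth 0%N (CodeSeq.decode p.2) 0))).-1], nth 0%N (CodeSeq.decode p.2) 2)) clt).
    cp; assert (H : computable (fun a : nat * nat =>
      size (CodeSeq.decode (nth 0%N (CodeSeq.decode a.2) 0)) - 1)%N) by cp.
    by refine (cp_ext H _) => a; rewrite subn1.
(* The finite criterion is equivalent to Q only in the presence of the invariance property, so the
   intersection is treated as a whole. *)
suff -> : codes (elt phi) (poly_setI Q Inv) = [set k | exists m, W k m] `&` codes (elt phi) Inv.
  exact: semidecidable_setI.
apply/seteqP; split=> k.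
  move=> [Qk Ik]; split=> //; have Ik' := (codesE phi Inv k).1 Ik.
  move/(codesE phi Q k): Qk.
  move/HQ/(density_regularP (HInv _ _ Ik') delta)/(@density_checkP delta (code_vars k) (code_terms phi k) delta0 isT) => [T [m [HT Hm]]].
  have /ltP[j Hj] : [set u : 2.-tuple nat | (tnth u ord0)%:R / (tnth u ord_max).+1%:R < delta]
      [tuple m; (size T).-1] by [].
  by exists (CodeSeq.code [:: CodeSeq.code T; m; j]); rewrite /W CodeSeq.codeK [nth _ _ 0]/= [nth _ _ 1]/= [nth _ _ 2]/= CodeSeq.codeK HT.
move=> [[m /andP[HT Hm]] Ik]; split=> //.
have Ik' := (codesE phi Inv k).1 Ik; apply/codesE/HQ.
apply/(density_regularP (HInv _ _ Ik') delta)/(@density_checkP delta (code_vars k) (code_terms phi k) delta0 isT).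
set T := CodeSeq.decode _ in HT Hm; exists T, (nth 0%N (CodeSeq.decode m) 1); split=> //.
have := (ltP [tuple nth 0%N (CodeSeq.decode m) 1; (size T).-1]).2; apply.
by exists (nth 0%N (CodeSeq.decode m) 2).
Qed.

End DensityMembership.

Local Open Scope quotient_scope.

Lemma fraction_quot (R : idomainType) (x : {fraction R}) :
  exists a b : R, b != 0 /\ x = tofrac a / tofrac b.
Proof.
exists (frac (repr x)).1, (frac (repr x)).2; have d0 := denom_ratioP (repr x).
split=> //; have F0 : tofrac (frac (repr x)).2 != 0 by rewrite tofrac_eq0.
apply: (mulIf F0); rewrite divfK // -{1}[x]reprK.
unlock FracField.tofrac; rewrite -[LHS]FracField.pi_mul; apply/eqmodP.
rewrite /= FracField.equivfE /FracField.mulf /=.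
by rewrite !numden_Ratio ?mulf_neq0 ?oner_neq0 // !mulr1 mulrC.
Qed.

Lemma dhomog_prod_ord (R : comNzRingType) n k (f : 'I_k -> mpoly n R) (d : 'I_k -> nat) :
  (forall i, f i \is ishomog1 (d i) (@mdeg n)) ->
  \prod_i f i \is ishomog1 (\sum_i d i)%N (@mdeg n).
Proof.
move=> H; elim/big_ind2: _ => //; first exact: dhomog1.
by move=> p1 d1 p2 d2 H1 H2; exact: dhomogM.
Qed.

Lemma dhomog_comp (R : comNzRingType) n k (L : n.-tuple (mpoly k R)) (p : mpoly n R) d :
  (forall i, tnth L i \is ishomog1 1 (@mdeg k)) -> p \is ishomog1 d (@mdeg n) ->
  comp_mpoly L p \is ishomog1 d (@mdeg k).
Proof.
move=> HL /dhomogP Hp; rewrite comp_mpolyE big_seq; apply: rpred_sum => m mp.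
apply: rpredZ; have <- : (\sum_(i < n) m i = d)%N by rewrite -mdegE; exact: Hp.
apply: dhomog_prod_ord => i; rewrite -{2}[m i]mul1n; exact: dhomogMn.
Qed.

Lemma meval_homog (R : comNzRingType) n (p : mpoly n R) d (s : R) (a : 'I_n -> R) :
  p \is ishomog1 d (@mdeg n) -> meval (fun i => s * a i) p = s ^+ d * meval a p.
Proof.
move=> /dhomogP Hp; rewrite !mevalE mulr_sumr big_seq [RHS]big_seq.
apply: eq_bigr => m mp; rewrite mulrCA; congr (_ * _).
have <- : mdeg m = d := Hp m mp.
rewrite mdegE -prodrXr -big_split /=.
by apply: eq_bigr => i _; rewrite exprMn.
Qed.

(** * The reduction from roots in the field of fractions *)

Lemma mulf_div_cancel (L : fieldType) (a b d m : L) : b != 0 ->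
  a * d * m = b * d * (a / b * m).
Proof. by move=> b0; field. Qed.

Lemma divf_mulr (L : fieldType) (a b c : L) : c != 0 -> a / b = a * c / (b * c).
Proof. by move=> c0; rewrite -mulf_div divff ?mulr1. Qed.

Section Reduction.
Variables (R : idomainType) (phi : computable_domain R).
Local Notation K := {fraction R}.
Local Notation F := (@tofrac R).

(* The terms of a polynomial over K, as triples (numerator, denominator, exponents). *)
Definition frac_terms (k : nat) : seq (R * R * seq nat) :=
  [seq (elt phi (nth 0%N (CodeSeq.decode (nth 0%N (CodeSeq.decode t) 0)) 0),
        elt phi (nth 0%N (CodeSeq.decode (nth 0%N (CodeSeq.decode t) 0)) 1),
        behead (CodeSeq.decode t)) | t <- behead (CodeSeq.decode k)].

Lemma codes_fracE (P : poly_set K) k : codes (frac_elt phi) P k <->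
  P (code_vars k) (tpoly (code_vars k) [seq (F t.1.1 / F t.1.2, t.2) | t <- frac_terms k]).
Proof.
rewrite /codes /= /code_vars nth0; set s := CodeSeq.decode k.
suff -> : poly_of_seq (frac_elt phi) s =
  tpoly (head 0%N s).+1 [seq (F t.1.1 / F t.1.2, t.2) | t <- frac_terms k] by [].
rewrite /poly_of_seq /tpoly !big_map; apply: eq_bigr => t _; rewrite /term_of /=.
by congr (_ *: mpolyX _ _); apply/mnmP => i; rewrite !mnmE -nth_behead.
Qed.

(* Pairs (P, d) with P = d p; the denominator 0 stands for the fraction 0. *)
Definition clear_denominators (p : seq (R * R * seq nat)) : seq (R * seq nat) * R :=
  foldr (fun t st => if t.1.2 == 0 then st
    else ((t.1.1 * st.2, t.2) :: [seq (t.1.2 * u.1, u.2) | u <- st.1], t.1.2 * st.2))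
    ([::], 1) p.

Lemma clear_denominators_neq0 p : (clear_denominators p).2 != 0.
Proof.
elim: p => [|t p IHp] /=; first exact: oner_neq0.
by have [//|t0] := eqVneq t.1.2 0; rewrite /= mulf_neq0.
Qed.

Lemma clear_denominatorsE p (mon : seq nat -> K) :
  \sum_(u <- (clear_denominators p).1) F u.1 * mon u.2 =
  F (clear_denominators p).2 * \sum_(t <- p) F t.1.1 / F t.1.2 * mon t.2.
Proof.
elim: p => [|t p IHp]; first by rewrite !big_nil mulr0.
rewrite big_cons /=; have [->|t0] := eqVneq t.1.2 0; first by rewrite rmorph0 invr0 mulr0 mul0r add0r.
have F0 : F t.1.2 != 0 by rewrite tofrac_eq0.
rewrite big_cons big_map /= (eq_bigr (fun u => F t.1.2 * (F u.1 * mon u.2))); last first.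
  by move=> u _; rewrite rmorphM mulrA.
rewrite -mulr_sumr IHp !rmorphM /=; set X := \sum_(_ <- p) _.
rewrite mulrDr; congr (_ + _); last by rewrite mulrA.
exact: mulf_div_cancel.
Qed.

Definition tdeg n (l : seq nat) := sumn (texpvec n l).

(** The sum of the degrees; any common upper bound works as the degree of the homogenization. *)
Definition max_deg n (P : seq (R * seq nat)) := sumn [seq tdeg n u.2 | u <- P].

Lemma tdeg_le_max n P u : u \in P -> (tdeg n u.2 <= max_deg n P)%N.
Proof.
rewrite /max_deg; elim: P => //= w P IHP; rewrite inE => /predU1P[->|/IHP H]; first exact: leq_addr.
exact: leq_trans H (leq_addl _ _).
Qed.

Lemma tdegE n l : tdeg n l = (\sum_(i < n) nth 0%N l i)%N.
Proof. by rewrite /tdeg sumn_texpvec mdegE; apply: eq_bigr => i _; rewrite expvecE. Qed.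

Definition thom n (P : seq (R * seq nat)) : seq (R * seq nat) :=
  [seq (u.1, (max_deg n P - tdeg n u.2)%N :: u.2) | u <- P].

(* The homogenization of P in the variables x0, x_0, ..., x_(n-1). *)
Definition hom_eval n (P : seq (R * seq nat)) (x0 : R) (x : nat -> R) : R :=
  \sum_(u <- P) u.1 * (x0 ^+ (max_deg n P - tdeg n u.2) * \prod_(i < n) x i ^+ nth 0%N u.2 i).

Lemma meval_thom n P (v : 'I_n.+1 -> R) x0 (x : nat -> R) : v ord0 = x0 ->
  (forall i : 'I_n, v (lift ord0 i) = x i) ->
  meval v (tpoly n.+1 (thom n P)) = hom_eval n P x0 x.
Proof.
move=> v0 vx; rewrite meval_tpoly big_map; apply: eq_bigr => u _; rewrite /= big_ord_recl v0.
by congr (_ * (_ * _)); apply: eq_bigr => i _; rewrite vx.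
Qed.

Lemma hom_eval_scale n P r x0 (x : nat -> R) :
  hom_eval n P (r * x0) (fun i => r * x i) = r ^+ max_deg n P * hom_eval n P x0 x.
Proof.
rewrite /hom_eval mulr_sumr big_seq [RHS]big_seq; apply: eq_bigr => u uP.
rewrite [RHS]mulrCA; congr (_ * _).
rewrite (eq_bigr (fun i : 'I_n => r ^+ nth 0%N u.2 i * x i ^+ nth 0%N u.2 i)); last first.
  by move=> i _; rewrite exprMn.
rewrite big_split /= prodrXr -tdegE exprMn mulrACA -exprD subnK //.
exact: tdeg_le_max.
Qed.

Lemma thom_dhomog n P : tpoly n.+1 (thom n P) \is ishomog1 (max_deg n P) (@mdeg n.+1).
Proof.
rewrite /tpoly big_map big_seq; apply: rpred_sum => u uP; apply: rpredZ.
rewrite dhomogX /= -sumn_texpvec; apply/eqP.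
rewrite [LHS](tdegE n.+1) big_ord_recl /=.
rewrite (eq_bigr (fun i : 'I_n => nth 0%N u.2 i)) // -tdegE subnK //.
exact: tdeg_le_max.
Qed.

Definition frac_root n (P : seq (R * seq nat)) :=
  exists y : nat -> K, \sum_(u <- P) F u.1 * \prod_(i < n) y i ^+ nth 0%N u.2 i = 0.

Lemma codes_has_root k : codes (frac_elt phi) (@has_root K) k <->
  frac_root (code_vars k) (clear_denominators (frac_terms k)).1.
Proof.
rewrite codes_fracE /has_root /mkset; move: (code_vars k) (frac_terms k) => n p.
have d0 : F (clear_denominators p).2 != 0 by rewrite tofrac_eq0 clear_denominators_neq0.
have E (y : nat -> K) : \sum_(u <- (clear_denominators p).1) F u.1 * \prod_(i < n) y i ^+ nth 0%N u.2 i
    = F (clear_denominators p).2 *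
      meval (fun i => y i) (tpoly n [seq (F t.1.1 / F t.1.2, t.2) | t <- p]).
  by rewrite (clear_denominatorsE p (fun l => \prod_(i < n) y i ^+ nth 0%N l i)) meval_tpoly big_map.
split=> [[a a0]|[y]]; last first.
  by rewrite (E y) => /eqP; rewrite mulf_eq0 (negbTE d0) => /eqP y0; exists (fun i => y i).
pose y j := oapp a 0 (insub j : option 'I_n).
exists y; rewrite (E y); apply/eqP; rewrite mulf_eq0; apply/orP; right.
by rewrite -a0; apply/eqP/meval_eq => i; rewrite /y valK.
Qed.

Lemma hom_eval_frac n P x0 x (x00 : x0 != 0) : F (hom_eval n P x0 x) =
  F x0 ^+ max_deg n P * \sum_(u <- P) F u.1 * \prod_(i < n) (F (x i) / F x0) ^+ nth 0%N u.2 i.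
Proof.
have F0 : F x0 != 0 by rewrite tofrac_eq0.
rewrite /hom_eval rmorph_sum mulr_sumr big_seq [RHS]big_seq; apply: eq_bigr => u uP.
rewrite !rmorphM /= [RHS]mulrCA; congr (_ * _).
rewrite rmorphXn rmorph_prod -{2}(subnK (tdeg_le_max n uP)) exprD -mulrA; congr (_ * _).
rewrite tdegE -prodrXr -big_split /=; apply: eq_bigr => i _.
by rewrite rmorphXn -exprMn mulrC divfK.
Qed.

Lemma frac_root_of_hom n P x0 x : x0 != 0 -> hom_eval n P x0 x = 0 -> frac_root n P.
Proof.
move=> x00 H; exists (fun i => F (x i) / F x0).
have := hom_eval_frac n P x x00; rewrite H rmorph0 => /esym/eqP.
by rewrite mulf_eq0 expf_eq0 tofrac_eq0 (negbTE x00) andbF /= => /eqP.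
Qed.

Lemma common_denominator n (y : nat -> K) : exists x0 (x : nat -> R), x0 != 0 /\
  forall i, (i < n)%N -> y i = F (x i) / F x0.
Proof.
elim: n => [|n [x0 [x [x00 Hx]]]]; first by exists 1, (fun=> 0); split; first exact: oner_neq0.
have [a [b [b0 yn]]] := fraction_quot (y n).
exists (x0 * b), (fun i => if i == n then a * x0 else x i * b); split; first by rewrite mulf_neq0.
move=> i; rewrite ltnS leq_eqVlt.
have [Fx Fb] : F x0 != 0 /\ F b != 0 by rewrite !tofrac_eq0.
have [-> _|_ /= /Hx ->] := eqVneq i n; rewrite !rmorphM; last exact: divf_mulr.
by rewrite yn [F x0 * _]mulrC; exact: divf_mulr.
Qed.

Lemma hom_root n P : frac_root n P -> exists x0 x, x0 != 0 /\ hom_eval n P x0 x = 0.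
Proof.
move=> [y y0]; have [x0 [x [x00 Hx]]] := common_denominator n y.
exists x0, x; split=> //; apply/eqP; rewrite -tofrac_eq0 hom_eval_frac //.
rewrite mulf_eq0; apply/orP; right; apply/eqP; rewrite -[RHS]y0; apply: eq_bigr => u _.
by congr (_ * _); apply: eq_bigr => i _; rewrite -Hx.
Qed.

(* Every root can be written with nonzero beta_j, since R is infinite. *)
Lemma hom_root_split n P : frac_root n P -> exists x0 (beta : nat -> R),
  [/\ x0 != 0, forall j, beta j != 0 &
      hom_eval n P x0 (fun i => beta i.*2 + beta i.*2.+1) = 0].
Proof.
move=> /hom_root[x0 [x [x00 H]]]; exists x0.
have Ht (b : R) : exists t, t \notin [:: 0; b] by apply: exists_fresh (@elt_inj R phi) _.
have [t tP] := choice Ht.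
(* The summands of x_i are t and x_i - t, where t differs from 0 and from x_i. *)
exists (fun j => if odd j then x j./2 - t (x j./2) else t (x j./2)); split=> //.
  move=> j; have := tP (x j./2); rewrite !inE negb_or => /andP[t0 tx].
  by case: ifP => // _; rewrite subr_eq0 eq_sym.
rewrite -[RHS]H /hom_eval; apply: eq_bigr => u _; congr (_ * (_ * _)).
by apply: eq_bigr => i _; rewrite /= odd_double /= uphalf_double doubleK addrC subrK.
Qed.

(* x0 is v_4n - v_(4n+1) if b, and v_4n otherwise, in N variables. *)
Definition tneg (N i : nat) : seq (R * seq nat) := [:: (-1, @unitvec N i)].

Definition head_form (b : bool) (N n : nat) : seq (R * seq nat) :=
  tvar R N (4 * n)%N ++ if b then tneg N (4 * n).+1 else [::].

Definition pair_form (N i : nat) : seq (R * seq nat) :=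
  tvar R N (4 * i)%N ++ tneg N (4 * i + 1)%N ++ tvar R N (4 * i + 2)%N ++ tneg N (4 * i + 3)%N.

Definition lin_forms (b : bool) (N n : nat) :=
  head_form b N n :: [seq pair_form N i | i <- iota 0 n].

Lemma nth_lin_forms b N n i : (i < n)%N -> nth [::] (lin_forms b N n) i.+1 = pair_form N i.
Proof.
move=> lt_i; transitivity (nth [::] [seq pair_form N i | i <- iota 0 n] i) => //.
by rewrite (nth_map 0%N) ?size_iota // nth_iota.
Qed.

(** There are 4 n variables for the x_i and one or two for x_0. The total is written as a successor
    because codes store the number of variables minus one. *)
Definition target_terms (b : bool) (n : nat) P :=
  tsubst n.+1 (lin_forms b (4 * n + b)%N.+1 n) (thom n P).

Definition target (b : bool) (n : nat) P : mpoly (4 * n + b).+1 R := tpoly (4 * n + b).+1 (target_terms b n P).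

Lemma meval_tvar_nat N (v : nat -> R) i : (i < N)%N ->
  meval (fun j : 'I_N => v j) (tpoly N (tvar R N i)) = v i.
Proof. by move=> iN; rewrite (meval_tvar (fun j : 'I_N => v j) (Ordinal iN)). Qed.

Lemma meval_tneg_nat N (v : nat -> R) i : (i < N)%N ->
  meval (fun j : 'I_N => v j) (tpoly N (tneg N i)) = - v i.
Proof.
move=> iN; have -> : tpoly N (tneg N i) = - tpoly N (tvar R N i).
  by rewrite /tpoly !big_seq1 scaleN1r scale1r.
by rewrite mevalN meval_tvar_nat.
Qed.

Lemma meval_target b n P (v : nat -> R) :
  meval (fun j : 'I__ => v j) (target b n P) =
  hom_eval n P (v (4 * n)%N - if b then v (4 * n).+1 else 0)
    (fun i => (v (4 * i)%N - v (4 * i + 1)%N) + (v (4 * i + 2)%N - v (4 * i + 3)%N)).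
Proof.
rewrite /target /target_terms tpoly_tsubst comp_mpoly_meval.
apply: meval_thom => [|i]; rewrite tnth_mktuple.
  rewrite -[nth _ _ _]/(head_form b _ n) tpoly_cat mevalD meval_tvar_nat ?ltnS ?leq_addr //; congr (_ + _).
  case: b; last by rewrite /tpoly big_nil meval0 oppr0.
  by rewrite meval_tneg_nat //; lia.
have lt_i := ltn_ord i; rewrite -[nth _ _ _]/(nth [::] (lin_forms b (4 * n + b).+1 n) i.+1).
rewrite nth_lin_forms // !tpoly_cat !mevalD.
by rewrite !meval_tvar_nat ?meval_tneg_nat ?addrA //; lia.
Qed.

Lemma tvar_dhomog N i : (i < N)%N -> tpoly N (tvar R N i) \is ishomog1 1 (@mdeg N).
Proof.
move=> iN; rewrite /tpoly big_seq1 scale1r dhomogX /= -sumn_texpvec; apply/eqP.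
rewrite [LHS](tdegE N) (bigD1 (Ordinal iN)) //= big1 ?addn0 => [|j ji].
  by rewrite (nth_map 0%N) ?size_iota // nth_iota // eqxx.
rewrite (nth_map 0%N) ?size_iota // nth_iota // add0n.
by apply/eqP; rewrite eqb0; apply: contraNneq ji => ji; apply/eqP/val_inj.
Qed.

Lemma tneg_dhomog N i : (i < N)%N -> tpoly N (tneg N i) \is ishomog1 1 (@mdeg N).
Proof.
move=> iN; have -> : tpoly N (tneg N i) = - tpoly N (tvar R N i).
  by rewrite /tpoly !big_seq1 scaleN1r scale1r.
by rewrite rpredN tvar_dhomog.
Qed.

Lemma target_homogeneous b n P : homogeneous (target b n P).
Proof.
exists (max_deg n P); rewrite /target /target_terms tpoly_tsubst.
apply: dhomog_comp (thom_dhomog n P) => i; rewrite tnth_mktuple.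
case: (unliftP ord0 i) => [j|] ->.
  have lt_j := ltn_ord j.
  rewrite -[nth _ _ _]/(nth [::] (lin_forms b (4 * n + b).+1 n) j.+1).
  rewrite nth_lin_forms // !tpoly_cat.
  by rewrite !rpredD ?tvar_dhomog ?tneg_dhomog //; lia.
rewrite -[nth _ _ _]/(head_form b _ n) tpoly_cat rpredD ?tvar_dhomog ?ltnS ?leq_addr //.
case: b; last by rewrite /tpoly big_nil; exact: dhomog0.
by rewrite tneg_dhomog //; lia.
Qed.

Lemma target_translation_invariant n P : translation_invariant (target true n P).
Proof.
apply/(translation_invariantP phi) => v r.
pose w j := oapp v 0 (insub j : option 'I_(4 * n + true).+1).
have wE (j : 'I_(4 * n + true).+1) : v j = w j by rewrite /w valK.
transitivity (meval (fun j : 'I__ => w j + r) (target true n P)).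
  by apply: meval_eq => j; rewrite wE.
transitivity (meval (fun j : 'I__ => w j) (target true n P)); last first.
  by apply: meval_eq => j; rewrite wE.
rewrite (meval_target true n P (fun j => w j + r)) meval_target.
have E (a b : R) : a + r - (b + r) = a - b by ring.
by rewrite /hom_eval E; under eq_bigr do under eq_bigr do rewrite !E.
Qed.

End Reduction.

(** Values indexed by [nat] avoid ordinal arithmetic with the variable numbers 4 * i + c. *)
Definition extend (T : Type) (x0 : T) M (y : 'I_M -> T) (j : nat) : T := oapp y x0 (insub j).

Lemma extendE T (x0 : T) M (y : 'I_M -> T) (i : 'I_M) : extend x0 y i = y i.
Proof. by rewrite /extend valK. Qed.

Lemma extend_lt T (x0 : T) M (y : 'I_M -> T) j (jM : (j < M)%N) :
  extend x0 y j = y (Ordinal jM).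
Proof. exact: (extendE x0 y (Ordinal jM)). Qed.

Section Target.
Variables (R : idomainType) (phi : computable_domain R).
Variables (n : nat) (P : seq (R * seq nat)).

Lemma meval_extend (b : bool) (a : 'I_(4 * n + b).+1 -> R) :
  meval a (target b n P) = meval (fun j : 'I__ => extend 0 a j) (target b n P).
Proof. by apply: meval_eq => j; rewrite extendE. Qed.

Lemma target_no_injective_root B : ~ frac_root n P -> ~ flag_root true (target true n P) B.
Proof.
move=> nP [a [/(_ isT) ia _]]; rewrite meval_extend meval_target; apply: contra_not nP.
apply: frac_root_of_hom; rewrite subr_eq0.
have h1 : (4 * n < (4 * n + true).+1)%N by lia.
have h2 : ((4 * n).+1 < (4 * n + true).+1)%N by lia.
rewrite (extend_lt _ _ h1) (extend_lt _ _ h2); apply/eqP => /ia/(congr1 val) /=; lia.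
Qed.

Lemma target_no_nonzero_root (B : set R) : ~ frac_root n P -> (forall x, B x -> x != 0) ->
  ~ flag_root false (target false n P) B.
Proof.
move=> nP B0 [a [_ aB]]; rewrite meval_extend meval_target; apply: contra_not nP.
apply: frac_root_of_hom; rewrite subr0.
have h1 : (4 * n < (4 * n + false).+1)%N by lia.
rewrite (extend_lt _ _ h1); exact/B0/aB.
Qed.

(** The pair (y j, z j) is assigned to the variables 2 j and 2 j + 1, so the form for x_i reads the
    pairs 2 i and 2 i + 1. *)
Definition interleave M (y z : 'I_M -> R) (j : nat) : R :=
  if odd j then extend 0 z j./2 else extend 0 y j./2.

Lemma interleave_inj M (b y z : 'I_M -> R) r i j : spread b r y z ->
  (i < 2 * M)%N -> (j < 2 * M)%N -> interleave y z i = interleave y z j -> i = j.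
Proof.
move=> [yi zi yz _] iM jM; have hi : (i./2 < M)%N by lia.
have hj : (j./2 < M)%N by lia.
rewrite /interleave !(extend_lt _ _ hi) !(extend_lt _ _ hj).
have E : i./2 = j./2 -> odd i = odd j -> i = j by lia.
case: ifP => oi; case: ifP => oj.
- by move=> /zi[] /E; apply; rewrite oi oj.
- by move=> /esym/eqP; rewrite (negbTE (yz _ _)).
- by move=> /eqP; rewrite (negbTE (yz _ _)).
- by move=> /yi[] /E; apply; rewrite oi oj.
Qed.

Lemma interleave_diff M (b y z : 'I_M -> R) r j (jM : (j < M)%N) : spread b r y z ->
  interleave y z (2 * j) - interleave y z (2 * j + 1) = r * b (Ordinal jM).
Proof.
move=> [_ _ _ yzb]; rewrite /interleave mul2n addn1 /= odd_double /= uphalf_double doubleK.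
by rewrite !(extend_lt _ _ jM).
Qed.

Lemma interleave_in M (y z : 'I_M -> R) (A : R -> Prop) j : (j < 2 * M)%N ->
  (forall i, A (y i) /\ A (z i)) -> A (interleave y z j).
Proof.
move=> jM H; have hj : (j./2 < M)%N by lia.
by rewrite /interleave !(extend_lt _ _ hj); case: ifP => _; case: (H (Ordinal hj)).
Qed.

Lemma target_dense_root k : frac_root n P -> exists T : seq R,
  [/\ (0 < size T)%N, uniq T, 0 \notin T & forall T', uniq T' -> {subset T' <= T} ->
    (size T <= k * size T')%N -> flag_root true (target true n P) [set x | x \in T']].
Proof.
move=> /(hom_root_split phi)[x0 [beta [x00 beta0 H]]].
(* The first 2 n differences are those of the beta, and the last one is reserved for x_0. *)
pose b (j : 'I_(2 * n).+1) := if j == (2 * n)%N :> nat then x0 else beta j.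
have [||D _ /(_ [:: 0])[T [T0 uT TE HT]]] := @dense_differences R (elt phi) (@elt_inj R phi) _ b k.
- by rewrite card_ord.
- by move=> j; rewrite /b; case: ifP.
exists T; split=> //; first by apply/negP => /TE; rewrite mem_head.
move=> T' uT' sT' cT'; have [r _ [y [z [yzT Hs]]]] := HT T' uT' sT' cT'.
pose v := interleave y z.
have diff j (jn : (j < (2 * n).+1)%N) : v (2 * j)%N - v (2 * j + 1)%N = r * b (Ordinal jn).
  exact: interleave_diff.
exists (fun j => v j); split.
- move=> _ i j E; apply: val_inj; apply: (interleave_inj Hs) E.
    by have := ltn_ord i; lia.
  by have := ltn_ord j; lia.
- move=> j; apply: (interleave_in (A := fun x => x \in T')) => //.
  by have := ltn_ord j; lia.
rewrite meval_target.
have -> : v (4 * n)%N - v (4 * n).+1 = r * x0.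
  have := diff (2 * n)%N (ltnSn _); rewrite /b eqxx => <-.
  by congr (v _ - v _); lia.
(* All the forms take r times their values at the known root, so homogeneity pulls out a power of
   r. *)
rewrite -[RHS](mulr0 (r ^+ max_deg n P)) -H -hom_eval_scale /hom_eval.
apply: eq_bigr => u _; congr (_ * (_ * _)); apply: eq_bigr => i _; congr (_ ^+ _).
have lt_i := ltn_ord i.
have h1 : (i.*2 < (2 * n).+1)%N by lia.
have h2 : (i.*2.+1 < (2 * n).+1)%N by lia.
rewrite mulrDr; have := diff _ h1; have := diff _ h2; rewrite /b /=.
have -> : (i.*2 == 2 * n)%N = false by lia.
have -> : (i.*2.+1 == 2 * n)%N = false by lia.
by move=> <- <-; congr (v _ - v _ + (v _ - v _)); lia.
Qed.

Lemma target_partition_root l : (0 < n)%N -> frac_root n P -> exists T : seq R,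
  0 \notin T /\ forall (c : R -> nat) Cs, (size Cs <= l)%N -> {in T, forall x, c x \in Cs} ->
    exists j, flag_root true (target false n P) [set x | x \in T /\ c x = j].
Proof.
move=> n0 /(hom_root_split phi)[x0 [beta [x00 beta0 H]]].
pose b (j : 'I_(2 * n)) := beta j.
have [||T [T0 nT HT]] := @brauer R (elt phi) (@elt_inj R phi) _ x0 b l _ x00.
- by rewrite card_ord; lia.
- by move=> j; exact: beta0.
exists T; split=> // c Cs sC Hc; have [j [r [y [z [r0 Aw Ayz Hs nw]]]]] := HT c Cs sC Hc.
(* The element r * x0 that Brauer's argument puts in the same class is the value of the single
   variable for x_0. *)
exists j; pose v (k : nat) : R := if k == (4 * n)%N then r * x0 else interleave y z k.
have vE k : (k < 4 * n)%N -> v k = interleave y z k by rewrite /v => lt_k; case: eqP => // ; lia.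
have diff i (hi : (i < 2 * n)%N) : v (2 * i)%N - v (2 * i + 1)%N = r * beta i.
  by rewrite !vE; [exact: (interleave_diff hi Hs)|lia|lia].
have nv k : (k < 4 * n)%N -> interleave y z k != r * x0.
  move=> lt_k; apply: (interleave_in (A := fun x => x != r * x0)) => //; lia.
exists (fun j => v j); split.
- move=> _ [i lt_i] [i' lt_i'] E; apply: val_inj => /=; move: E; rewrite /v /=.
  case: eqP => [->|ni]; case: eqP => [->|ni'] // E.
  + have h : (i' < 4 * n)%N by lia.
    by have := nv i' h; rewrite -E eqxx.
  + have h : (i < 4 * n)%N by lia.
    by have := nv i h; rewrite E eqxx.
  + by apply: (interleave_inj Hs) E; lia.
- move=> [i lt_i]; rewrite /v /=; case: eqP => // ni.
  by apply: (interleave_in (A := fun x => x \in T /\ c x = j)) => //; lia.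
rewrite meval_target subr0.
have -> : v (4 * n)%N = r * x0 by rewrite /v eqxx.
rewrite -[RHS](mulr0 (r ^+ max_deg n P)) -H -hom_eval_scale /hom_eval.
apply: eq_bigr => u _; congr (_ * (_ * _)); apply: eq_bigr => i _; congr (_ ^+ _).
have lt_i := ltn_ord i.
have h1 : (i.*2 < 2 * n)%N by lia.
have h2 : (i.*2.+1 < 2 * n)%N by lia.
rewrite mulrDr; have := diff _ h1; have := diff _ h2.
by move=> <- <-; congr (v _ - v _ + (v _ - v _)); lia.
Qed.

End Target.

Section DensityTarget.
Variables (R : idomainType) (phi : computable_domain R) (rT : realType).
Variables (S : choiceType) (op : S -> S -> S) (v : S -> R) (e : nat -> S) (P : pred nat).
Hypothesis opC : commutative op.
Hypothesis opI : forall s, injective (op s).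
Hypothesis eP : forall i, P i -> num phi (v (e i)) = i.
Hypothesis P_neq0 : forall t, t != 0 -> P (num phi t).

Lemma dense_root n (p : mpoly n R) (delta : rT) : 0 < delta ->
  (forall s (A : set S), flag_root true p (v @` dilate op s A) -> flag_root true p (v @` A)) ->
  (forall k, exists T : seq R,
    [/\ (0 < size T)%N, uniq T, 0 \notin T & forall T', uniq T' -> {subset T' <= T} ->
      (size T <= k * size T')%N -> flag_root true p [set x | x \in T']]) ->
  forall A : set S, (delta%:E <= upper_Banach_density op rT A)%E -> flag_root true p (v @` A).
Proof.
(* As k >= 1 / delta, a subset T' with at least delta |T| elements satisfies |T| <= k |T'|. *)
move=> delta0 Hdil HT A HA; pose k := (Num.truncn delta^-1).+1.
have Hk : 1 <= k%:R * delta by rewrite -ler_pdivrMr // div1r ltW // truncnS_gt.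
have [T [T0 uT nT {}HT]] := HT k.
have veK t : t \in T -> v (e (num phi t)) = t.
  move=> tT; apply: (can_inj (numK phi)); rewrite eP // P_neq0 //.
  by apply: contraNneq nT => <-.
pose W := [fset e (num phi t) | t in T]%fset.
have pW : perm_eq W [seq e (num phi t) | t <- T].
  apply: uniq_perm; first exact: fset_uniq.
    by rewrite map_inj_in_uniq // => s t sT tT E; rewrite -(veK s) // E veK.
  by move=> s; apply/imfsetP/mapP => /= -[t tT ->]; exists t.
have cW : #|` W| = size T by rewrite (perm_size pW) size_map.
have W0 : W != fset0 by rewrite -cardfs_gt0 cW.
have [s Hs] := exists_dense_dilate opC opI e HA W0.
apply: (Hdil s); pose T' := [seq t <- T | e (num phi t) \in dilate op s A].
have cT' : size T' = hits W (dilate op s A).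
  by rewrite count_hits size_filter (seq.permP pW) count_map.
have /flag_root_sub : flag_root true p [set x | x \in T'].
  apply: HT; first exact: filter_uniq.
    by move=> t; rewrite mem_filter => /andP[].
  rewrite -(ler_nat rT) natrM cT' -cW.
  apply: (@le_trans _ _ (k%:R * (delta * #|` W|%:R))); last by rewrite ler_pM2l // ltr0n.
  by rewrite mulrA ler_peMl.
apply=> t; rewrite /= mem_filter => /andP[tA tT].
by exists (e (num phi t)); [exact: set_mem | exact: veK].
Qed.

End DensityTarget.

(** * Hardness by reduction, and the classification *)

Section Hardness.
Variables (R : idomainType) (phi : computable_domain R).

Definition cleared k := (clear_denominators (frac_terms phi k)).1.

Definition target_code (b : bool) k : nat :=
  terms_code phi (4 * code_vars k + b) (target_terms b (code_vars k) (cleared k)).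

Lemma cp_target_code b : computable (target_code b).
Proof.
assert (Hp : computable cleared).
  by rewrite /cleared /clear_denominators /frac_terms; cp.
assert (Hp1 : forall (A : Type) (eA : Enc A) (f : A -> nat), computable f -> computable (fun a => cleared (f a))).
  by move=> A eA f; exact: cp_comp.
rewrite /target_code /target_terms /lin_forms /head_form /pair_form /thom /max_deg /tdeg /texpvec /tneg /tvar /unitvec.
by case: b; cp; apply: Hp1; cp.
Qed.

Lemma codes_target_code (Q : poly_set R) b k :
  codes (elt phi) Q (target_code b k) <-> Q _ (target b (code_vars k) (cleared k)).
Proof. exact: codes_terms_code. Qed.

Lemma hard_of_target (Q : poly_set R) b : HTP_undecidable phi ->
  (forall n P, (0 < n)%N -> frac_root n P -> Q _ (target b n P)) ->
  (forall n P, (0 < n)%N -> Q _ (target b n P) -> frac_root n P) ->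
  Sigma01_hard (codes (elt phi) Q).
Proof.
move=> HTP HQ1 HQ2 B /HTP[f cf fP].
pose g (s : seq nat) := f [tuple nth 0%N s 0].
assert (cg : computable g).
  assert (Hs : computable (fun s : seq nat => [:: nth 0%N s 0])) by cp.
  exact: (cp_computable_fun (s := fun s : seq nat => [tuple nth 0%N s 0]) cf Hs).
exists (fun v => target_code b (f v)).
  apply: (computable_fun_of (g := fun s => target_code b (g s))).
    exact: (cp_comp (cp_target_code b) cg).
  move=> v; rewrite /g; congr (target_code b (f _)).
  by apply: eq_from_tnth => i; rewrite (ord1 i) !(tnth_nth 0%N).
move=> v; rewrite fP codes_has_root codes_target_code.
by split; [exact: HQ1 | exact: HQ2].
Qed.

End Hardness.

Section Classification.
Variables (R : idomainType) (phi : computable_domain R) (rT : realType).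
Local Notation nz := (nonzero R).
Local Notation code := (codes (elt phi)).

(** The number of 0 is sent to 1, which makes the enumeration of the nonzero elements total. *)
Definition nonzero_elt (i : nat) : nz := insubd (exist _ 1 (oner_neq0 R) : nz) (elt phi i).

Lemma nonzero_eltK (s : nz) : nonzero_elt (num phi (val s)) = s.
Proof. by rewrite /nonzero_elt numK valKd. Qed.

Lemma val_nonzero_elt i : elt phi i != 0 -> num phi (val (nonzero_elt i)) = i.
Proof. by move=> i0; rewrite /nonzero_elt insubdK ?eltK. Qed.

Lemma nonzero_mulA : associative (@nonzero_mul R).
Proof. by move=> x y z; apply: val_inj; rewrite /= mulrA. Qed.

Lemma nonzero_mulC : commutative (@nonzero_mul R).
Proof. by move=> x y; apply: val_inj; rewrite /= mulrC. Qed.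

Lemma nonzero_mulI (s : nz) : injective (nonzero_mul s).
Proof. by move=> x y /(congr1 val) /(mulfI (valP s)) /val_inj. Qed.

Lemma inj_root_inE n (p : mpoly n R) B : inj_root_in p B <-> flag_root true p B.
Proof.
by split=> -[a []]; [move=> ia aB a0 | move=> /(_ isT) ia aB a0]; exists a; split.
Qed.

Lemma IADR_E (delta : rT) n (p : mpoly n R) : IADR delta p <->
  forall A : set R, (delta%:E <= upper_Banach_density +%R rT A)%E -> flag_root true p (id @` A).
Proof.
by split=> H A HA; [rewrite image_id; apply/inj_root_inE/H | apply/inj_root_inE; rewrite -(image_id A); exact: H].
Qed.

Lemma IMDR_E (delta : rT) n (p : mpoly n R) : IMDR delta p <->
  forall A : set nz, (delta%:E <= upper_Banach_density (@nonzero_mul R) rT A)%E ->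
    flag_root true p (val @` A).
Proof.
split=> H A HA.
  apply/inj_root_inE/H; rewrite /mul_density.
  suff -> : [set x : nz | [set val x | x in A] (val x)] = A by [].
  by apply/seteqP; split=> x; [case=> y Ay /val_inj <- | move=> Ax; exists x].
apply/inj_root_inE; have := H _ HA; apply: flag_root_sub => _ [x Bx <-].
exact: Bx.
Qed.

Lemma root_translate n (p : mpoly n R) : translation_invariant p -> forall s (A : set R),
  flag_root true p (id @` dilate +%R s A) -> flag_root true p (id @` A).
Proof.
move=> /(translation_invariantP phi) Tp s A; rewrite !image_id => -[a [ia aA a0]].
exists (fun i => a i + s); split.
- by move=> _ i j /addIr /ia; exact.
- by move=> i; have := aA i; rewrite /dilate /= addrC.
- by rewrite Tp.
Qed.

Lemma root_dilate n (p : mpoly n R) : homogeneous p -> forall (s : nz) (A : set nz),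
  flag_root true p (val @` dilate (@nonzero_mul R) s A) -> flag_root true p (val @` A).
Proof.
move=> [d Hp] s A [a [ia aA a0]]; exists (fun i => val s * a i); split.
- by move=> _ i j /(mulfI (valP s)) /ia; exact.
- by move=> i; case: (aA i) => x Ax <-; exists (nonzero_mul s x).
- by rewrite (meval_homog _ _ Hp) a0 mulr0.
Qed.

Lemma cp_elt_neq0 : computable (fun i : nat => elt phi i != 0).
Proof.
by cp.
Qed.

Lemma semidecidable_IADR (delta : rT) : 0 < delta -> left_ce delta ->
  semidecidable (code (poly_setI (@IADR R rT delta) (@translation_invariant R))).
Proof.
move=> delta0 dce.
apply: (@semidecidable_density R phi rT R +%R id (elt phi) predT (@addrA R) (@addrC R) (@addrI R)
  (numK phi) (fun _ => isT) (fun i _ => eltK phi i) delta) => //.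
- exact: cp_const.
- exact: semidecidable_translation_invariant.
- exact: root_translate.
- exact: IADR_E.
Qed.

Lemma semidecidable_IMDR (delta : rT) : 0 < delta -> left_ce delta ->
  semidecidable (code (poly_setI (@IMDR R rT delta) (@homogeneous R))).
Proof.
move=> delta0 dce.
apply: (@semidecidable_density R phi rT nz (@nonzero_mul R) val nonzero_elt
  (fun i => elt phi i != 0) nonzero_mulA nonzero_mulC nonzero_mulI
  nonzero_eltK _ val_nonzero_elt delta) => //.
- by move=> s; rewrite numK (valP s).
- exact: cp_elt_neq0.
- exact: semidecidable_homogeneous.
- exact: root_dilate.
- exact: IMDR_E.
Qed.

Hypothesis HTP : HTP_undecidable phi.

Lemma IADR_hard (delta : rT) : 0 < delta <= 1 ->
  Sigma01_hard (code (poly_setI (@IADR R rT delta) (@translation_invariant R))).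
Proof.
move=> /andP[delta0 delta1]; apply: (@hard_of_target R phi _ true HTP) => n P n0.
  move=> rP; split; last exact: (target_translation_invariant phi).
  apply/IADR_E; apply: (@dense_root R phi rT R +%R id (elt phi) predT (@addrC R) (@addrI R)
    (fun i _ => eltK phi i) (fun _ _ => isT)) => //.
    exact: root_translate (target_translation_invariant phi n P).
  by move=> k; exact: (target_dense_root phi).
(* Here delta <= 1 enters: the whole of R has density at least delta, so it would contain an
   injective root of the target. *)
move=> [HI _]; apply: contrapT => nP.
apply: (target_no_injective_root (B := setT) nP); apply/inj_root_inE/HI.
exact: (@upper_Banach_density_setT R +%R rT (@addrA R) (@addrC R) (@addrI R) (elt phi) (num phi) (numK phi)).
Qed.

Lemma IMDR_hard (delta : rT) : 0 < delta <= 1 ->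
  Sigma01_hard (code (poly_setI (@IMDR R rT delta) (@homogeneous R))).
Proof.
move=> /andP[delta0 delta1]; apply: (@hard_of_target R phi _ true HTP) => n P n0.
  move=> rP; split; last exact: target_homogeneous.
  apply/IMDR_E; apply: (@dense_root R phi rT nz (@nonzero_mul R) val nonzero_elt
    (fun i => elt phi i != 0) nonzero_mulC nonzero_mulI val_nonzero_elt) => //.
  - by move=> t; rewrite numK.
  - exact: root_dilate (target_homogeneous true n P).
  - by move=> k; exact: (target_dense_root phi).
move=> [HI _]; apply: contrapT => nP.
apply: (target_no_injective_root (B := setT) nP); apply/inj_root_inE/HI.
exact: (@upper_Banach_density_setT nz (@nonzero_mul R) rT nonzero_mulA nonzero_mulC nonzero_mulI
  nonzero_elt (fun s => num phi (val s)) nonzero_eltK).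
Qed.

Lemma target_IPRl n (P : seq (R * seq nat)) l : (0 < n)%N -> (0 < l)%N -> frac_root n P -> IPRl l (target false n P).
Proof.
move=> n0 l0 rP C [_ CT].
have [T [nT HT]] := target_partition_root phi l n0 rP.
have HC x : exists i : 'I_l, x != 0 -> C i x.
  have [->|x0] := eqVneq x 0; first by exists (Ordinal l0).
  have : (\bigcup_i C i) x by rewrite CT.
  by case=> i _ Cx; exists i.
have [c Hc] := choice HC.
have [||j Hj] := HT (fun x => val (c x)) (iota 0 l).
- by rewrite size_iota.
- by move=> x _; rewrite mem_iota ltn_ord.
(* The colour j comes without a bound; as the colour of the first coordinate of a root it is below
   l. *)
have [a [_ /(_ ord0)[_ cj] _]] := Hj.
have jl : (j < l)%N by rewrite -cj ltn_ord.
exists (Ordinal jl); apply/inj_root_inE; apply: flag_root_sub Hj => x [xT cx].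
have <- : c x = Ordinal jl by apply: val_inj.
by apply: Hc; apply: contraNneq nT => <-.
Qed.

Lemma IPRl_PRl n (p : mpoly n R) l : IPRl l p -> PRl l p.
Proof. by move=> H C /H[i0 [a [_ aC a0]]]; exists i0, a. Qed.

Lemma PRl_target n (P : seq (R * seq nat)) l : (0 < l)%N -> PRl l (target false n P) -> frac_root n P.
Proof.
move=> l0 H; apply: contrapT => nP.
pose C (i : 'I_l) : set R := [set x | x != 0 /\ val i = 0%N].
have [|i0 [a [aC a0]]] := H C.
  split; first by move=> i j _ _ [x [[_ i0] [_ j0]]]; apply: val_inj; rewrite /= i0 j0.
  apply/seteqP; split=> x /=; first by case=> i _ [].
  by move=> x0; exists (Ordinal l0).
apply: (target_no_nonzero_root (B := C i0) nP); first by move=> x [].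
by exists a; split.
Qed.

(** A target lies in every [IPRl] with l > 0 or in no such [PRl], so the same reduction works for
    any Q squeezed between these properties. *)
Lemma partition_hard (Q : poly_set R) l : (0 < l)%N ->
  (forall n p, Q n p -> PRl l p) ->
  (forall n (P : seq (R * seq nat)), (forall l, (0 < l)%N -> IPRl l (target false n P)) -> Q _ (target false n P)) ->
  Sigma01_hard (code Q).
Proof.
move=> l0 Q1 Q2; apply: (@hard_of_target R phi _ false HTP) => n P n0.
  by move=> rP; apply: Q2 => l' l'0; exact: target_IPRl.
by move=> /Q1; exact: PRl_target.
Qed.

End Classification.

Theorem theorem4p2 (R : idomainType) (phi : computable_domain R) (rT : realType)
    (HTP_K : HTP_undecidable phi) :
  let code := codes (elt phi) in
  let H := @homogeneous R in
  let T := @translation_invariant R in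
  let complete_universal A := Sigma01_complete A /\ Sigma01_universal A in
  (forall delta : rT, 0 < delta <= 1 ->
    let A := code (poly_setI (@IADR R rT delta) T) in
    (left_ce delta -> Sigma01_complete A) /\ ~ Pi01 (unary A)
      /\ Sigma01_universal A) /\
  (forall delta : rT, 0 < delta <= 1 ->
    let A := code (poly_setI (@IMDR R rT delta) H) in
    (left_ce delta -> Sigma01_complete A) /\ ~ Pi01 (unary A)
      /\ Sigma01_universal A) /\
  (forall l : nat, (0 < l)%N ->
    [/\ complete_universal (code (@PRl R l)),
        complete_universal (code (@IPRl R l)),
        complete_universal (code (poly_setI (@PRl R l) H)) &
        complete_universal (code (poly_setI (@IPRl R l) H))]) /\
  [/\ Sigma01_hard (code (@PR R)),
      Sigma01_hard (code (@IPR R)),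
      Sigma01_hard (code (poly_setI (@PR R) H)) &
      Sigma01_hard (code (poly_setI (@IPR R) H))].
Proof.
move=> code H T complete_universal.
have complete A : semidecidable A -> Sigma01_hard A -> complete_universal A.
  move=> sA hA; split=> //; split; first exact: semidecidable_Sigma01.
  exact: Sigma01_hard_not_Pi01.
have semiH (Q : poly_set R) : semidecidable (code Q) -> semidecidable (code (poly_setI Q H)).
  by move=> sQ; exact: semidecidable_setI sQ (semidecidable_homogeneous phi).
have homH n (P : seq (R * seq nat)) : H _ (target false n P) := target_homogeneous false n P.
split; [|split; [|split]].
- move=> delta d01; have hA := IADR_hard HTP_K d01; split=> [dce|].
    have [d0 _] := andP d01.
    by case: (complete _ (semidecidable_IADR phi d0 dce) hA).
  by split=> //; exact: Sigma01_hard_not_Pi01.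
- move=> delta d01; have hA := IMDR_hard HTP_K d01; split=> [dce|].
    have [d0 _] := andP d01.
    by case: (complete _ (semidecidable_IMDR phi d0 dce) hA).
  by split=> //; exact: Sigma01_hard_not_Pi01.
- move=> l l0; split; apply: complete.
  + exact: semidecidable_PRl.
  + by apply: (partition_hard HTP_K l0) => // n P /(_ l l0)/IPRl_PRl.
  + exact: semidecidable_IPRl.
  + by apply: (partition_hard HTP_K l0) => [n p /IPRl_PRl //|n P /(_ l l0)].
  + exact/semiH/semidecidable_PRl.
  + apply: (partition_hard HTP_K l0) => [n p [] //|n P /(_ l l0)/IPRl_PRl Hl].
    by split.
  + exact/semiH/semidecidable_IPRl.
  + apply: (partition_hard HTP_K l0) => [n p [/IPRl_PRl //]|n P /(_ l l0) Hl].
    by split.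
split; apply: (partition_hard HTP_K (isT : (0 < 1)%N)).
- by move=> n p; exact.
- by move=> n P Hl l l0; exact/IPRl_PRl/Hl.
- by move=> n p Hp; exact/IPRl_PRl/Hp.
- by [].
- by move=> n p [Hp _]; exact: Hp.
- by move=> n P Hl; split=> // l l0; exact/IPRl_PRl/Hl.
- by move=> n p [Hp _]; exact/IPRl_PRl/Hp.
- by move=> n P Hl; split.
Qed.
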